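(* Let $\{\alpha_n\}_{n\ge1}\subset[0,1)$ be a sequence with $\alpha_n\uparrow1$ satisfying ($\underline{B}_{\{\alpha_n\}}$) $w^*:=\inf_{x\in\mathbb{X}}w(x)<+\infty$ and $\liminf_{n\to\infty}u_{\alpha_n}(x)<+\infty$ for all $x\in\mathbb{X}$; (LEC$_{\{\alpha_n\}}$(ii)) $\lim_{n\to\infty}u_{\alpha_n}(x)$ exists for each $x\in\mathbb{X}$; (LEC$_{\{\alpha_n\}}$(iii)) for each $x\in\mathbb{X}$ and $a\in\mathbb{A}$ the sequence $\{u_{\alpha_n}\}_{n\ge1}$ is asymptotically uniformly integrable with respect to the probability measure $q(\cdot|x,a)$. Suppose that at least one of the following holds: (a) the cost function $c$ is $\mathbb{K}$-inf-compact on $\mathbb{X}\times\mathbb{A}$, the transition probability $q(\cdot|x,a)$ is weakly continuous in $(x,a)\in\mathbb{X}\times\mathbb{A}$, and the sequence of functions $\{u_{\alpha_n}\}_{n\ge1}$ is lower semi-equicontinuous on $\mathbb{X}$; (b) for each $x\in\mathbb{X}$ the function $a\mapsto c(x,a)$ is inf-compact on $\mathbb{A}$, and for each $x\in\mathbb{X}$ the transition probability $q(\cdot|x,a)$ is setwise continuous in $a\in\mathbb{A}$. If, in addition, $\lim_{n\to\infty}(1-\alpha_n)m_{\alpha_n}=\underline{w}$, then $w^*=\overline{w}=\underline{w}$ and, with $u(x):=\liminf_{n\to\infty}u_{\alpha_n}(x)$, $x\in\mathbb{X}$, there exists a deterministic policy $\phi$ such that $$\underline{w}+u(x)=c(x,\phi(x))+\int_{\mathbb{X}}u(y)\,q(dy|x,\phi(x))=\min_{a\in\mathbb{A}}\left[c(x,a)+\int_{\mathbb{X}}u(y)\,q(dy|x,a)\right],\qquad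 x\in\mathbb{X}.$$
   Context: Setting (MDP). The state space $\mathbb{X}$ and the action space $\mathbb{A}$ are Borel subsets of Polish spaces; every action in $\mathbb{A}$ is available at every state. The one-step cost $c:\mathbb{X}\times\mathbb{A}\to\mathbb{R}\cup\{+\infty\}$ is measurable and bounded below. The transition kernel $q(B|x,a)$ ($B\in\mathcal{B}(\mathbb{X})$) is a regular (measurable) transition probability from $\mathbb{X}\times\mathbb{A}$ to $\mathbb{X}$. A policy $\pi=(\pi_0,\pi_1,\dots)$ is a sequence of decision rules, $\pi_t$ being a regular transition probability from the histories $(\mathbb{X}\times\mathbb{A})^t\times\mathbb{X}$ to $\mathbb{A}$; $\Pi$ is the set of all policies. A deterministic policy is identified with a measurable map $\phi:\mathbb{X}\to\mathbb{A}$, which prescribes action $\phi(x)$ whenever the current state is $x$. For an initial state $x$ and policy $\pi$, $\mathbb{E}_x^\pi$ is the expectation with respect to the induced probability measure on trajectories $(x_0,a_0,x_1,a_1,\dots)$ (Ionescu Tulcea theorem). Criteria. $v_{N,\alpha}^\pi(x)=\mathbb{E}_x^\pi\sum_{t=0}^{N-1}\alpha^t c(x_t,a_t)$ for $N\in\{1,2,\dots\}$, $\alpha\in[0,1]$; $v_\alpha^\pi(x)=\mathbb{E}_x^\pi\sum_{t=0}^{\infty}\alpha^t c(x_t,a_t)$ for $\alpha\in[0,1)$; $v_\alpha(x)=\inf_{\pi\in\Pi}v_\alpha^\pi(x)$; $w^\pi(x)=\limsup_{N\to\infty}\frac1N v_{N,1}^\pi(x)$; $w(x)=\inf_{\pi\in\Pi}w^\pi(x)$.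 Notation. $m_\alpha=\inf_{x\in\mathbb{X}}v_\alpha(x)$ (finite for all $\alpha\in[0,1)$ when $w^*<+\infty$), $u_\alpha(x)=v_\alpha(x)-m_\alpha$, $\underline{w}=\liminf_{\alpha\uparrow1}(1-\alpha)m_\alpha$, $\overline{w}=\limsup_{\alpha\uparrow1}(1-\alpha)m_\alpha$. Definitions. A function $f:\mathbb{U}\to\mathbb{R}\cup\{+\infty\}$ on a metric space $\mathbb{U}$ is inf-compact if for every $\lambda\in\mathbb{R}$ the level set $\{s\in\mathbb{U}:f(s)\le\lambda\}$ is compact. A function $f:\mathbb{X}\times\mathbb{A}\to\mathbb{R}\cup\{+\infty\}$ is $\mathbb{K}$-inf-compact if for every nonempty compact $\mathcal{K}\subset\mathbb{X}$ the restriction of $f$ to $\mathcal{K}\times\mathbb{A}$ is inf-compact. Setwise continuity of $q(\cdot|x,a)$ in $a$ means that $a\mapsto q(B|x,a)$ is continuous on $\mathbb{A}$ for every $B\in\mathcal{B}(\mathbb{X})$. A sequence $\{f_n\}_{n\ge1}$ of real-valued functions on a metric space $(\mathbb{S},\rho)$ is lower semi-equicontinuous on $\mathbb{S}$ if for each $s\in\mathbb{S}$ and each $\varepsilon>0$ there exists $\delta>0$ such that $f_n(s')>f_n(s)-\varepsilon$ for all $n\ge1$ whenever $\rho(s,s')<\delta$ (so assuming this property for $\{u_{\alpha_n}\}$ includes that these functions are real-valued). The sequence $\{u_{\alpha_n}\}$ of nonnegative functions is asymptotically uniformly integrable with respect to a probability measure $\mu$ on $\mathbb{X}$ if $\lim_{K\to+\infty}\limsup_{n\to\infty}\int_{\mathbb{X}}u_{\alpha_n}(z)\mathbf{1}\{u_{\alpha_n}(z)\ge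 K\}\,\mu(dz)=0$; equivalently, there exists $N\ge1$ such that $\{u_{\alpha_N},u_{\alpha_{N+1}},\dots\}$ is uniformly integrable with respect to $\mu$. *)

(* Defs.v *)
From HB Require Import structures.
From mathcomp Require Import all_boot all_order all_algebra.
From mathcomp Require Import all_classical all_reals all_analysis.
From mathcomp Require Import measurable_realfun.

Set Implicit Arguments.
Unset Strict Implicit.
Unset Printing Implicit Defensive.

Import Order.TTheory GRing.Theory Num.Theory.
Import numFieldNormedType.Exports.

Local Open Scope classical_set_scope.
Local Open Scope ring_scope.
Local Open Scope ereal_scope.

(* [measurableType] is pointed, so the metric spaces that carry a Borel
   sigma-algebra have to be pointed too, that is, nonempty. *)
#[short(type="pmetricType")]
HB.structure Definition PointedMetric (R : numDomainType) :=
  {T of Pointed T & Metric R T}.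

#[short(type="completeMetricType")]
HB.structure Definition CompleteMetric (R : numDomainType) :=
  {T of Complete T & Metric R T}.

Definition separable_space (T : topologicalType) : Prop :=
  exists2 D : set T, countable D & dense D.

(* X, with its own metric, is a Borel subset of a Polish space: the inclusion
   map [i] is an isometry onto a Borel set. *)
Definition borel_subset_of_polish (R : realType) (X : metricType R) : Prop :=
  exists (S : completeMetricType R) (i : X -> S),
    [/\ separable_space S,
        forall x y, mdist (i x) (i y) = mdist x y &
        <<s @open S >> (range i)].

Notation borelType X := (g_sigma_algebraType (@open X)).

Section inf_compactness.
Context {R : realType}.

Definition inf_compact_on (U : topologicalType) (D : set U) (f : U -> \bar R) :=
  forall l : R, compact (D `&` [set s | f s <= l%:E]).

Definition inf_compact (U : topologicalType) (f : U -> \bar R) :=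
  inf_compact_on setT f.

Definition K_inf_compact (X A : topologicalType) (f : X * A -> \bar R) :=
  forall K : set X, K !=set0 -> compact K -> inf_compact_on (K `*` setT) f.

Definition lower_semi_equicontinuous (S : metricType R)
    (f : nat -> S -> \bar R) :=
  (forall n s, f n s \is a fin_num) /\
  forall (s : S) (e : R), (0 < e)%R ->
    exists2 d : R, (0 < d)%R &
      forall s', (mdist s s' < d)%R -> forall n, f n s - e%:E < f n s'.

Definition asymptotically_uniformly_integrable d (T : measurableType d)
    (mu : {measure set T -> \bar R}) (f : nat -> T -> \bar R) :=
  limn_esup (fun n => \int[mu]_(z in [set z | K%:E <= f n z]) f n z)
    @[K --> +oo%R] --> 0.

End inf_compactness.

(* The product sigma-algebra on T^nat. *)
Definition cylinders d (T : measurableType d) : set (set (nat -> T)) :=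
  \bigcup_t preimage_set_system setT (fun w : nat -> T => w t) measurable.

Notation trajectoryType T := (g_sigma_algebraType (@cylinders _ T)).

Definition past (T : Type) (t : nat) (w : nat -> T) : t.-tuple T :=
  [tuple w i | i < t].

Section mdp.
Context {R : realType} {X A : pmetricType R}.

Local Notation XA := (borelType X * borelType A)%type.
(* h_t = (x_0, a_0, ..., x_(t-1), a_(t-1), x_t) *)
Local Notation historyType t := (t.-tuple XA * borelType X)%type.

Variables (c : X * A -> \bar R) (q : R.-pker XA ~> borelType X).

Definition policy := forall t : nat, R.-pker (historyType t) ~> borelType A.

Definition history (t : nat) (w : nat -> XA) : historyType t :=
  (past t w, (w t).1).

(* x_0 = x a.s., and pi_t (resp. q) is a version of the conditional law of a_t
   given h_t (resp. of x_(t+1) given (h_t, a_t)). By the Ionescu Tulcea theorem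
   exactly one probability measure has these properties. *)
Definition induced_by (pi : policy) (x : X)
    (P : probability (trajectoryType XA) R) : Prop :=
  [/\ forall B : set (borelType X), measurable B ->
        P [set w | B (w 0%N).1] = \d_(x : borelType X) B,
      forall t (D : set (historyType t)) (B : set (borelType A)),
        measurable D -> measurable B ->
        P [set w | D (history t w) /\ B (w t).2] =
        \int[P]_(w in [set w | D (history t w)]) pi t (history t w) B &
      forall t (D : set (t.+1.-tuple XA)) (B : set (borelType X)),
        measurable D -> measurable B ->
        P [set w | D (past t.+1 w) /\ B (w t.+1).1] =
        \int[P]_(w in [set w | D (past t.+1 w)]) q (w t) B].

Definition induced_measure (pi : policy) (x : X) :
    probability (trajectoryType XA) R :=
  get (induced_by pi x).

Definition v_finite (N : nat) (alpha : R) (pi : policy) (x : X) : \bar R :=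
  \int[induced_measure pi x]_w
    \sum_(0 <= t < N) (alpha ^+ t)%:E * c (w t).

Definition v_disc_policy (alpha : R) (pi : policy) (x : X) : \bar R :=
  \int[induced_measure pi x]_w
    \sum_(0 <= t <oo) (alpha ^+ t)%:E * c (w t).

Definition v_disc (alpha : R) (x : X) : \bar R :=
  ereal_inf (range (fun pi : policy => v_disc_policy alpha pi x)).

Definition w_policy (pi : policy) (x : X) : \bar R :=
  limn_esup (fun N => (N%:R^-1)%:E * v_finite N 1 pi x).

Definition w_opt (x : X) : \bar R :=
  ereal_inf (range (fun pi : policy => w_policy pi x)).

Definition w_star : \bar R := ereal_inf (range w_opt).

Definition m_disc (alpha : R) : \bar R := ereal_inf (range (v_disc alpha)).

Definition u_disc (alpha : R) (x : X) : \bar R := v_disc alpha x - m_disc alpha.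

Definition w_lower : \bar R :=
  limf_einf (fun alpha : R => (1 - alpha)%:E * m_disc alpha) 1%R^'-.

Definition w_upper : \bar R :=
  limf_esup (fun alpha : R => (1 - alpha)%:E * m_disc alpha) 1%R^'-.

Definition weakly_continuous : Prop :=
  forall f : X -> R, continuous f -> bounded_fun f ->
    continuous (fun z : X * A => \int[q z]_y (f y)%:E).

Definition setwise_continuous_in_action : Prop :=
  forall (x : X) (B : set (borelType X)), measurable B ->
    continuous (fun a : A => q (x, a) B).

End mdp.

(* Main.v *)
From HB Require Import structures.
From mathcomp Require Import all_boot all_order all_algebra.
From mathcomp Require Import all_classical all_reals all_analysis.
From mathcomp Require Import measurable_realfun lra giry.
Require Import Defs.

(** Adding a constant to [c] adds it to the average costs, changes the
    discounted values by a constant and leaves the relative values [u_disc]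
    alone, so [c] may be assumed nonnegative (the lemmas named [_shift]).

    For a nonnegative cost, value iteration from zero increases to the value
    [v_disc], which satisfies the discounted optimality equation
    ([discounted_optimality]). Subtracting multiples of [m_disc], this reads
    [(1 - alpha) * m_disc alpha + u_disc alpha x =
     min_a (c (x, a) + alpha * \int u_disc alpha dq(x, a))].
    Let [alpha] tend to one along the given sequence. The left-hand side tends
    to [w_lower + u x]. On the right, for each fixed action asymptotic uniform
    integrability bounds the limit of the integrals by the integral of [u]
    ([average_equation_le]). For the converse, the discounted minimizers depend
    on [alpha]; replacing the relative values by the infima over the tails of the
    sequence makes the right-hand sides increase, and inf-compactness in the
    action lets the minimum commute with the increasing limit
    ([inf_compact_interchange], [average_equation_ge]). This is the optimality
    equation, and a minimizer [phi] of its right-hand side gives a stationary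
    policy whose average cost is at most [w_lower] ([w_star_le_lower]). On the
    other hand [w_lower <= w_upper <= w_star], because Abel means are bounded by
    Cesaro means ([cesaro_abel], [w_upper_le_w_star]).

    The two continuity assumptions enter only through [stable_class]: under
    setwise continuity all the functions involved are measurable, and under weak
    continuity they are lower semicontinuous, where lower semi-equicontinuity
    takes care of the infima over tails ([setwise_stable], [weak_stable],
    [equicontinuous_einfs]).

    Two classical theorems carry the measure theory. The theorem of Ionescu
    Tulcea ([ionescu_tulcea]) shows that [induced_measure] has the transition
    laws that its definition asks for, from which expected costs are computed
    one step at a time. The theorem of Novikov that projections of Borel sets
    with compact sections are Borel ([measurable_projection]) makes minimizers
    measurable ([measurable_minimizer]). It is proved on the Baire space by
    separation of analytic sets ([novikov_separation]) and the fan theorem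
    ([binary_bar]), and transported to [X] and [A] by coding points as binary
    sequences ([polish_coding]). *)

Set Implicit Arguments.
Unset Strict Implicit.
Unset Printing Implicit Defensive.

Import Order.TTheory GRing.Theory Num.Theory.
Import numFieldNormedType.Exports.

Local Open Scope classical_set_scope.
Local Open Scope ring_scope.
Local Open Scope ereal_scope.

(** * Analytic sets of the Baire space *)

Section trajectories.
Context d (T : measurableType d).

Lemma measurable_coord t :
  measurable_fun setT (fun w : trajectoryType T => w t).
Proof.
move=> _ B mB; rewrite setTI; apply: sub_sigma_algebra.
by exists t => //; exists B => //; rewrite setTI.
Qed.

Lemma measurable_fun_trajectory d' (Y : measurableType d')
    (f : Y -> trajectoryType T) :
  (forall t, measurable_fun setT (fun y => f y t)) -> measurable_fun setT f.
Proof.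
move=> mf; apply: (@measurability _ _ Y (trajectoryType T) setT f (@cylinders _ T) erefl).
move=> _ [_ [t _ [B mB <-]] <-]; rewrite setTI.
exact: mf.
Qed.

End trajectories.

Lemma measurable_bigcup_count d (T : measurableType d) (I : countType)
    (P : set I) (F : I -> set T) :
  (forall i, P i -> measurable (F i)) -> measurable (\bigcup_(i in P) F i).
Proof.
move=> mF.
rewrite (_ : \bigcup_(i in P) F i =
    \bigcup_n (if pickle_inv n is Some i then
                 (if `[< P i >] then F i else set0) else set0)).
  apply: bigcupT_measurable => n; case: (pickle_inv n) => // i.
  by case: asboolP => // /mF.
apply/seteqP; split=> x [].
  by move=> i Pi Fx; exists (pickle i) => //; rewrite pickleK_inv; case: asboolP.
by move=> n _; case: (pickle_inv n) => // i; case: asboolP => // Pi Fx; exists i.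
Qed.

Lemma measurable_bigcap_count d (T : measurableType d) (I : countType)
    (P : set I) (F : I -> set T) :
  (forall i, P i -> measurable (F i)) -> measurable (\bigcap_(i in P) F i).
Proof.
move=> mF; rewrite -(setCK (\bigcap_(i in P) F i)); apply: measurableC.
by rewrite setC_bigcap; apply: measurable_bigcup_count => i /mF; exact: measurableC.
Qed.

Notation baire := (trajectoryType nat).

Lemma measurable_coord_in i (B : set nat) : measurable [set y : baire | B (y i)].
Proof. by rewrite -[X in measurable X]setTI; exact: measurable_coord. Qed.

Definition agree (T : Type) k (x y : nat -> T) := forall i, (i < k)%N -> x i = y i.

Lemma agree_le (T : Type) k l (x y : nat -> T) : (k <= l)%N -> agree l x y -> agree k x y.
Proof. by move=> kl h i ik; apply: h; exact: leq_trans ik kl. Qed.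

(** Closedness for the product of two copies of the Baire space: the sets of
    the [x'] with [agree k x x'] form a basis of neighborhoods of [x]. *)
Definition closed_rel (F : baire -> baire -> Prop) := forall a x,
  (forall k, exists a' x', [/\ agree k a a', agree k x x' & F a' x']) -> F a x.

(** Analytic sets are encoded as the projections of closed sets, so that every
    membership has a witness that is approximated by its finite prefixes. *)
Definition analytic (P : set baire) :=
  exists2 F, closed_rel F & forall a, P a <-> exists x, F a x.

(** [K] is a modulus of continuity of the substitution at [k]. *)
Lemma closed_rel_comp (F : baire -> baire -> Prop) (f g : baire -> baire -> baire) :
  (forall k, exists K, forall a a' x x', agree K a a' -> agree K x x' ->
     agree k (f a x) (f a' x') /\ agree k (g a x) (g a' x')) ->
  closed_rel F -> closed_rel (fun a x => F (f a x) (g a x)).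
Proof.
move=> fg cF a x h; apply: cF => k; have [K HK] := fg k.
have [a' [x' [aa xx Fx]]] := h K; have [? ?] := HK _ _ _ _ aa xx.
by exists (f a' x'), (g a' x').
Qed.

Lemma analytic_bigcup (P : nat -> set baire) :
  (forall n, analytic (P n)) -> analytic (\bigcup_n P n).
Proof.
move=> aP; have {aP}/choice[F HF] : forall n, exists F,
  closed_rel F /\ (forall a, P n a <-> exists x, F a x).
  by move=> n; have [F ? ?] := aP n; exists F.
exists (fun a x => F (x 0%N) a (fun i => x i.+1)).
  move=> a x h; apply: (HF (x 0%N)).1 => k.
  have [a' [x' [aa xx Fx]]] := h k.+1; exists a', (fun i => x' i.+1); split.
  - exact: agree_le aa.
  - by move=> i ik; apply: xx.
  - by rewrite (xx 0%N).
move=> a; split => [[n _ /(HF n).2[x Fx]]|[x Fx]].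
  by exists (fun i => if i is j.+1 then x j else n).
by exists (x 0%N) => //; apply/(HF (x 0%N)).2; exists (fun i => x i.+1).
Qed.

(** One witness carries those of all the [P n], interleaved by the pairing
    function. *)
Lemma analytic_bigcap (P : nat -> set baire) :
  (forall n, analytic (P n)) -> analytic (\bigcap_n P n).
Proof.
move=> aP; have {aP}/choice[F HF] : forall n, exists F,
  closed_rel F /\ (forall a, P n a <-> exists x, F a x).
  by move=> n; have [F ? ?] := aP n; exists F.
exists (fun a x => forall n, F n a (fun i => x (pickle (n, i)))).
  move=> a x h n; apply: (HF n).1 => k.
  pose K := (k + \max_(i < k) (pickle (n, i : nat)).+1)%N.
  have [a' [x' [aa xx Fx]]] := h K.
  exists a', (fun i => x' (pickle (n, i))); split => //.
  - by apply: agree_le aa; rewrite leq_addr.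
  - move=> i ik; apply: xx; rewrite /K (leq_trans _ (leq_addl _ _))//.
    exact: (leq_bigmax (Ordinal ik)).
move=> a; split => [h|[x Fx] n _]; last first.
  by apply/(HF n).2; exists (fun i => x (pickle (n, i))).
have /choice[x Fx] : forall n, exists x, F n a x.
  by move=> n; apply/(HF n).2; exact: h.
exists (fun m => if unpickle m is Some (n, i) then x n i else 0%N) => n.
rewrite (_ : (fun i => _) = x n)//; apply/funext => i.
by rewrite pickleK.
Qed.

Lemma analytic0 : analytic set0.
Proof.
exists (fun _ _ => False); last by move=> a; split=> [//|[]].
by move=> a x /(_ 0%N)[? [? []]].
Qed.

Lemma analytic_cylinder t (B : set nat) : analytic [set a : baire | B (a t)].
Proof.
exists (fun a _ => B (a t)).
  by move=> a x /(_ t.+1)[a' [x' [aa _]]]; rewrite (aa t).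
by move=> a; split=> [|[x]//]; exists point.
Qed.

(** The sets that are analytic together with their complements form a
    sigma-algebra that contains the cylinders. *)
Lemma measurable_analytic (B : set baire) : measurable B -> analytic B.
Proof.
move=> mB; suff : [set B | analytic B /\ analytic (~` B)] B by case.
apply: mB; split; last first.
  move=> _ [t _ [C mC <-]]; rewrite setTI /=; split.
    exact: analytic_cylinder.
  exact: (analytic_cylinder t (~` C)).
split.
- split; first exact: analytic0.
  rewrite (_ : ~` set0 = [set a : baire | setT (a 0%N)]); last by apply/seteqP; split=> x // _ [].
  exact: (analytic_cylinder 0 setT).
- by move=> A [] ? ?; rewrite setTD; split; rewrite ?setCK.
- move=> A hA; split; first by apply: analytic_bigcup => n; case: (hA n).
  rewrite setC_bigcup; apply: analytic_bigcap => n; by case: (hA n).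
Qed.

Lemma analyticU P Q : analytic P -> analytic Q -> analytic (P `|` Q).
Proof.
move=> aP aQ; rewrite -bigcup2E; apply: analytic_bigcup => -[|[|n]] //=.
exact: analytic0.
Qed.

Lemma analyticI P Q : analytic P -> analytic Q -> analytic (P `&` Q).
Proof.
move=> aP aQ; rewrite -bigcap2E; apply: analytic_bigcap => -[|[|n]] //=.
exact: (analytic_cylinder 0 setT).
Qed.

(** A pair of sequences is coded by interleaving, so that subsets of the product
    and their projections stay within the Baire space. *)
Definition evens (z : baire) : baire := fun i => z i.*2.
Definition odds (z : baire) : baire := fun i => z i.*2.+1.
Definition join (x y : baire) : baire := fun n => if odd n then y n./2 else x n./2.

Lemma evens_join x y : evens (join x y) = x.
Proof. by apply/funext => i; rewrite /evens /join odd_double doubleK. Qed.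

Lemma odds_join x y : odds (join x y) = y.
Proof.
by apply/funext => i; rewrite /odds /join /= odd_double /= uphalf_double.
Qed.

Lemma join_evens_odds z : join (evens z) (odds z) = z.
Proof.
apply/funext => i; rewrite /evens /odds /join; case: ifPn => oi; congr (z _).
  by rewrite -[RHS]odd_double_half oi.
by rewrite -[RHS]odd_double_half (negbTE oi).
Qed.

Lemma agree_join k x x' y y' : agree k x x' -> agree k y y' ->
  agree k (join x y) (join x' y').
Proof.
move=> xx yy i ik; have ik2 : (i./2 < k)%N.
  by rewrite ltn_half_double (leq_trans ik)// -addnn leq_addr.
by rewrite /join; case: ifP => _; [exact: yy|exact: xx].
Qed.

Lemma agree_evens k z z' : agree k.*2 z z' -> agree k (evens z) (evens z').
Proof. by move=> zz i ik; apply: zz; rewrite ltn_double. Qed.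

Lemma agree_odds k z z' : agree k.*2 z z' -> agree k (odds z) (odds z').
Proof. by move=> zz i ik; apply: zz; rewrite ltn_Sdouble. Qed.

Lemma analytic_evens_preimage P : analytic P -> analytic (evens @^-1` P).
Proof.
move=> [F cF HF]; exists (fun a x => F (evens a) x); last by move=> a; exact: HF.
apply: (closed_rel_comp (f := fun a _ => evens a) (g := fun _ x => x)) => // k.
exists k.*2 => a a' x x' aa xx; split; first exact: agree_evens.
by apply: agree_le xx; rewrite -addnn leq_addr.
Qed.

Lemma analytic_evens_image P : analytic P -> analytic (evens @` P).
Proof.
move=> [F cF HF]; exists (fun a x => F (join a (evens x)) (odds x)); last first.
  move=> a; split=> [[z /HF[x Fx] <-]|[x Fx]].
    exists (join (odds z) x); rewrite evens_join odds_join.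
    by rewrite join_evens_odds.
  exists (join a (evens x)); rewrite ?evens_join//.
  by apply/HF; exists (odds x).
apply: (closed_rel_comp (f := fun a x => join a (evens x)) (g := fun _ x => odds x)) => // k.
exists k.*2 => a a' x x' aa xx; split; last exact: agree_odds.
apply: agree_join; last exact: agree_evens.
by apply: agree_le aa; rewrite -addnn leq_addr.
Qed.

Lemma measurable_evens : measurable_fun setT evens.
Proof. by apply: measurable_fun_trajectory => t; exact: measurable_coord. Qed.

Lemma measurable_odds : measurable_fun setT odds.
Proof. by apply: measurable_fun_trajectory => t; exact: measurable_coord. Qed.

(** * Separation of analytic sets *)

Definition separable_family (P : nat -> set baire) := exists B : nat -> set baire,
  [/\ forall n, measurable (B n), forall n, P n `<=` B n &
      forall x, ~ forall n, B n x].

Definition replace (P : nat -> set baire) m Q n := if n == m then Q else P n.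

(** Splitting one of the sets into countably many pieces preserves
    inseparability for at least one piece. *)
Lemma separable_split (I : countType) (P : nat -> set baire) m (Q : I -> set baire) :
  P m `<=` \bigcup_i Q i ->
  (forall i, separable_family (replace P m (Q i))) -> separable_family P.
Proof.
move=> PQ /choice[B HB].
exists (fun n => if n == m then \bigcup_i B i m else \bigcap_i B i n); split.
- move=> n; have mB i k : measurable (B i k) by case: (HB i).
  case: ifP => _; [exact: measurable_bigcup_count|exact: measurable_bigcap_count].
- move=> n a Pa; case: eqP => [nm|/eqP nm].
    move: Pa; rewrite nm => /PQ[i _ Qa]; exists i => //.
    by case: (HB i) => _ /(_ m) h _; apply: h; rewrite /replace eqxx.
  by move=> i _; case: (HB i) => _ /(_ n) h _; apply: h; rewrite /replace (negbTE nm).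
- move=> x h; have := h m; rewrite eqxx => -[i _ Bm].
  case: (HB i) => _ _ /(_ x); apply => n; have := h n.
  by case: eqP => [->//|_]; exact.
Qed.

(** The points of the projection of [F] for which the point and its witness
    begin with the pairs in [s]. *)
Definition section_of (F : baire -> baire -> Prop) (s : seq (nat * nat)) : set baire :=
  [set a | exists2 x, F a x &
           forall i, (i < size s)%N -> (a i, x i) = nth (0, 0)%N s i].

(** The stage [t] of the construction below treats the set of number
    [logn 2 t.+1]; each set has its turn infinitely often. *)
Lemma infinitely_often n t0 : exists2 t, (t0 <= t)%N & logn 2 t.+1 = n.
Proof.
have p0 : (0 < 2 ^ n * t0.*2.+1)%N by rewrite muln_gt0 expn_gt0.
exists (2 ^ n * t0.*2.+1).-1; last first.
  rewrite prednK// lognM ?expn_gt0// pfactorK// logn_coprime ?addn0//.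
  by rewrite coprime2n /= odd_double.
rewrite -ltnS prednK// (@leq_trans t0.*2.+1)//.
  by rewrite ltnS -addnn leq_addr.
by rewrite leq_pmull// expn_gt0.
Qed.

(** Suppose that the family is inseparable. By [separable_split] the prefixes of
    a point of [P n] and of its witness can be extended by one step, for one [n]
    at a time, while the family of the restricted sets remains inseparable. In
    the limit this gives a point in each [P n]. If two of these points differ at
    some coordinate, then two cylinders separate the restricted family at some
    stage; so they all agree, and their common value lies in every [P n]. *)
Theorem novikov_separation (P : nat -> set baire) :
  (forall n, analytic (P n)) -> (forall x, ~ forall n, P n x) ->
  separable_family P.
Proof.
move=> aP P0; apply: contrapT => nsep.
have {aP}/choice[F HF] : forall n, exists F,
  closed_rel F /\ (forall a, P n a <-> exists x, F a x).
  by move=> n; have [F ? ?] := aP n; exists F.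
pose fam (st : nat -> seq (nat * nat)) n := section_of (F n) (st n).
have step st n : exists p, ~ separable_family (fam st) ->
    ~ separable_family (fam (fun k => if k == n then rcons (st k) p else st k)).
  apply: contrapT => /forallNP h; have ns : ~ separable_family (fam st).
    by move=> s; apply: (h (0, 0)%N).
  apply: ns.
  apply: (@separable_split _ _ n (fun p => section_of (F n) (rcons (st n) p))).
    move=> a [x Fx ax]; exists (a (size (st n)), x (size (st n))) => //.
    exists x => // i; rewrite size_rcons ltnS leq_eqVlt nth_rcons.
    move=> /orP[/eqP ->|ist]; first by rewrite ltnn eqxx.
    by rewrite ist; exact: ax.
  move=> p; have /not_implyP[_ /contrapT] := h p; congr separable_family.
  by apply/funext => k; rewrite /replace /fam; case: eqP => [->|].
have /choice[f Hf] : forall x : (nat -> seq (nat * nat)) * nat, exists p,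
    ~ separable_family (fam x.1) ->
    ~ separable_family (fam (fun k => if k == x.2 then rcons (x.1 k) p else x.1 k)).
  by move=> [st n]; exact: step.
pose st := fix st t := if t is t'.+1 then
    (fun k => if k == logn 2 t'.+1 then rcons (st t' k) (f (st t', logn 2 t'.+1))
              else st t' k) else (fun=> [::]).
have nst t : ~ separable_family (fam (st t)).
  elim: t => [|t IH] /=; last exact: (Hf (st t, logn 2 t.+1)).
  move=> [B [mB PB B0]]; apply: nsep; exists B; split => // n a Pa; apply: PB.
  by have /(HF n).2[x Fx] := Pa; exists x.
have st_pre t t' n : (t <= t')%N ->
    (size (st t n) <= size (st t' n))%N /\
    forall i, (i < size (st t n))%N -> nth (0, 0)%N (st t' n) i = nth (0, 0)%N (st t n) i.
  elim: t' => [|t' IH]; first by rewrite leqn0 => /eqP ->.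
  rewrite leq_eqVlt => /orP[/eqP <-//|]; rewrite ltnS => /IH [le IHn].
  rewrite [st t'.+1 n]/=; case: eqP => // _; rewrite size_rcons; split.
    exact: leqW.
  by move=> i it; rewrite nth_rcons (leq_trans it le) IHn.
have st_size n k : exists t, (k <= size (st t n))%N.
  elim: k => [|k [t0 IH]]; first by exists 0%N.
  have [t t0t tn] := infinitely_often n t0; exists t.+1.
  rewrite /= tn eqxx size_rcons ltnS (leq_trans IH)//.
  by have [] := st_pre _ _ n t0t.
have /choice[tau Htau] : forall p : nat * nat, exists t, (p.2 <= size (st t p.1))%N.
  by move=> [n k]; exact: st_size.
pose z n i := nth (0, 0)%N (st (tau (n, i.+1)) n) i.
have zE t n i : (i < size (st t n))%N -> nth (0, 0)%N (st t n) i = z n i.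
  move=> ist; rewrite /z; have := Htau (n, i.+1) => /= ist'.
  have [tt|/ltnW tt] := leqP t (tau (n, i.+1)).
    by have [_ ->] := st_pre _ _ n tt.
  by have [_ ->] := st_pre _ _ n tt.
have fam_ne t n : exists a, fam (st t) n a.
  apply: contrapT => /forallNP h; apply: (nst t).
  exists (fun k => if k == n then set0 else setT); split.
  - by move=> k; case: ifP.
  - by move=> k a; case: eqP => // ->; exact: h.
  - by move=> x /(_ n); rewrite eqxx.
have Fz n : F n (fun i => (z n i).1) (fun i => (z n i).2).
  apply: (HF n).1 => k.
  have [a [x Fx ax]] := fam_ne (tau (n, k)) n.
  have kst := Htau (n, k).
  have zax i : (i < k)%N -> (a i, x i) = z n i.
    by move=> ik; rewrite -(zE (tau (n, k))) ?ax// (leq_trans ik).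
  by exists a, x; split => // i /zax <-.
have [n na] : exists n, (fun i => (z n i).1) <> (fun i => (z 0%N i).1).
  apply: contrapT => /forallNP h; apply: (P0 (fun i => (z 0%N i).1)) => n.
  apply/(HF n).2; exists (fun i => (z n i).2).
  by have /contrapT <- := h n; exact: Fz.
have n0 : n != 0%N by apply: contra_notN na => /eqP ->.
have [i ni] : exists i, (z n i).1 <> (z 0%N i).1.
  by apply: contrapT => /forallNP h; apply: na; apply/funext => i; apply: contrapT; exact: h.
pose t := maxn (tau (n, i.+1)) (tau (0%N, i.+1)).
have cyl m (a : baire) : (tau (m, i.+1) <= t)%N -> fam (st t) m a -> a i = (z m i).1.
  move=> mt [x _ ax]; have im : (i < size (st t m))%N.
    by rewrite (leq_trans (Htau (m, i.+1)))//; have [] := st_pre _ _ m mt.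
  by have := ax _ im; rewrite zE// => <-.
apply: (nst t); exists (fun k => if k == n then [set a : baire | a i = (z n i).1] else
    if k == 0%N then [set a : baire | a i = (z 0%N i).1] else setT); split.
- have mc j : measurable [set a : baire | a i = j] := measurable_coord_in i [set j].
  by move=> k; case: ifP => _; [|case: ifP => _].
- move=> k a; case: eqP => [->|_]; first by apply: cyl; rewrite leq_maxl.
  by case: eqP => [->|//]; apply: cyl; rewrite leq_maxr.
- move=> x h; have := h n; have := h 0%N.
  by rewrite !eqxx eq_sym (negbTE n0) /= => -> /esym.
Qed.

Lemma lusin_separation (P Q : set baire) : analytic P -> analytic Q ->
  P `&` Q = set0 -> exists D, [/\ measurable D, P `<=` D & D `&` Q = set0].
Proof.
move=> aP aQ PQ0.
have [|x h|B [mB PB B0]] :=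
    novikov_separation (P := fun n => if n == 0%N then P else Q).
- by move=> n; case: ifP.
- by have : (P `&` Q) x; [split; [exact: (h 0%N)|exact: (h 1%N)]|rewrite PQ0].
exists (B 0%N); split => //; first exact: (PB 0%N).
rewrite -subset0 => x [B0x Qx]; apply: (B0 x) => -[//|n].
exact: (PB n.+1).
Qed.

(** * Projection of Borel sets with compact sections *)

Definition binary_seq : set baire := [set y | forall i, (y i < 2)%N].

Definition has_prefix (s : seq nat) : set baire := [set y | mkseq y (size s) = s].

Lemma measurable_has_prefix s : measurable (has_prefix s).
Proof.
rewrite (_ : has_prefix s =
  \bigcap_(i in [set i | (i < size s)%N]) [set y : baire | y i = nth 0%N s i]).
  by apply: measurable_bigcap_count => i _; exact: (measurable_coord_in i [set nth 0%N s i]).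
apply/seteqP; split => y.
  by move=> ys i /= isz; rewrite -ys nth_mkseq.
move=> h; apply: (@eq_from_nth _ 0%N) => [|i]; rewrite size_mkseq// => isz.
by rewrite nth_mkseq//; exact: h.
Qed.

(** The fan theorem: otherwise the prefixes with arbitrarily long extensions
    that avoid [D] contain the empty one and can be extended forever, which
    gives a binary sequence without prefix in [D]. *)
Lemma binary_bar (D : set (seq nat)) :
  (forall y, binary_seq y -> exists k, D (mkseq y k)) ->
  exists m, forall t, size t = m -> all (fun b => b < 2)%N t ->
    exists2 j, (j <= m)%N & D (take j t).
Proof.
move=> bar; apply: contrapT => /forallNP nb.
pose free t := forall j, (j <= size t)%N -> ~ D (take j t).
pose ext s := forall m, (size s <= m)%N -> exists t,
  [/\ size t = m, all (fun b => b < 2)%N t, take (size s) t = s & free t].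
have ext0 : ext [::].
  move=> m _; have /existsNP[t /not_implyP[tm /not_implyP[t2 h]]] := nb m.
  exists t; split; rewrite ?take0// => j jt Dj.
  by apply: h; exists j; rewrite // -tm.
have extS s : exists b, (b < 2)%N /\ (ext s -> ext (rcons s b)).
  apply: contrapT => /forallNP h.
  have {h} h b : (b < 2)%N -> ext s /\ ~ ext (rcons s b).
    by move=> b2; have /not_andP[//|/not_implyP] := h b.
  have [es /existsNP[m0 /not_implyP[sm0 h0]]] := h 0%N isT.
  have [_ /existsNP[m1 /not_implyP[sm1 h1]]] := h 1%N isT.
  rewrite !size_rcons in sm0 sm1.
  have [|t [tm t2 ts ft]] := es (maxn m0 m1).
    by rewrite leq_max (ltnW sm0).
  have st : (size s < size t)%N by rewrite tm leq_max sm0.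
  have tS : take (size s).+1 t = rcons s (nth 0%N t (size s)).
    by rewrite (take_nth 0%N)// ts.
  have cut m : (size s < m)%N -> (m <= size t)%N ->
      [/\ size (take m t) = m, all (fun b => b < 2)%N (take m t),
       take (size s).+1 (take m t) = rcons s (nth 0%N t (size s)) & free (take m t)].
    move=> sm mt; split; first by rewrite size_takel.
    - by apply/allP => b /mem_take; exact: (allP t2).
    - by rewrite take_takel.
    - move=> j; rewrite size_takel// => jm; rewrite take_takel//.
      by apply: ft; exact: leq_trans mt.
  have : (nth 0%N t (size s) < 2)%N by rewrite (allP t2)// mem_nth.
  case E : (nth 0%N t (size s)) => [|[|//]] _.
    apply: h0; exists (take m0 t); rewrite size_rcons.
    by have := cut m0 sm0; rewrite E tm leq_maxl; exact.
  apply: h1; exists (take m1 t); rewrite size_rcons.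
  by have := cut m1 sm1; rewrite E tm leq_maxr; exact.
have /choice[f Hf] := extS.
pose st := fix st n := if n is n'.+1 then rcons (st n') (f (st n')) else [::].
pose y n := f (st n).
have yst n : mkseq y n = st n.
  by elim: n => // n IH; rewrite mkseqS IH.
have y2 : binary_seq y by move=> i; exact: (Hf _).1.
have est n : ext (st n) by elim: n => // n IH; exact: (Hf _).2.
have [k Dk] := bar y y2.
have sk : size (st k) = k by rewrite -yst size_mkseq.
have [|t [tk _ tst ft]] := est k k; first by rewrite sk.
apply: (ft k); first by rewrite tk.
by move: Dk; rewrite yst -{1}tst sk.
Qed.

(** A point [x] lies outside the projection when every binary [y] has a prefix
    [s] such that no point of [G] over [x] continues [s], that is, [x] is not in
    [hit s]. The sets [hit s] are only analytic. The family of [E] and all the [A s]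
    has no common point, because the sections of [G] are closed; Novikov separation
    covers [E] by the complements of Borel sets [B s], and the projection [Q s]
    of the part of [E] outside [B s] is disjoint from [hit s]. Lusin separation
    puts a Borel set [D s] between [Q s] and the complement of [hit s]. Then [x]
    is outside the projection when the prefixes [s] with [D s x] form a bar, and
    the fan theorem turns this condition on all [y] into a countable one. *)
Theorem measurable_projection_baire (G : set baire) : measurable G ->
  G `<=` odds @^-1` binary_seq ->
  (forall x y, binary_seq y ->
     (forall k, exists2 y', agree k y y' & G (join x y')) -> G (join x y)) ->
  measurable (evens @` G).
Proof.
move=> mG Gbin Gclosed.
have mbin : measurable binary_seq.
  rewrite (_ : binary_seq = \bigcap_i [set y : baire | (y i < 2)%N]).
    by apply: bigcapT_measurable => i; exact: (measurable_coord_in i [set j | (j < 2)%N]).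
  by apply/seteqP; split => y h i; [move=> _|]; exact: h.
have modds := measurable_odds; have mevens := measurable_evens.
pose hit s := evens @` (G `&` odds @^-1` has_prefix s).
have ahit s : analytic (hit s).
  apply: analytic_evens_image; apply: analyticI; first exact: measurable_analytic.
  apply: measurable_analytic; rewrite -[X in measurable X]setTI; apply: modds => //.
  exact: measurable_has_prefix.
pose E := odds @^-1` binary_seq `&` ~` G.
have mE : measurable E.
  by apply: measurableI; [rewrite -[X in measurable X]setTI; exact: modds|exact: measurableC].
pose A s := evens @^-1` hit s `|` odds @^-1` (~` has_prefix s).
have mo s : measurable (odds @^-1` (~` has_prefix s)).
  rewrite -[X in measurable X]setTI; apply: modds => //.
  by apply: measurableC; exact: measurable_has_prefix.
have aA s : analytic (A s).
  by apply: analyticU; [exact: analytic_evens_preimage|exact: measurable_analytic].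
have key z : E z -> exists s, ~ A s z.
  move=> [z2 nGz]; apply: contrapT => /forallNP h; apply: nGz.
  rewrite -(join_evens_odds z); apply: Gclosed => // k.
  have /contrapT[|] := h (mkseq (odds z) k).
    move=> [z' [Gz' hz'] zz']; exists (odds z'); last by rewrite -zz' join_evens_odds.
    move=> i ik; move: hz'; rewrite /has_prefix/= size_mkseq => /(congr1 (nth 0%N ^~ i)).
    by rewrite !nth_mkseq.
  by rewrite /has_prefix/= size_mkseq.
have [|x h|B [mB PB B0]] := novikov_separation
  (P := fun n => if n is n'.+1 then (if pickle_inv n' is Some s then A s else setT) else E).
- case=> [|n]; first exact: measurable_analytic.
  by case: pickle_inv => [s|]; [exact: aA|exact: measurable_analytic].
- have [s] := key x (h 0%N); apply; by have := h (pickle s).+1; rewrite pickleK_inv.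
have EB z : E z -> exists s : seq nat, ~ B (pickle s).+1 z.
  move=> Ez; have /existsNP[[|n] nB] := B0 z; first by have := PB 0%N _ Ez.
  have := PB n.+1 z; have := @pickle_invK (seq nat) n.
  by case: (@pickle_inv (seq nat) n) => [s /= sn _|_ /(_ I)//]; exists s; rewrite sn.
have AB (s : seq nat) z : A s z -> B (pickle s).+1 z.
  by move=> Az; apply: PB; rewrite pickleK_inv.
pose Q (s : seq nat) := evens @` (E `&` ~` B (pickle s).+1).
have /choice[D HD] : forall s, exists D : set baire, [/\ measurable D, Q s `<=` D & D `&` hit s = set0].
  move=> s; apply: lusin_separation => //.
    apply: analytic_evens_image; apply: measurable_analytic.
    by apply: measurableI => //; exact: measurableC.
  rewrite -subset0 => x [[z [Ez nBz] <-] hz]; apply: nBz; apply: AB; by left.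
rewrite -(setCK (evens @` G)); apply: measurableC.
rewrite (_ : ~` _ = \bigcup_m \bigcap_(t in [set t | size t = m /\ all (fun b => b < 2)%N t])
    \bigcup_(j in [set j | (j <= m)%N]) D (take j t)).
  apply: bigcupT_measurable => m; apply: measurable_bigcap_count => t _.
  by apply: measurable_bigcup_count => j _; case: (HD (take j t)).
apply/seteqP; split => x.
  move=> nGx.
  have Ex y : binary_seq y -> E (join x y).
    move=> y2; split; first by rewrite /= odds_join.
    by move=> Gxy; apply: nGx; exists (join x y); rewrite ?evens_join.
  have [y y2|m Hm] := @binary_bar [set s | D s x].
    have [s nB] := EB _ (Ex y y2).
    have /not_orP[_ /contrapT] : ~ A s (join x y) by move/AB.
    rewrite /= odds_join /has_prefix /= => ys; exists (size s) => //=.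
    rewrite ys; case: (HD s) => _ + _; apply; exists (join x y); last exact: evens_join.
    by split => //; exact: Ex.
  by exists m => // t [tm t2]; have [j jm Dj] := Hm t tm t2; exists j.
move=> [m _ Hm] [z Gz zx]; pose t := mkseq (odds z) m.
have [|j jm Dj] := Hm t.
  split; first by rewrite size_mkseq.
  by apply/allP => b /mapP[i _ ->]; exact: (Gbin _ Gz).
case: (HD (take j t)) => _ _; rewrite -subset0 => /(_ x); apply; split => //.
exists z => //; split => //; rewrite /= /has_prefix /= size_takel ?size_mkseq//.
by rewrite /t /mkseq -map_take take_iota (minn_idPl jm).
Qed.

(** * Coding a Borel subset of a Polish space by binary sequences *)

Section compactness.

Lemma compact_seq_cluster (T : topologicalType) (K : set T) (x : nat -> T) :
  compact K -> (forall n, K (x n)) ->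
  exists2 p, K p & forall C N, closed C -> (forall n, (N <= n)%N -> C (x n)) -> C p.
Proof.
move=> cK Kx; have [|p [Kp clp]] := cK (x @ \oo) _; first by exists 0%N => // n _; exact: Kx.
exists p => // C N cC Cx; apply: cC => B /clp; apply.
by exists N.
Qed.

End compactness.

Section metric.
Context {R : realType}.

Lemma nbhs_mdist (X : metricType R) (x : X) (U : set X) :
  nbhs x U <-> exists2 e : R, (0 < e)%R & forall y, (mdist x y < e)%R -> U y.
Proof.
split=> [/nbhs_ballP[e e0 eU]|[e e0 eU]].
  by exists e => // y xy; apply: eU; rewrite ballEmdist.
by apply/nbhs_ballP; exists e => // y; rewrite ballEmdist => /eU.
Qed.

Definition isometric (X S : metricType R) (i : X -> S) :=
  forall x y, mdist (i x) (i y) = mdist x y.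

Lemma closed_mdist_le (X S : metricType R) (i : X -> S) (p : S) (r : R) :
  isometric i -> closed [set x | (mdist (i x) p <= r)%R].
Proof.
move=> iso; rewrite -(setCK [set x | _]); apply: open_closedC.
rewrite openE => x /= /negP; rewrite -ltNge => rx; apply/nbhs_mdist.
exists (mdist (i x) p - r)%R; first by rewrite subr_gt0.
move=> y xy; apply/negP; rewrite -ltNge.
have := metric_triangle (i x) (i y) p; rewrite iso; lra.
Qed.

Lemma closed_mdist_ge (X S : metricType R) (i : X -> S) (p : S) (r : R) :
  isometric i -> closed [set x | (r <= mdist (i x) p)%R].
Proof.
move=> iso; rewrite -(setCK [set x | _]); apply: open_closedC.
rewrite openE => x /= /negP; rewrite -ltNge => rx; apply/nbhs_mdist.
exists (r - mdist (i x) p)%R; first by rewrite subr_gt0.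
move=> y xy; apply/negP; rewrite -ltNge.
have := metric_triangle (i y) (i x) p; rewrite iso (metric_sym y x); lra.
Qed.

Lemma open_measurable_borel (X : pmetricType R) (U : set X) :
  open U -> measurable (U : set (borelType X)).
Proof. by move=> oU; exact: sub_sigma_algebra. Qed.

Lemma closed_measurable_borel (X : pmetricType R) (C : set X) :
  closed C -> measurable (C : set (borelType X)).
Proof.
move=> cC; rewrite -(setCK C); apply: measurableC.
by apply: open_measurable_borel; exact: closed_openC.
Qed.

Lemma measurable_fun_borel d (T : measurableType d) (X : pmetricType R)
    (D : set T) (f : T -> borelType X) :
  measurable D -> (forall U : set X, open U -> measurable (D `&` f @^-1` U)) ->
  measurable_fun D f.
Proof.
move=> mD h.
apply: (@measurability _ _ T (borelType X) D f (@open X) erefl).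
by move=> _ [U oU <-]; exact: h.
Qed.

Definition dense_seq (S : metricType R) (s : nat -> S) :=
  forall x (e : R), (0 < e)%R -> exists n, (mdist x (s n) < e)%R.

Lemma separable_dense_seq (S : metricType R) (x0 : S) :
  separable_space S -> exists s : nat -> S, dense_seq s.
Proof.
move=> [D /pfcard_geP[D0 dD|/unsquash g dD]].
  by have [||x [_]] := dD setT; [exists x0|exact: openT|rewrite D0].
exists g => x e e0; have [||y [xy Dy]] := dD (ball x e)°.
- by exists x; exact: nbhsx_ballx.
- exact: open_interior.
- have [n _ gn] := 'surj_g Dy; exists n.
  by rewrite gn; have := interior_subset xy; rewrite ballEmdist.
Qed.

Section codes.
Context (S : metricType R) (s : nat -> S) (s_dense : dense_seq s).

(** The [n]-th bit of a code of [x] says whether [x] lies in the [n]-th closed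
    ball with center in the dense sequence and rational radius; on the sphere
    both answers are allowed, which makes the relation closed. *)
Definition ball_index n : nat * rat := odflt (0%N, 0%R) (unpickle n).
Definition center n := s (ball_index n).1.
Definition radius n : R := ratr (ball_index n).2.
Definition codes (x : S) (b : baire) := forall n,
  (b n = 1%N /\ (mdist x (center n) <= radius n)%R) \/
  (b n = 0%N /\ (radius n <= mdist x (center n))%R).

Lemma ball_index_surj k r : exists n, center n = s k /\ radius n = ratr r.
Proof.
exists (pickle (k, r)); by rewrite /center /radius /ball_index pickleK.
Qed.

Lemma codes_lt x b n : codes x b -> (mdist x (center n) < radius n)%R -> b n = 1%N.
Proof. by move=> /(_ n)[[//]|[_ +]]; rewrite leNgt => /negP. Qed.

Lemma codes1 x b n : codes x b -> b n = 1%N -> (mdist x (center n) <= radius n)%R.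
Proof. by move=> /(_ n)[[//]|[-> ]]. Qed.

Lemma codes0 x b n : codes x b -> b n = 0%N -> (radius n <= mdist x (center n))%R.
Proof. by move=> /(_ n)[[->]|[]]. Qed.

Lemma codes_small_ball x b (e : R) : (0 < e)%R -> codes x b ->
  exists n, [/\ b n = 1%N, (0 < radius n)%R & (radius n < e)%R].
Proof.
move=> e0 xb; have [k xk] := s_dense x e0.
have /rat_in_itvoo[r] := xk; rewrite in_itv /= => /andP[r1 r2].
have [n [cn rn]] := ball_index_surj k r; exists n; rewrite rn; split => //.
  by apply: (codes_lt xb); rewrite cn rn.
exact: le_lt_trans (mdist_ge0 _ _) r1.
Qed.

Lemma codes_inj x y b : codes x b -> codes y b -> x = y.
Proof.
move=> xb yb; apply: contrapT => /eqP; rewrite -mdist_gt0 => d0.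
have e0 : (0 < mdist x y / 2)%R by lra.
have [n [b1 r0 re]] := codes_small_ball e0 xb.
have := codes1 xb b1; have := codes1 yb b1.
have := metric_triangle x (center n) y; rewrite (metric_sym (center n) y); lra.
Qed.

Lemma codes_open (X : metricType R) (i : X -> S) (U : set X) x b : isometric i -> open U ->
  codes (i x) b -> U x <-> exists2 n, b n = 1%N &
    [set x | (mdist (i x) (center n) <= radius n)%R] `<=` U.
Proof.
move=> iso oU xb; split=> [Ux|[n b1]]; last by apply; exact: (codes1 xb).
have /nbhs_mdist[e e0 eU] : nbhs x U by apply: open_nbhs_nbhs.
have e20 : (0 < e / 2)%R by lra.
have [n [b1 r0 re]] := codes_small_ball e20 xb.
exists n => // y /= yn; apply: eU; have := codes1 xb b1.
have := metric_triangle (i x) (center n) (i y).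
by rewrite iso (metric_sym (center n) (i y)); lra.
Qed.

Definition encode (x : S) : baire := fun n => (mdist x (center n) <= radius n)%R : nat.

Lemma codes_encode x : codes x (encode x).
Proof.
move=> n; rewrite /encode; have [h|h] := leP (mdist x (center n)) (radius n).
  by left.
by right; split => //; exact: ltW.
Qed.

Lemma codes_binary x b : codes x b -> binary_seq b.
Proof. by move=> xb n; case: (xb n) => -[-> _]. Qed.

(** The codes of points of a complete space, described without mentioning the
    points: each condition concerns finitely many bits, or is a countable
    combination of such conditions, which makes the set Borel. *)
Definition consistent : set baire := [set b |
  [/\ binary_seq b,
      forall m, exists n, b n = 1%N /\ (radius n <= m.+1%:R^-1)%R,
      forall n n', b n = 1%N -> b n' = 1%N ->
        (mdist (center n) (center n') <= radius n + radius n')%R &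
      forall n n', b n = 1%N -> b n' = 0%N ->
        (radius n' <= mdist (center n) (center n') + radius n)%R]].

Lemma codes_consistent x b : codes x b -> consistent b.
Proof.
move=> xb; split.
- exact: codes_binary xb.
- move=> m; have [n [b1 _ re]] := @codes_small_ball x b m.+1%:R^-1 (ltac:(by rewrite invr_gt0)) xb.
  by exists n; split => //; exact: ltW.
- move=> n n' /(codes1 xb) h /(codes1 xb) h'.
  have := metric_triangle (center n) x (center n').
  by rewrite (metric_sym (center n) x); lra.
- move=> n n' /(codes1 xb) h /(codes0 xb) h'.
  have := metric_triangle x (center n) (center n'); lra.
Qed.

Let cyl n j : measurable [set b : baire | b n = j].
Proof. exact: (measurable_coord_in n [set j]). Qed.

Lemma measurable_consistent : measurable consistent.
Proof.
rewrite (_ : consistent =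
  (\bigcap_i ([set b : baire | b i = 0%N] `|` [set b : baire | b i = 1%N])) `&`
  (\bigcap_m \bigcup_(n in [set n | (radius n <= m.+1%:R^-1)%R]) [set b : baire | b n = 1%N]) `&`
  (\bigcap_(p in [set p | ~ (mdist (center p.1) (center p.2) <= radius p.1 + radius p.2)%R])
      ~` ([set b : baire | b p.1 = 1%N] `&` [set b : baire | b p.2 = 1%N])) `&`
  (\bigcap_(p in [set p | ~ (radius p.2 <= mdist (center p.1) (center p.2) + radius p.1)%R])
      ~` ([set b : baire | b p.1 = 1%N] `&` [set b : baire | b p.2 = 0%N]))).
  repeat apply: measurableI.
  - apply: bigcapT_measurable => i; exact: measurableU.
  - apply: bigcapT_measurable => i; exact: measurable_bigcup_count.
  - apply: measurable_bigcap_count => -[n n'] _.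
    by apply: measurableC; exact: measurableI.
  - apply: measurable_bigcap_count => -[n n'] _.
    by apply: measurableC; exact: measurableI.
apply/seteqP; split => b.
  move=> [b01 small b11 b10]; split; [split; [split|]|].
  - by move=> i _; have := b01 i; case E : (b i) => [|[|//]] _; [left|right].
  - by move=> m _; have [n [? ?]] := small m; exists n.
  - by move=> [n n'] /= nle [/= bn bn']; apply: nle; exact: b11.
  - by move=> [n n'] /= nle [/= bn bn']; apply: nle; exact: b10.
move=> [[[b01 small] b11] b10]; split.
- by move=> i; case: (b01 i I) => /= ->.
- by move=> m; have [n ? ?] := small m I; exists n.
- by move=> n n' bn bn'; apply: contrapT => nle; apply: (b11 (n, n')).
- by move=> n n' bn bn'; apply: contrapT => nle; apply: (b10 (n, n')).
Qed.

End codes.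

(** Centers of smaller and smaller balls of the code form a Cauchy sequence. *)
Lemma consistent_codes (S : completeMetricType R) (s : nat -> S) b :
  dense_seq s -> consistent s b -> exists x, codes s x b.
Proof.
move=> sd [b01 /choice[f Hf] b11 b10].
have [eps epsE] : exists eps : nat -> R, forall m, eps m = (m.+1%:R^-1)%R.
  by exists (fun m => m.+1%:R^-1)%R.
pose p m := center s (f m).
have Hf1 m : b (f m) = 1%N by have [] := Hf m.
have Hf2 m : (radius (f m) <= eps m)%R by rewrite epsE; have [] := Hf m.
have pp m l : (mdist (p m) (p l) <= eps m + eps l)%R.
  have := b11 _ _ (Hf1 m) (Hf1 l); have := Hf2 m; have := Hf2 l.
  by rewrite -/(p m) -/(p l); lra.
have small (e : R) : (0 < e)%R -> exists N, forall m, (N <= m)%N -> (eps m < e)%R.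
  move=> e0; have [N _ HN] := near_infty_natSinv_lt (PosNum e0).
  by exists N => m Nm; rewrite epsE; exact: HN.
have /cauchy_cvgP cvp : cauchy (p @ \oo).
  apply/cauchy_ballP => e e0.
  have e20 : (0 < e / 2)%R by rewrite divr_gt0.
  have [N HN] := small _ e20.
  exists ([set x | exists2 m, (N <= m)%N & x = p m], [set x | exists2 m, (N <= m)%N & x = p m]).
    by split; exists N => // m Nm; exists m.
  move=> [_ _] [[m Nm ->] [l Nl ->]]; rewrite /= ballEmdist /=.
  have := HN m Nm; have := HN l Nl; have := pp m l; lra.
set x := lim (p @ \oo) in cvp.
have px (e : R) : (0 < e)%R -> exists m, (mdist (p m) x < e)%R /\ (eps m < e)%R.
  move=> e0; have /cvp[N _ HN] : nbhs x [set y | (mdist x y < e)%R].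
    by apply/nbhs_mdist; exists e.
  have [M HM] := small e e0; exists (maxn N M).
  by rewrite metric_sym; split; [apply: HN; exact: leq_maxl|apply: HM; exact: leq_maxr].
exists x => n.
have := b01 n; case E : (b n) => [|[|//]] _; [right|left]; split => //;
  apply/ler_addgt0Pr => e e0; have e20 : (0 < e / 2)%R by [rewrite divr_gt0];
  have [m [pm me]] := px _ e20; have := Hf2 m.
  have := b10 _ _ (Hf1 m) E; have := metric_triangle (p m) x (center s n).
  by rewrite -/(p m); lra.
have := b11 _ _ (Hf1 m) E; have := metric_triangle x (p m) (center s n).
by rewrite -/(p m) (metric_sym x (p m)); lra.
Qed.

End metric.

Section polish.
Context {R : realType}.

Section code_space.
Context (S : completeMetricType R) (s : nat -> S) (sd : dense_seq s).

Let cyl n j : measurable [set b : baire | b n = j].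
Proof. exact: (measurable_coord_in n [set j]). Qed.

Lemma measurable_codes_borel (B : set S) : <<s @open S >> B ->
  measurable [set b : baire | exists2 x, codes s x b & B x].
Proof.
move=> mB; apply: (mB [set B | measurable [set b : baire | exists2 x, codes s x b & B x]]).
have mT : measurable [set b : baire | exists x, codes s x b].
  rewrite (_ : [set _ | _] = consistent s); first exact: measurable_consistent.
  apply/seteqP; split => b; first by move=> [x]; exact: codes_consistent.
  exact: consistent_codes.
split.
- split.
  + rewrite /= (_ : [set _ | _] = set0)//.
    by apply/seteqP; split=> // b [].
  + move=> A mA /=; rewrite (_ : [set _ | _] = [set b : baire | exists x, codes s x b] `\`
      [set b : baire | exists2 x, codes s x b & A x]); first exact: measurableD.
    apply/seteqP; split=> b.
      move=> [x xb [_ nAx]]; split; first by exists x.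
      by move=> [y yb Ay]; apply: nAx; rewrite (codes_inj sd xb yb).
    move=> [[x xb] nA]; exists x => //; split => // Ax; apply: nA; by exists x.
  + move=> A mA /=; rewrite (_ : [set _ | _] =
      \bigcup_k [set b : baire | exists2 x, codes s x b & A k x]).
      exact: bigcupT_measurable.
    apply/seteqP; split=> b.
      by move=> [x xb [k _ Ak]]; exists k => //; exists x.
    by move=> [k _ [x xb Ak]]; exists x => //; exists k.
- move=> U oU /=; have iso : isometric (@id S) by [].
  rewrite (_ : [set _ | _] = [set b : baire | exists x, codes s x b] `&`
    \bigcup_(n in [set n | [set x | (mdist x (center s n) <= radius n)%R] `<=` U])
       [set b : baire | b n = 1%N]).
    by apply: measurableI => //; exact: measurable_bigcup_count.
  apply/seteqP; split=> b.
    move=> [x xb Ux]; split; first by exists x.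
    by have /(codes_open sd iso oU xb)[n b1 nU] := Ux; exists n.
  move=> [[x xb] [n nU b1]]; exists x => //.
  by apply/(codes_open sd iso oU xb); exists n.
Qed.

End code_space.

(** [X] is measurably a retract [beta] of a Borel set [D] of binary sequences,
    in such a way that compact sets have closed preimages. *)
Lemma polish_coding (X : pmetricType R) : borel_subset_of_polish X ->
  exists (e : X -> baire) (D : set baire) (beta : baire -> X),
  [/\ measurable_fun setT (e : borelType X -> baire), measurable D,
      measurable_fun setT (beta : baire -> borelType X),
      forall x, D (e x) /\ beta (e x) = x &
      D `<=` binary_seq /\
      forall K b, compact K -> binary_seq b ->
       (forall k, exists b', [/\ agree k b b', D b' & K (beta b')]) -> D b /\ K (beta b)].
Proof.
move=> [S [i [sepS iso mi]]].
have [s sd] := separable_dense_seq (i point) sepS.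
pose D : set baire := [set b | exists x, codes s (i x) b].
pose beta b : X := get [set x | codes s (i x) b].
have betaP b : D b -> codes s (i (beta b)) b by move=> Db; exact: (getPex Db).
have i_inj x y : i x = i y -> x = y.
  by move=> ixy; apply: mdist_positivity; rewrite -iso ixy mdistxx.
have beta_eq x b : codes s (i x) b -> beta b = x.
  move=> xb; apply: i_inj; apply: (codes_inj sd _ xb); apply: betaP; by exists x.
have mD : measurable D.
  rewrite (_ : D = [set b : baire | exists2 x, codes s x b & range i x]).
    exact: measurable_codes_borel.
  apply/seteqP; split=> b; first by move=> [x xb]; exists (i x) => //; exists x.
  by move=> [y yb [x _ xy]]; exists x; rewrite xy.
exists (fun x => encode s (i x)), D, beta; split => //.
- apply: measurable_fun_trajectory => n _ B mB; rewrite setTI.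
  have mC : measurable ([set x : X | (mdist (i x) (center s n) <= radius n)%R] : set (borelType X)).
    by apply: closed_measurable_borel; exact: closed_mdist_le.
  rewrite (_ : _ @^-1` _ =
    (if `[< B 1%N >] then [set x : X | (mdist (i x) (center s n) <= radius n)%R] else set0) `|`
    (if `[< B 0%N >] then ~` [set x : X | (mdist (i x) (center s n) <= radius n)%R] else set0)).
    by apply: measurableU; case: ifP => // _; exact: measurableC.
  apply/seteqP; split=> x; rewrite /encode /=.
    case: (leP (mdist (i x) _)) => /= h Bx; [left|right]; case: asboolP => //= _.
    by apply/negP; rewrite -ltNge.
  by case=> /=; case: asboolP => //= Bj; [move=> ->|move=> /negP/negbTE ->].
- apply: measurable_fun_borel => // U oU; rewrite setTI.
  have beta_point b : ~ D b -> beta b = point.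
    by move=> nD; apply: xgetPN => x xb; apply: nD; exists x.
  rewrite (_ : _ @^-1` _ = D `&`
    \bigcup_(n in [set n | [set x | (mdist (i x) (center s n) <= radius n)%R] `<=` U])
       [set b : baire | b n = 1%N] `|` (if `[< U point >] then ~` D else set0)).
    apply: measurableU; last by case: ifP => // _; exact: measurableC.
    apply: measurableI => //; apply: measurable_bigcup_count => n _.
    exact: (measurable_coord_in n [set 1%N]).
  apply/seteqP; split=> b /=.
    move=> Ub; have [Db|nDb] := pselect (D b); [left; split => //|right].
      by have /(codes_open sd iso oU (betaP _ Db))[n b1 nU] := Ub; exists n.
    by move: Ub; rewrite beta_point//; case: asboolP.
  case=> [[Db [n nU b1]]|]; last by case: asboolP => // Up /beta_point ->.
  by apply/(codes_open sd iso oU (betaP _ Db)); exists n.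
- move=> x; have xe : codes s (i x) (encode s (i x)) by exact: codes_encode.
  by split; [exists x|exact: beta_eq].
split; first by move=> b [x]; exact: codes_binary.
move=> K b cK b2 /choice[f Hf].
have Kf n : K (beta (f n)) by case: (Hf n).
have [x Kx Hx] := compact_seq_cluster cK Kf.
suff xb : codes s (i x) b by split; [exists x|rewrite (beta_eq _ _ xb)].
move=> n; have bn k : (n < k)%N -> b n = f k n by move=> nk; case: (Hf k) => + _ _; exact.
have := b2 n; case E : (b n) => [|[|//]] _; [right|left]; split => //.
  apply: (Hx [set x | (radius n <= mdist (i x) (center s n))%R] n.+1).
    exact: closed_mdist_ge.
  by move=> k nk /=; case: (Hf k) => _ /betaP /codes0 + _; apply; rewrite -bn.
apply: (Hx [set x | (mdist (i x) (center s n) <= radius n)%R] n.+1).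
  exact: closed_mdist_le.
by move=> k nk /=; case: (Hf k) => _ /betaP /codes1 + _; apply; rewrite -bn.
Qed.

(** The theorem of Novikov on Borel sets with compact sections, transported from
    the Baire space along the codings of [X] and [A]: compactness of the sections
    in [A] makes the sections of the coded set closed. *)
Theorem measurable_projection (X A : pmetricType R)
    (hX : borel_subset_of_polish X) (hA : borel_subset_of_polish A)
    (G : set (borelType X * borelType A)) : measurable G ->
  (forall x, compact ([set a | G (x, a)] : set A)) ->
  measurable ([set x | exists a, G (x, a)] : set (borelType X)).
Proof.
move=> mG cG.
have [e1 [D1 [b1 [me1 mD1 mb1 eb1 [D12 _]]]]] := polish_coding hX.
have [e2 [D2 [b2 [me2 mD2 mb2 eb2 [D22 HK]]]]] := polish_coding hA.
have modds := measurable_odds; have mevens := measurable_evens.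
pose E := evens @^-1` D1 `&` odds @^-1` D2.
have mE : measurable E.
  by apply: measurableI; rewrite -[X in measurable X]setTI; [exact: mevens|exact: modds].
pose h (z : baire) : borelType X * borelType A := (b1 (evens z), b2 (odds z)).
have mh : measurable_fun setT h.
  by apply/measurable_fun_pair; exact: measurableT_comp.
have mG' : measurable (evens @` (E `&` h @^-1` G)).
  apply: measurable_projection_baire.
    by apply: measurableI => //; rewrite -[X in measurable X]setTI; exact: mh.
    by move=> z [[_ Dz] _]; exact: D22.
  move=> x y y2 Hy.
  have [y0 _ [[+ _] _]] := Hy 0%N; rewrite /= evens_join => Dx.
  have [|Dy Gy] := HK [set a | G (b1 x, a)] y (cG _) y2.
    move=> k; have [y' yy' [[_ Dy'] Gy']] := Hy k; exists y'.
    by move: Dy' Gy'; rewrite /h /= evens_join odds_join.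
  by split; [split|]; rewrite /h /= ?evens_join ?odds_join.
rewrite (_ : [set x | _] = e1 @^-1` (evens @` (E `&` h @^-1` G))).
  by rewrite -[X in measurable X]setTI; exact: me1.
apply/seteqP; split=> x.
  move=> [a Gxa]; exists (join (e1 x) (e2 a)); rewrite ?evens_join//.
  have [Dx bx] := eb1 x; have [Da ba] := eb2 a.
  by split; [split|]; rewrite /h /= ?evens_join ?odds_join// bx ba.
move=> [z [[D1z D2z] Gz] zx]; exists (b2 (odds z)).
by move: Gz; rewrite /h /= zx; have [_ ->] := eb1 x.
Qed.

(** * Measurable selection of minimizers *)

(** Minimization and increasing limits commute under compactness: a cluster
    point of approximate minimizers of the [f n] works for all of them. *)
Lemma inf_compact_interchange (A : pmetricType R) (f : nat -> A -> \bar R) (l : R) :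
  (forall n, inf_compact (f n)) ->
  (forall n m a, (n <= m)%N -> f n a <= f m a) ->
  (forall n (e : R), (0 < e)%R -> exists a, f n a <= (l + e)%:E) ->
  exists a, forall n, f n a <= l%:E.
Proof.
move=> cf fmon Hf.
have {}Hf n : exists a, f n a <= (l + n.+1%:R^-1)%:E by apply: Hf; rewrite invr_gt0.
have /choice[a Ha] := Hf.
have cK n (r : R) : compact [set a | f n a <= r%:E].
  by have := cf n r; rewrite setTI.
have fle n m : (n <= m)%N -> f n (a m) <= (l + n.+1%:R^-1)%:E.
  move=> nm; apply: (le_trans (fmon _ _ _ nm)); apply: (le_trans (Ha m)).
  by rewrite lee_fin lerD2l lef_pV2 ?posrE// ler_nat.
have [n|p _ Hp] := compact_seq_cluster (cK 0%N (l + 1)%R) (x := a).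
  by have := fle 0%N n isT; rewrite invr1.
have fp n : f n p <= (l + n.+1%:R^-1)%:E.
  apply: (Hp [set a | f n a <= (l + n.+1%:R^-1)%:E] n); last by move=> m; exact: fle.
  by apply: compact_closed; [exact: metric_hausdorff|exact: cK].
exists p => n; apply/lee_addgt0Pr => e e0; rewrite -EFinD.
have [N _ HN] := near_infty_natSinv_lt (PosNum e0).
apply: (le_trans (fmon _ (maxn n N) _ (leq_maxl _ _))).
apply: (le_trans (fp _)); rewrite lee_fin lerD2l ltW//.
by apply: HN; exact: leq_maxr.
Qed.

Lemma inf_compact_min (A : pmetricType R) (f : A -> \bar R) :
  inf_compact f -> (forall a, 0 <= f a) -> exists a, forall a', f a <= f a'.
Proof.
move=> cf f0; pose m := ereal_inf (range f).
have mf a : m <= f a by apply: ereal_inf_lbound; exists a.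
have m0 : 0 <= m by apply: le_ereal_inf_tmp => _ [a _ <-].
have [moo|] := eqVneq m +oo.
  by exists point => a'; have := mf a'; rewrite moo leye_eq => /eqP ->; rewrite leey.
move=> mnoo; have mfin : m \is a fin_num by rewrite ge0_fin_numE// ltey.
have [|//||a Ha] := @inf_compact_interchange A (fun=> f) (fine m) => //.
  move=> _ e e0; have : m < (fine m + e)%:E.
    by rewrite EFinD fineK// lteDl// lte_fin.
  by move=> /ereal_inf_lt[_ [a _ <-]] /ltW; exists a.
by exists a => a'; apply: le_trans (mf a'); have := Ha 0%N; rewrite fineK.
Qed.

Lemma compact_subset_closed (A : pmetricType R) (K C : set A) :
  compact K -> closed C -> compact (K `&` C).
Proof.
move=> cK cC; have clK : closed K by apply: compact_closed => //; exact: metric_hausdorff.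
by apply: (subclosed_compact _ cK); [exact: closedI|move=> x []].
Qed.

Lemma measurable_fun_if_set d d' (T : measurableType d) (T' : measurableType d')
    (P : set T) (g h : T -> T') : measurable P ->
  measurable_fun setT g -> measurable_fun setT h ->
  measurable_fun setT (fun z => if `[< P z >] then g z else h z).
Proof.
move=> mP mg mh; apply: measurable_fun_ifT => //.
apply: (measurable_fun_bool true); rewrite setTI.
rewrite (_ : _ @^-1` _ = P)//; apply/seteqP; split=> z /=; first by move/asboolP.
by move=> Pz; apply/asboolP.
Qed.

Section selection.
Context (X A : pmetricType R).
Hypotheses (hX : borel_subset_of_polish X) (hA : borel_subset_of_polish A).
Local Notation XA := (borelType X * borelType A)%type.

(** Minimality is tested against rational levels only, which presents the set by
    countably many projections; states where [f] is infinite have no minimizer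
    in this sense. *)
Definition argmin (f : X * A -> \bar R) : set (X * A) :=
  [set z | f z < +oo /\ forall r : rat, (exists a, f (z.1, a) <= (ratr r)%:E) -> f z <= (ratr r)%:E].

Lemma argminP (f : X * A -> \bar R) x a a' : (forall z, 0 <= f z) ->
  argmin f (x, a) -> f (x, a) <= f (x, a').
Proof.
move=> f0 [foo fr]; rewrite leNgt; apply/negP => h.
have fa : f (x, a) \is a fin_num by rewrite ge0_fin_numE.
have fa' : f (x, a') \is a fin_num by rewrite ge0_fin_numE// (lt_trans h).
move: h; rewrite -(fineK fa) -(fineK fa') lte_fin => /rat_in_itvoo[r].
rewrite in_itv /= => /andP[r1 r2].
have := fr r (ex_intro _ a' _); rewrite -(fineK fa) -(fineK fa') !lee_fin.
by move=> /(_ (ltW r1)); rewrite leNgt r2.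
Qed.

Lemma argmin_ex (f : X * A -> \bar R) x : (forall z, 0 <= f z) ->
  inf_compact (fun a => f (x, a)) -> (exists a, f (x, a) < +oo) ->
  exists a, argmin f (x, a).
Proof.
move=> f0 cf [a0 fa0]; have [a Ha] := inf_compact_min cf (fun a => f0 (x, a)).
exists a; split; first exact: le_lt_trans (Ha a0) fa0.
by move=> r [a' fa']; exact: le_trans (Ha a') fa'.
Qed.

Lemma compact_level (f : A -> \bar R) (r : R) : inf_compact f ->
  compact [set a | f a <= r%:E].
Proof. by move=> /(_ r); rewrite setTI. Qed.

Lemma compact_argmin (f : X * A -> \bar R) x : (forall z, 0 <= f z) ->
  inf_compact (fun a => f (x, a)) -> compact [set a | argmin f (x, a)].
Proof.
move=> f0 cf; have [[a0 fa0]|/forallNP h] := pselect (exists a, f (x, a) < +oo); last first.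
  rewrite (_ : [set _ | _] = set0); first exact: compact0.
  by apply/seteqP; split=> // a [foo _]; exact: (h a).
have [a am] := argmin_ex f0 cf (ex_intro _ a0 fa0).
have fa : f (x, a) \is a fin_num by rewrite ge0_fin_numE//; case: am.
rewrite (_ : [set _ | _] = [set a' | f (x, a') <= (fine (f (x, a)))%:E]).
  exact: (compact_level (f := fun a => f (x, a)) cf).
apply/seteqP; split=> a' /=; rewrite fineK//; first exact: argminP.
move=> a'a; split; first by apply: le_lt_trans a'a _; case: am.
move=> r [a'' fa'']; apply: le_trans a'a (le_trans _ fa''); exact: argminP.
Qed.

Lemma measurable_argmin (f : X * A -> \bar R) : measurable_fun setT (f : XA -> \bar R) ->
  (forall x, inf_compact (fun a => f (x, a))) ->
  measurable (argmin f : set XA).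
Proof.
move=> mf cf.
have ml (r : R) : measurable ([set z | f z <= r%:E] : set XA).
  by rewrite -[X in measurable X]setTI; exact: emeasurable_fun_infty_c.
rewrite (_ : argmin f = [set z | f z < +oo] `&` \bigcap_(r : rat)
   ((~` ((fst : XA -> borelType X) @^-1` [set x | exists a, f (x, a) <= (ratr r)%:E])) `|`
    [set z | f z <= (ratr r)%:E])).
  apply: measurableI.
    by rewrite -[X in measurable X]setTI; exact: emeasurable_fun_infty_o.
  apply: measurable_bigcap_count => r _; apply: measurableU => //.
  apply: measurableC; rewrite -[X in measurable X]setTI; apply: measurable_fst => //.
  apply: (measurable_projection hX hA (ml (ratr r))) => x.
  exact: (compact_level (f := fun a => f (x, a)) (cf x)).
apply/seteqP; split=> -[x a] [foo fr]; split => // r.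
  move=> _ /=; have [h|h] := pselect (exists a, f (x, a) <= (ratr r)%:E); last by left.
  by right; exact: fr.
by move=> h; have [] := fr r I => // /(_ h).
Qed.

(** Lexicographic minimization: first of [f], then of the distances to the
    points of a dense sequence, which leaves a single point. *)
Theorem measurable_minimizer (f : X * A -> \bar R) :
  measurable_fun setT (f : XA -> \bar R) -> (forall z, 0 <= f z) ->
  (forall x, inf_compact (fun a => f (x, a))) ->
  exists phi : X -> A, measurable_fun setT (phi : borelType X -> borelType A) /\
    forall x a, f (x, phi x) <= f (x, a).
Proof.
move=> mf f0 cf; have [S [i [sepS iso _]]] := hA.
have [s sd] := separable_dense_seq (i point) sepS.
have mfin : measurable ([set x | exists a, f (x, a) < +oo] : set (borelType X)).
  rewrite (_ : [set _ | _] = \bigcup_n [set x | exists a, f (x, a) <= n%:R%:E]).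
    apply: bigcupT_measurable => n.
    apply: (measurable_projection hX hA (G := [set z | f z <= n%:R%:E])) => [|x].
      by rewrite -[X in measurable X]setTI; exact: emeasurable_fun_infty_c.
    exact: (compact_level (f := fun a => f (x, a)) (cf x)).
  apply/seteqP; split=> x; last by move=> [n _ [a fa]]; exists a; exact: le_lt_trans fa (ltry _).
  move=> [a fa]; have fin : f (x, a) \is a fin_num by rewrite ge0_fin_numE.
  have [n Hn] : exists n : nat, (fine (f (x, a)) <= n%:R)%R.
    by exists (Num.bound `|fine (f (x, a))|%R); rewrite ltW// (le_lt_trans (ler_norm _))// archi_boundP.
  by exists n => //; exists a; rewrite -(fineK fin) lee_fin.
(* The states with no finite value get a fixed action. *)
pose g0 : X * A -> \bar R := fun z =>
  if `[< exists a, f (z.1, a) < +oo >] then f z else (if `[< z.2 = point >] then 0 else +oo).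
pose restr (G : set (X * A)) n : X * A -> \bar R := fun z =>
  if `[< G z >] then (mdist (i z.2) (s n))%:E else +oo.
pose G := fix G n := if n is n'.+1 then argmin (restr (G n') n') else argmin g0.
have g00 z : 0 <= g0 z by rewrite /g0; do 2 case: asboolP => //.
have restr0 G' n z : 0 <= restr G' n z.
  by rewrite /restr; case: asboolP => // _; rewrite lee_fin mdist_ge0.
have cg0 x : inf_compact (fun a => g0 (x, a)).
  move=> r; rewrite /g0 /=; case: asboolP => _; first exact: cf.
  rewrite setTI.
  have [r0|r0] := leP 0%R r.
    rewrite (_ : [set _ | _] = [set point]); first exact: compact_set1.
    by apply/seteqP; split=> a /=; case: asboolP => //; rewrite lee_fin.
  rewrite (_ : [set _ | _] = set0); first exact: compact0.
  by apply/seteqP; split=> a //=; case: asboolP => //; rewrite lee_fin leNgt r0.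
have crestr G' n x : compact [set a | G' (x, a)] -> inf_compact (fun a => restr G' n (x, a)).
  move=> cG r; rewrite setTI /restr /=.
  rewrite (_ : [set _ | _] = [set a | G' (x, a)] `&` [set a | (mdist (i a) (s n) <= r)%R]).
    by apply: compact_subset_closed => //; exact: closed_mdist_le.
  apply/seteqP; split=> a /=; first by case: asboolP => // _ h; split.
  by move=> [Ga]; case: asboolP.
have mg0 : measurable_fun setT (g0 : XA -> \bar R).
  apply: (@measurable_fun_if_set _ _ XA (\bar R) (fst @^-1` [set x | exists a, f (x, a) < +oo])
    f (fun z => if `[< z.2 = point >] then 0 else +oo)) => //.
    by rewrite -[X in measurable X]setTI; apply: (measurable_fst (T2 := borelType A)).
  apply: (@measurable_fun_if_set _ _ XA (\bar R) (snd @^-1` [set point]) (cst 0) (cst +oo)) => //.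
  rewrite -[X in measurable X]setTI; apply: (measurable_snd (T1 := borelType X)) => //.
  by apply: closed_measurable_borel; exact: (compact_closed (@metric_hausdorff _ A) (@compact_set1 _ _)).
have mrestr G' n : measurable (G' : set XA) -> measurable_fun setT (restr G' n : XA -> \bar R).
  move=> mG'; apply: (@measurable_fun_if_set _ _ XA (\bar R) G'
    (fun z => (mdist (i z.2) (s n))%:E) (cst +oo)) => //.
  apply/measurable_EFinP.
  apply: (measurableT_comp (f := fun a : borelType A => mdist (i a) (s n))); last exact: measurable_snd.
  apply: (@measurability _ _ (borelType A) R setT _ _ (RGenOInfty.measurableE R)) => _ [_ [r ->] <-].
  rewrite setTI preimage_itvoy -(setCK [set a | _]).
  apply: measurableC; apply: closed_measurable_borel.
  rewrite (_ : ~` _ = [set a | (mdist (i a) (s n) <= r)%R]); first exact: closed_mdist_le.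
  by apply/seteqP; split=> a /=; rewrite leNgt => /negP.
have cG n x : compact [set a | G n (x, a)].
  by elim: n => [|n IH]; apply: compact_argmin => //; exact: crestr.
have mG n : measurable (G n : set XA).
  elim: n => [|n IH]; apply: measurable_argmin => //; first exact: mrestr.
  by move=> x; apply: crestr; exact: cG.
have neG n x : exists a, G n (x, a).
  elim: n => [|n [a IH]]; apply: argmin_ex => //.
  - rewrite /g0 /=; case: asboolP => [//|_]; exists point; by case: asboolP.
  - exact: crestr.
  - by exists a; rewrite /restr; case: asboolP => // _; rewrite ltry.
have GS n z : G n.+1 z -> G n z.
  by move=> [+ _]; rewrite /restr; case: asboolP.
have Gle n m z : (n <= m)%N -> G m z -> G n z.
  elim: m => [|m IH]; first by rewrite leqn0 => /eqP ->.
  by rewrite leq_eqVlt => /orP[/eqP ->//|]; rewrite ltnS => /IH h /GS.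
have clG n x : closed [set a | G n (x, a)].
  by apply: compact_closed => //; exact: metric_hausdorff.
pose Goo : set (X * A) := \bigcap_n G n.
have neGoo x : exists a, Goo (x, a).
  have /choice[a Ha] := fun n => neG n x.
  have [n|p _ Hp] := compact_seq_cluster (cG 0%N x) (x := a); first exact: Gle (Ha n).
  exists p => n _; apply: (Hp [set a | G n (x, a)] n) => // m nm; exact: Gle (Ha m).
have Goo_uniq x a a' : Goo (x, a) -> Goo (x, a') -> a = a'.
  move=> Ga Ga'.
  have dn n : mdist (i a) (s n) = mdist (i a') (s n).
    have Gn := Ga n I; have Gn' := Ga' n I.
    have rE b : G n (x, b) -> restr (G n) n (x, b) = (mdist (i b) (s n))%:E.
      by move=> Gb; rewrite /restr; case: asboolP.
    have h1 := argminP a' (restr0 (G n) n) (Ga n.+1 I).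
    have h2 := argminP a (restr0 (G n) n) (Ga' n.+1 I).
    by apply/eqP; rewrite eq_le -!lee_fin -!rE// h1 h2.
  apply: contrapT => /eqP; rewrite -mdist_gt0 => d0.
  have d20 : (0 < mdist a a' / 2)%R by rewrite divr_gt0.
  have [n hn] := sd (i a) _ d20; have := metric_triangle (i a) (s n) (i a').
  by rewrite iso (metric_sym (s n)) -dn; lra.
have /choice[phi Hphi] := neGoo.
exists phi; split; last first.
  move=> x a; have := argminP a g00 (Hphi x 0%N I); rewrite /g0 /=.
  case: asboolP => // /forallNP h _; have /negP := h a.
  by rewrite -leNgt leye_eq => /eqP ->; rewrite leey.
apply: measurable_fun_borel => // U oU; rewrite setTI.
rewrite -(setCK (phi @^-1` U)); apply: measurableC.
rewrite (_ : ~` _ = [set x | exists a, (Goo `&` snd @^-1` (~` U)) (x, a)]).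
  apply: (measurable_projection hX hA).
    apply: measurableI; first exact: bigcapT_measurable.
    rewrite -[X in measurable X]setTI; apply: (measurable_snd (T1 := borelType X)) => //.
    by apply: measurableC; exact: open_measurable_borel.
  move=> x; rewrite (_ : [set _ | _] = [set a | G 0%N (x, a)] `&`
      (\bigcap_n [set a | G n (x, a)] `&` ~` U)).
    apply: compact_subset_closed => //; apply: closedI; last exact: open_closedC.
    by apply: closed_bigI => n _; exact: clG.
  apply/seteqP; split=> a; first by move=> [h nU]; split; [exact: h|split].
  by move=> [_ [h nU]]; split.
apply/seteqP; split=> x /=; first by move=> nU; exists (phi x).
by move=> [a [Ga nU]]; rewrite (Goo_uniq _ _ _ (Hphi x) Ga).
Qed.

End selection.
End polish.

(** * The Ionescu Tulcea theorem *)

Section kernel_operations.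
Context {R : realType}.

Section precomposition.
Context d1 d2 d3 (X : measurableType d1) (Y : measurableType d2) (Z : measurableType d3).
Variables (k : R.-pker Y ~> Z) (f : X -> Y).

Definition kpre (mf : measurable_fun setT f) (x : X) : {measure set Z -> \bar R} := k (f x).

Hypothesis mf : measurable_fun setT f.

Let kpre_measurable U : measurable U -> measurable_fun setT (kpre mf ^~ U).
Proof. by move=> mU; exact: measurableT_comp (measurable_kernel k U mU) mf. Qed.

HB.instance Definition _ := isKernel.Build _ _ X Z R (kpre mf) kpre_measurable.

Let kpre_prob x : kpre mf x setT = 1.
Proof. exact: prob_kernel. Qed.

HB.instance Definition _ := Kernel_isProbability.Build _ _ X Z R (kpre mf) kpre_prob.

End precomposition.

Section composition.
Context d1 d2 d3 (X : measurableType d1) (Y : measurableType d2) (Z : measurableType d3).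
Variables (l : R.-pker X ~> Y) (k : R.-pker (X * Y) ~> Z).

Definition kbind : X -> {measure set Z -> \bar R} := mkcomp l k.

Let kbind_measurable U : measurable U -> measurable_fun setT (kbind ^~ U).
Proof. exact: measurable_kernel. Qed.

HB.instance Definition _ := isKernel.Build _ _ X Z R kbind kbind_measurable.

Let kbind_prob x : kbind x setT = 1.
Proof.
rewrite /kbind /= /kcomp (eq_integral (cst 1)); last by move=> y _; exact: prob_kernel.
by rewrite integral_cst// mul1e; exact: prob_kernel.
Qed.

HB.instance Definition _ := Kernel_isProbability.Build _ _ X Z R kbind kbind_prob.

Lemma integral_kbind x (f : Z -> \bar R) : (forall z, 0 <= f z) ->
  measurable_fun setT f ->
  \int[kbind x]_z f z = \int[l x]_y \int[k (x, y)]_z f z.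
Proof. exact: integral_kcomp. Qed.

End composition.
End kernel_operations.

Lemma integral_indicator {R : realType} d (T : measurableType d)
    (mu : {measure set T -> \bar R}) C : measurable C ->
  \int[mu]_x (\1_C x)%:E = mu C.
Proof. by move=> mC; rewrite integral_indic// setIT. Qed.

Lemma integral_eq_cst {R : realType} d (T : measurableType d)
    (mu : {measure set T -> \bar R}) (f : T -> \bar R) r :
  mu setT = 1 -> (forall x, f x = r) -> \int[mu]_x f x = r.
Proof.
move=> mu1 fr; by rewrite (eq_integral (cst r)) ?integral_cst ?mu1 ?mule1.
Qed.

Section ionescu_tulcea.
Context {R : realType} d (E : measurableType d).
Local Notation Omega := (trajectoryType E).
Variable kappa : nat -> R.-pker Omega ~> E.
Hypothesis kappa_local : forall t w w', agree t w w' ->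
  forall B, measurable B -> kappa t w B = kappa t w' B.

Definition upd t (w : Omega) (z : E) : Omega := fun i => if i == t then z else w i.

Lemma measurable_upd t : measurable_fun setT (fun p : Omega * E => upd t p.1 p.2).
Proof.
apply: measurable_fun_trajectory => i; rewrite /upd; case: eqP => _.
  exact: measurable_snd.
exact: (measurableT_comp (measurable_coord (T := E) i) measurable_fst).
Qed.

Lemma measurable_upd2 t w : measurable_fun setT (upd t w).
Proof.
apply: measurable_fun_trajectory => i; rewrite /upd; case: eqP => _.
  exact: measurable_id.
exact: measurable_cst.
Qed.

Lemma agree_upd t w z : agree t w (upd t w z).
Proof. by move=> i it; rewrite /upd ltn_eqF. Qed.

Lemma agree_upd2 t w w' z : agree t w w' -> agree t.+1 (upd t w z) (upd t w' z).
Proof.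
move=> ww i; rewrite ltnS leq_eqVlt /upd => /orP[/eqP ->|it]; first by rewrite eqxx.
by rewrite ltn_eqF// ww.
Qed.

(** For [T] equal to [Prop], this says that a set is a cylinder over the first
    [t] coordinates. *)
Definition depends_on t (T : Type) (F : Omega -> T) := forall w w', agree t w w' -> F w = F w'.

Lemma depends_on_le s t T (F : Omega -> T) : (s <= t)%N -> depends_on s F -> depends_on t F.
Proof. by move=> st h w w' ww; apply: h; exact: agree_le ww. Qed.

(** One step of the dynamics: the conditional expectation of [F] given the
    first [t] coordinates, when [F] depends on the first [t.+1] ones. *)
Definition step t (F : Omega -> \bar R) (w : Omega) : \bar R :=
  \int[kappa t w]_z F (upd t w z).

Fixpoint steps s n (F : Omega -> \bar R) : Omega -> \bar R :=
  if n is n'.+1 then step s (steps s.+1 n' F) else F.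

Definition nnm (F : Omega -> \bar R) := (forall w, 0 <= F w) /\ measurable_fun setT F.

Lemma nnm_upd t w F : nnm F -> measurable_fun setT (fun z => F (upd t w z)).
Proof. by move=> [_ mF]; apply: measurableT_comp => //; exact: measurable_upd2. Qed.

Lemma step_ge0 t F : (forall w, 0 <= F w) -> forall w, 0 <= step t F w.
Proof. by move=> F0 w; exact: integral_ge0. Qed.

Lemma nnm_step t F : nnm F -> nnm (step t F).
Proof.
move=> [F0 mF]; split; first exact: step_ge0.
apply: (measurable_fun_integral_sfinite_kernel (fun p => F (upd t p.1 p.2))) => //.
by apply: measurableT_comp => //; exact: measurable_upd.
Qed.

Lemma steps_ge0 s n F : (forall w, 0 <= F w) -> forall w, 0 <= steps s n F w.
Proof. by move=> F0; elim: n s => //= n IH s; apply: step_ge0. Qed.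

Lemma nnm_steps s n F : nnm F -> nnm (steps s n F).
Proof. by move=> F0; elim: n s => //= n IH s; apply: nnm_step. Qed.

Lemma step_id t F : depends_on t F -> step t F = F.
Proof.
move=> dF; apply/funext => w; apply: integral_eq_cst; first exact: prob_kernel.
by move=> z; apply/esym/dF; exact: agree_upd.
Qed.

Lemma depends_on_step t F : depends_on t.+1 F -> depends_on t (step t F).
Proof.
move=> dF w w' ww; rewrite /step (eq_measure_integral (kappa t w')).
  by apply: eq_integral => z _; apply: dF; exact: agree_upd2.
by move=> B mB _; exact: kappa_local.
Qed.

Lemma steps_id s n F : depends_on s F -> steps s n F = F.
Proof.
elim: n s => //= n IH s dF; rewrite IH; first exact: step_id.
exact: depends_on_le dF.
Qed.

Lemma stepsD s n m F : steps s (n + m) F = steps s n (steps (s + n) m F).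
Proof.
elim: n s => [|n IH] s /=; first by rewrite addn0.
by rewrite IH addSnnS.
Qed.

Lemma steps_stable s n m F : (n <= m)%N -> depends_on (s + n) F -> steps s m F = steps s n F.
Proof. by move=> nm dF; rewrite -(subnKC nm) stepsD (steps_id (s := s + n)). Qed.

Lemma step_mono t F G : nnm F -> nnm G -> (forall w, F w <= G w) ->
  forall w, step t F w <= step t G w.
Proof.
move=> nF nG FG w; apply: ge0_le_integral => //; try exact: nnm_upd.
by move=> z _; case: nF.
Qed.

Lemma steps_mono s n F G : nnm F -> nnm G -> (forall w, F w <= G w) ->
  forall w, steps s n F w <= steps s n G w.
Proof.
move=> nF nG FG; elim: n s => //= n IH s; apply: step_mono; try exact: nnm_steps.
exact: IH.
Qed.

Lemma stepsU s n F G : nnm F -> nnm G ->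
  steps s n (F \+ G) = steps s n F \+ steps s n G.
Proof.
move=> nF nG; elim: n s => //= n IH s; apply/funext => w; rewrite IH.
have nF' := nnm_steps s.+1 n nF; have nG' := nnm_steps s.+1 n nG.
rewrite /step /= ge0_integralD//.
- by move=> z _; case: nF'.
- exact: nnm_upd.
- by move=> z _; case: nG'.
- exact: nnm_upd.
Qed.

Definition ind (C : set Omega) (w : Omega) : \bar R := (\1_C w)%:E.

Lemma ind_ge0 C w : 0 <= ind C w.
Proof. by rewrite /ind lee_fin. Qed.

Lemma nnm_ind C : measurable C -> nnm (ind C).
Proof.
by move=> mC; split; [exact: ind_ge0|apply/measurable_EFinP; exact: measurable_indic].
Qed.

Lemma depends_on_ind n (C : set Omega) : depends_on n C <-> depends_on n (ind C).
Proof.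
split=> dC w w' ww.
  by rewrite /ind !indicE; have -> : (w \in C) = (w' \in C) by apply/idP/idP; rewrite !inE (dC _ _ ww).
have CE : (w \in C) = (w' \in C).
  have := dC _ _ ww; rewrite /ind !indicE => -[] /eqP.
  by case: (w \in C); case: (w' \in C) => //; rewrite ?oner_eq0// eq_sym oner_eq0.
by apply/propext; split=> /mem_set; [rewrite CE|rewrite -CE] => /set_mem.
Qed.

Definition cylinder_alg : set (set Omega) :=
  [set C | measurable C /\ exists n, depends_on n C].

Lemma cylinder_alg0 : cylinder_alg set0.
Proof. by split => //; exists 0%N. Qed.

Lemma cylinder_algU : setU_closed cylinder_alg.
Proof.
move=> B C [mB [n dB]] [mC [m dC]]; split; first exact: measurableU.
exists (maxn n m) => w w' ww; rewrite /setU /=; congr (_ \/ _).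
  by apply: dB; apply: agree_le ww; exact: leq_maxl.
by apply: dC; apply: agree_le ww; exact: leq_maxr.
Qed.

Lemma cylinder_algC : setC_closed cylinder_alg.
Proof.
move=> B [mB [n dB]]; split; first exact: measurableC.
by exists n => w w' ww; rewrite /setC /= (dB _ _ ww).
Qed.

Definition cylinder_type : Type := Omega.
HB.instance Definition _ := Pointed.on cylinder_type.
HB.instance Definition _ := @isAlgebraOfSets.Build default_measure_display cylinder_type
  cylinder_alg cylinder_alg0 cylinder_algU cylinder_algC.

Variable w0 : Omega.

(** The probability of a cylinder under the dynamics started at [w0]; the number
    of coordinates chosen here does not matter, by [steps_stable]. *)
Definition cylinder_content (C : set cylinder_type) : \bar R :=
  steps 0 (xget 0%N [set n | depends_on n C]) (ind C) w0.

Lemma cylinder_contentE n C : depends_on n C -> cylinder_content C = steps 0 n (ind C) w0.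
Proof.
move=> dC; rewrite /cylinder_content; have /xgetPex : exists n, [set n | depends_on n C] n by exists n.
move=> /(_ 0%N) /=; set m := xget _ _ => dCm.
have [nm|/ltnW mn] := leqP n m.
  by rewrite (steps_stable nm)//; apply/depends_on_ind.
by rewrite (steps_stable mn)//; apply/depends_on_ind.
Qed.

Lemma cylinder_content_ge0 C : 0 <= cylinder_content C.
Proof. by apply: steps_ge0; exact: ind_ge0. Qed.

Lemma depends_max (B C : set Omega) : cylinder_alg B -> cylinder_alg C ->
  exists n, depends_on n B /\ depends_on n C.
Proof.
move=> [_ [n dB]] [_ [m dC]]; exists (maxn n m); split.
  by apply: depends_on_le dB; exact: leq_maxl.
by apply: depends_on_le dC; exact: leq_maxr.
Qed.

Lemma cylinder_content_additive2 : additive2 cylinder_content.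
Proof.
move=> B C mB mC BC0; have [n [dB dC]] := depends_max mB mC.
have dBC : depends_on n (B `|` C : set Omega).
  by move=> w w' ww; rewrite /setU /= (dB _ _ ww) (dC _ _ ww).
rewrite (cylinder_contentE dBC) (cylinder_contentE dB) (cylinder_contentE dC).
rewrite (_ : ind _ = ind B \+ ind C).
  by rewrite stepsU//; apply: nnm_ind; [case: mB|case: mC].
apply/funext => w; rewrite /ind /= !indicE -EFinD -natrD in_setU.
case: (boolP (w \in B)) => //; case: (boolP (w \in C)) => //; rewrite !inE => Cw Bw.
by have : (B `&` C) w by []; rewrite BC0.
Qed.

Lemma cylinder_content0 : cylinder_content set0 = 0.
Proof.
rewrite (@cylinder_contentE 0%N)//= /ind indic0//.
Qed.

Lemma cylinder_content_semi_additive : measure_function.semi_additive cylinder_content.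
Proof. by apply/additive2P; [exact: cylinder_content0|exact: cylinder_content_additive2]. Qed.

HB.instance Definition _ := @isContent.Build default_measure_display cylinder_type R cylinder_content
  cylinder_content_ge0 cylinder_content_semi_additive.

(** Decreasing cylinders with contents bounded away from zero have a common
    point, which is built one coordinate at a time. *)
Lemma cylinder_content_continuity (C : nat -> set Omega) (e : R) : (0 < e)%R ->
  (forall n, cylinder_alg (C n)) -> (forall n, C n.+1 `<=` C n) ->
  (forall n, e%:E <= cylinder_content (C n)) -> exists w, forall n, C n w.
Proof.
move=> e0 aC dec eC.
have /choice[L HL] : forall n, exists L, depends_on L (C n) by move=> n; case: (aC n).
have nC n : nnm (ind (C n)) by apply: nnm_ind; case: (aC n).
pose h s n := steps s (L n) (ind (C n)).
have dC s n : depends_on (s + L n) (ind (C n)).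
  by apply: depends_on_le (leq_addl _ _) _; apply/depends_on_ind.
have hS s n : h s n = step s (h s.+1 n).
  rewrite /h -(steps_stable (n := L n) (m := (L n).+1))//.
have nh s n : nnm (h s n) by exact: nnm_steps.
have hdec s n w : h s n.+1 w <= h s n w.
  rewrite /h -(@steps_stable s (L n.+1) (maxn (L n) (L n.+1)))//; last exact: leq_maxr.
  rewrite -(@steps_stable s (L n) (maxn (L n) (L n.+1)))//; last exact: leq_maxl.
  apply: steps_mono => // w'; rewrite /ind lee_fin !indicE ler_nat.
  by case: (boolP (w' \in C n.+1)) => //; rewrite inE => /dec Cw'; rewrite mem_set.
have h1 s n w : h s n w <= 1.
  have <- : steps s (L n) (cst 1) w = 1 by rewrite steps_id.
  apply: steps_mono => // w'.
  by rewrite /ind lee_fin indicE; case: (_ \in _).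
pose good s w := exists2 e : R, (0 < e)%R & forall n, e%:E <= h s n w.
have next s w : exists z, good s w -> good s.+1 (upd s w z).
  apply: contrapT => /forallNP nz.
  have gw : good s w by have /not_implyP[] := nz point.
  have {}nz z : ~ good s.+1 (upd s w z) by have /not_implyP[] := nz z.
  have h0 z : h s.+1 n (upd s w z) @[n --> \oo] --> 0.
    rewrite (_ : 0 = ereal_inf (range (fun n => h s.+1 n (upd s w z)))).
      by apply: ereal_nonincreasing_cvgn; apply/nonincreasing_seqP => n; exact: hdec.
    apply/eqP; rewrite eq_le; apply/andP; split.
      by apply: le_ereal_inf_tmp => _ [n _ <-]; case: (nh s.+1 n).
    apply/lee_addgt0Pr => e1 e10; rewrite add0e; apply: contrapT => /negP; rewrite -ltNge => lt.
    apply: (nz z); exists e1 => // n; apply/ltW/(lt_le_trans lt).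
    by apply: ereal_inf_lbound; exists n.
  case: gw => e1 e10 He1.
  have [||||| _ _ cv] := @dominated_convergence _ _ _ (kappa s w) setT measurableT
     (fun n z => h s.+1 n (upd s w z)) (cst 0) (cst 1).
  - by move=> n; exact: nnm_upd.
  - exact: measurable_cst.
  - by apply: aeW => z _; exact: h0.
  - apply/integrableP; split; first exact: measurable_cst.
    rewrite (eq_integral (cst 1)); last by move=> z _ /=; rewrite normr1.
    by rewrite integral_cst// mul1e prob_kernel ltry.
  - by apply: aeW => z n _; rewrite gee0_abs ?h1//; case: (nh s.+1 n).
  move: cv; rewrite integral0 => cv.
  have : e1%:E <= 0.
    rewrite -(cvg_lim _ cv)//; apply: lime_ge; first by apply/cvg_ex; exists 0.
    by apply: nearW => n; have := He1 n; rewrite hS.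
  by rewrite lee_fin leNgt e10.
have /choice[f Hf] : forall p : nat * Omega, exists z, good p.1 p.2 -> good p.1.+1 (upd p.1 p.2 z).
  by move=> [s w]; exact: next.
pose W := fix W s := if s is s'.+1 then upd s' (W s') (f (s', W s')) else w0.
have gW s : good s (W s).
  elim: s => [|s IH]; last exact: (Hf (s, W s)).
  by exists e => // n; rewrite /h -(cylinder_contentE (HL n)).
have WS s k : agree s (W s) (W (s + k)%N).
  elim: k => [|k IH]; first by rewrite addn0.
  rewrite addnS => i si; rewrite IH//=; apply: (agree_upd _ (t := s + k)%N).
  exact: leq_trans si (leq_addr _ _).
pose w : Omega := fun i => W i.+1 i.
have ww s : agree s (W s) w.
  by move=> i si; rewrite /w -(subnKC si) -WS.
exists w => n; have [e1 e10 /(_ n)] := gW (L n).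
rewrite /h steps_id; last by apply/depends_on_ind.
rewrite -(HL n _ _ (ww _)) /ind indicE; case: (boolP (_ \in _)); first by rewrite inE.
by rewrite lee_fin leNgt e10.
Qed.

Lemma cylinder_content_le_add (A B C : set Omega) : cylinder_alg A -> cylinder_alg B -> cylinder_alg C ->
  A `<=` B `|` C -> cylinder_content A <= cylinder_content B + cylinder_content C.
Proof.
move=> aA aB aC ABC; have [n [dA dBC]] := depends_max aA (cylinder_algU aB aC).
have [m [dB dC]] := depends_max aB aC.
have dA' : depends_on (maxn n m) A by apply: depends_on_le dA; exact: leq_maxl.
have dB' : depends_on (maxn n m) B by apply: depends_on_le dB; exact: leq_maxr.
have dC' : depends_on (maxn n m) C by apply: depends_on_le dC; exact: leq_maxr.
have nA : nnm (ind A) by apply: nnm_ind; case: aA.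
have nB : nnm (ind B) by apply: nnm_ind; case: aB.
have nC : nnm (ind C) by apply: nnm_ind; case: aC.
rewrite (cylinder_contentE dA') (cylinder_contentE dB') (cylinder_contentE dC').
have -> : steps 0 (maxn n m) (ind B) w0 + steps 0 (maxn n m) (ind C) w0 =
    steps 0 (maxn n m) (ind B \+ ind C) w0 by rewrite stepsU.
apply: steps_mono => //.
  split; first by move=> w; rewrite adde_ge0// ind_ge0.
  by apply: emeasurable_funD; [case: nB|case: nC].
move=> w; rewrite /ind /= -EFinD lee_fin !indicE -natrD ler_nat.
case: (boolP (w \in A)) => //; rewrite inE => /ABC[] h; rewrite (mem_set h)//.
by rewrite addn1.
Qed.

(** If the contents of countably many cylinders covering [A] add up to less than
    that of [A], then the uncovered parts of [A] decrease with contents bounded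
    away from zero, and have a common point. *)
Lemma cylinder_content_sigma_subadditive : measurable_subset_sigma_subadditive cylinder_content.
Proof.
move=> A F mF mA AF; rewrite leNgt; apply/negP => lt.
pose C n := A `\` \big[setU/set0]_(i < n) F i.
have aF n : cylinder_alg (\big[setU/set0]_(i < n) F i).
  elim: n => [|n IH]; rewrite ?big_ord0 ?big_ord_recr /=; first exact: cylinder_alg0.
  exact: cylinder_algU (mF n).
have aC n : cylinder_alg (C n).
  rewrite /C setDE -(setCK (A `&` _)) setCI setCK.
  by apply: cylinder_algC; apply: cylinder_algU => //; exact: cylinder_algC.
have ctnC n : cylinder_content A <= cylinder_content (C n) + \sum_(i < n) cylinder_content (F i).
  elim: n => [|n IH]; first by rewrite /C !big_ord0 setD0 adde0.
  apply: (le_trans IH); rewrite big_ord_recr /= addeA [leRHS]addeAC.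
  apply: leeD => //; apply: cylinder_content_le_add => //; first exact: mF.
  by move=> w [Aw nw]; have [Fw|nFw] := pselect (F n w); [right|left; split => //; rewrite big_ord_recr /= => -[]].
set S := \sum_(n <oo) cylinder_content (F n) in lt *.
have S0 : 0 <= S by apply: nneseries_ge0 => n _ _; exact: cylinder_content_ge0.
have ctn1 B : cylinder_alg B -> cylinder_content B <= 1.
  move=> aB; have [n [dB _]] := depends_max aB aB; rewrite (cylinder_contentE dB).
  have <- : steps 0 n (cst 1) w0 = 1 by rewrite steps_id.
  apply: steps_mono => //; first by apply: nnm_ind; case: aB.
  by move=> w'; rewrite /ind lee_fin indicE; case: (_ \in _).
have finA : cylinder_content A \is a fin_num.
  by rewrite ge0_fin_numE; [rewrite (le_lt_trans (ctn1 _ mA))// ltry|exact: cylinder_content_ge0].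
have finS : S \is a fin_num by rewrite ge0_fin_numE// (lt_trans lt)// (le_lt_trans (ctn1 _ mA))// ltry.
have [|//|n B|n|w Cw] := @cylinder_content_continuity C (fine (cylinder_content A) - fine S)%R.
- by rewrite subr_gt0 -lte_fin !fineK.
- by move: B; apply: setDS; rewrite big_ord_recr /=; left.
- rewrite EFinB !fineK// leeBlDr//; apply: (le_trans (ctnC n)); rewrite leeD2l//.
  rewrite -(big_mkord xpredT (cylinder_content \o F)) /=.
  by apply: nneseries_lim_ge => i *; exact: cylinder_content_ge0.
have [n _ Fn] := AF w (Cw 0%N).1.
by have [_] := Cw n.+1; apply; rewrite big_ord_recr /=; right.
Qed.

HB.instance Definition _ := @Content_SigmaSubAdditive_isMeasure.Build
  default_measure_display R cylinder_type cylinder_content cylinder_content_sigma_subadditive.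

Definition tulcea (C : set Omega) : \bar R := measure_extension cylinder_content C.

Lemma measurable_tulcea_domain (C : set Omega) : measurable C ->
  (<<s (@measurable _ cylinder_type) >>) C.
Proof.
apply: smallest_sub; first exact: smallest_sigma_algebra.
move=> _ [t _ [B mB <-]]; apply: sub_sigma_algebra; split.
  by rewrite setTI -[X in measurable X]setTI; exact: measurable_coord.
by exists t.+1 => w w' ww; rewrite setTI /preimage /= ww.
Qed.

Let tulcea0 : tulcea set0 = 0. Proof. exact: measure0. Qed.
Let tulcea_ge0 C : 0 <= tulcea C. Proof. exact: measure_ge0. Qed.
Let tulcea_sigma_additive : semi_sigma_additive tulcea.
Proof.
move=> F mF tF mUF; apply: measure_semi_sigma_additive => //.
  by move=> i; exact: measurable_tulcea_domain.
exact: measurable_tulcea_domain.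
Qed.

HB.instance Definition _ := isMeasure.Build _ _ _ tulcea
  tulcea0 tulcea_ge0 tulcea_sigma_additive.

Lemma tulceaE n C : measurable C -> depends_on n C -> tulcea C = steps 0 n (ind C) w0.
Proof.
move=> mC dC; rewrite /tulcea /measure_extension measurable_mu_extE; first exact: cylinder_contentE.
by split => //; exists n.
Qed.

Let tulcea_setT : tulcea setT = 1.
Proof.
rewrite (@tulceaE 0%N)//= /ind indicT//.
Qed.

HB.instance Definition _ := Measure_isProbability.Build _ _ _ tulcea tulcea_setT.

(** Functions of the first [t] coordinates factor through [trunc t], which allows
    a comparison of their integrals by pushforward. *)
Definition trunc t (w : Omega) : Omega := fun i => if (i < t)%N then w i else w0 i.

Lemma measurable_trunc t : measurable_fun setT (trunc t).
Proof.
apply: measurable_fun_trajectory => i; rewrite /trunc; case: (i < t)%N.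
  exact: measurable_coord.
exact: measurable_cst.
Qed.

Lemma agree_trunc t w : agree t w (trunc t w).
Proof. by move=> i it; rewrite /trunc it. Qed.

Lemma trunc_agree t w w' : agree t w w' -> trunc t w = trunc t w'.
Proof. by move=> ww; apply/funext => i; rewrite /trunc; case: ifP => // /ww. Qed.

Lemma eq_integral_depends_on t (mu nu : {measure set Omega -> \bar R}) F :
  (forall C, measurable C -> depends_on t C -> mu C = nu C) ->
  nnm F -> depends_on t F -> \int[mu]_w F w = \int[nu]_w F w.
Proof.
move=> munu [F0 mF] dF; have mt := @measurable_trunc t.
have Etr (m : {measure set Omega -> \bar R}) : \int[m]_w F w = \int[m]_w (F \o trunc t) w.
  by apply: eq_integral => w _ /=; apply: dF; exact: agree_trunc.
have F0' : {in setT, forall w, 0 <= F w} by move=> w _.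
rewrite (Etr mu) (Etr nu).
have /= <- := ge0_integral_pushforward mt mu measurableT mF F0'.
have /= <- := ge0_integral_pushforward mt nu measurableT mF F0'.
apply: eq_measure_integral => /= C mC _; apply: munu.
  by rewrite -[X in measurable X]setTI; exact: mt.
by move=> w w' ww; rewrite /preimage /= (trunc_agree ww).
Qed.

(** The measure that draws the first [n] coordinates from [tulcea] and the next
    one from [kappa n] agrees with [tulcea] on the cylinders over [n.+1]
    coordinates, hence integrates the functions of these coordinates alike. *)
Lemma integral_tulcea n F : nnm F -> depends_on n F ->
  \int[tulcea]_w F w = steps 0 n F w0.
Proof.
elim: n F => [|n IH] F nF dF.
  by apply: integral_eq_cst; [exact: tulcea_setT|move=> w; apply: dF => i].
pose l := kprobability (X := Omega) (@measurable_cst _ _ _ _ setT (tulcea : pprobability Omega R)).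
have mu' : measurable_fun setT (fun p : (Omega * Omega) * E => upd n p.1.2 p.2).
  have h : measurable_fun setT (fun p : (Omega * Omega) * E => (p.1.2, p.2)).
    by apply: measurable_fun_pair => //; exact: measurableT_comp.
  exact: (measurableT_comp (@measurable_upd n) h).
pose k := kbind (kpre (kappa n) (@measurable_snd _ _ Omega Omega)) (kdirac mu').
have rhoE G : nnm G -> \int[kbind l k w0]_w G w = \int[tulcea]_w step n G w.
  move=> [G0 mG]; rewrite integral_kbind//; apply: eq_integral => w _.
  rewrite integral_kbind//; apply: eq_integral => z _.
  by rewrite integral_dirac// diracT mul1e.
rewrite (_ : \int[tulcea]_w F w = \int[kbind l k w0]_w F w).
  rewrite rhoE// IH; last exact: depends_on_step.
    by rewrite -addn1 stepsD.
  exact: nnm_step.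
apply: (@eq_integral_depends_on n.+1) => // C mC dC.
have dC' : depends_on n.+1 (ind C) by apply/depends_on_ind.
transitivity (\int[tulcea]_w step n (ind C) w).
  rewrite IH; [|by apply: nnm_step; exact: nnm_ind|exact: depends_on_step].
  transitivity (tulcea C) => //.
  by rewrite (tulceaE mC dC) -addn1 stepsD.
exact: etrans (esym (rhoE _ (nnm_ind mC))) (integral_indicator _ mC).
Qed.

Theorem ionescu_tulcea : exists P : probability Omega R,
  forall t F, nnm F -> depends_on t.+1 F -> \int[P]_w F w = \int[P]_w step t F w.
Proof.
exists tulcea => t F nF dF.
rewrite (integral_tulcea nF dF) -addn1 stepsD (@integral_tulcea t)//.
  exact: nnm_step.
exact: depends_on_step.
Qed.

End ionescu_tulcea.

(** * The trajectory measure of a policy *)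

Section induced.
Context {R : realType} {X A : pmetricType R}.
Local Notation XA := (borelType X * borelType A)%type.
Local Notation Omega := (trajectoryType XA).
Local Notation historyType t := (t.-tuple XA * borelType X)%type.
Variables (q : R.-pker XA ~> borelType X) (pi : policy (X := X) (A := A) (R := R)) (x0 : X).

Lemma measurable_past t : measurable_fun setT (past t : Omega -> t.-tuple XA).
Proof.
apply/measurable_fun_tnthP => i.
rewrite (_ : _ \o _ = fun w : Omega => w i).
  exact: (measurable_coord (T := XA)).
by apply/funext => w /=; rewrite tnth_mktuple.
Qed.

Lemma measurable_state t : measurable_fun setT (fun w : Omega => (w t).1).
Proof. exact: measurableT_comp (measurable_coord (T := XA) t). Qed.

Lemma measurable_action t : measurable_fun setT (fun w : Omega => (w t).2).
Proof. exact: measurableT_comp (measurable_coord (T := XA) t). Qed.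

Lemma measurable_history t : measurable_fun setT (@history R X A t : Omega -> historyType t).
Proof.
apply/measurable_fun_pair; [exact: measurable_past|exact: measurable_state].
Qed.

Lemma past_agree t (w w' : Omega) : agree t w w' -> past t w = past t w'.
Proof. by move=> ww; apply: eq_from_tnth => i; rewrite !tnth_mktuple ww. Qed.

Definition next_state (t : nat) : R.-pker Omega ~> borelType X :=
  if t is t'.+1 then kpre q (measurable_coord (T := XA) t')
  else kdirac (@measurable_cst _ _ Omega (borelType X) setT x0).

Let extend t (p : Omega * borelType X) : historyType t := (past t p.1, p.2).

Let measurable_extend t : measurable_fun setT (extend t).
Proof.
apply/measurable_fun_pair; last exact: measurable_snd.
exact: measurableT_comp (@measurable_past t) _.
Qed.

Let rearrange (p : (Omega * borelType X) * borelType A) : XA := (p.1.2, p.2).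

Let measurable_rearrange : measurable_fun setT rearrange.
Proof.
apply/measurable_fun_pair; last exact: measurable_snd.
exact: measurableT_comp.
Qed.

(** The law of the pair of the state and the action at time [t], given the pairs
    before [t]. *)
Definition transition t : R.-pker Omega ~> XA :=
  kbind (next_state t) (kbind (kpre (pi t) (@measurable_extend t)) (kdirac measurable_rearrange)).

Lemma integral_transition t w (f : XA -> \bar R) : (forall z, 0 <= f z) ->
  measurable_fun setT f ->
  \int[transition t w]_z f z =
  \int[next_state t w]_y \int[pi t (past t w, y)]_a f (y, a).
Proof.
move=> f0 mf; rewrite integral_kbind//; apply: eq_integral => y _.
rewrite integral_kbind//; apply: eq_integral => a _.
by rewrite integral_dirac// diracT mul1e.
Qed.

Lemma transition_local t (w w' : Omega) : agree t w w' ->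
  forall B, measurable B -> transition t w B = transition t w' B.
Proof.
move=> ww B mB.
have E v : transition t v B = \int[next_state t v]_y \int[pi t (past t v, y)]_a (\1_B (y, a))%:E.
  apply: etrans (esym (integral_indicator (transition t v) mB)) _.
  apply: integral_transition; first by move=> z; rewrite lee_fin.
  by apply/measurable_EFinP; exact: measurable_indic.
rewrite !E (past_agree ww); case: t ww {E} => [//|t] ww.
have -> // : next_state t.+1 w = next_state t.+1 w'.
by rewrite /= /kpre ww.
Qed.

Let past_upd t (w : Omega) z : past t (upd t w z) = past t w.
Proof. by apply/esym/past_agree; exact: agree_upd. Qed.

Let upd_eq t (w : Omega) z : upd t w z t = z.
Proof. by rewrite /upd eqxx. Qed.

Lemma step_transition t (F : Omega -> \bar R) w : nnm F ->
  step transition t F w =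
  \int[next_state t w]_y \int[pi t (past t w, y)]_a F (upd t w (y, a)).
Proof.
by move=> nF; apply: integral_transition; [move=> z; case: nF|exact: nnm_upd].
Qed.

Lemma measurable_pred_preimage d (T : measurableType d) (f : Omega -> T) (D : set T) :
  measurable_fun setT f -> measurable D -> measurable [set w | D (f w)].
Proof. by move=> mf mD; rewrite -[X in measurable X]setTI; exact: mf. Qed.

Lemma induced_by_exists : exists P : probability Omega R, induced_by q pi x0 P.
Proof.
have [P HP] := ionescu_tulcea transition_local point.
have PC t C : measurable C -> depends_on t.+1 C ->
    P C = \int[P]_w step transition t (ind C) w.
  move=> mC dC; rewrite -HP; first exact: (esym (integral_indicator _ _)).
    exact: nnm_ind.
  by apply/depends_on_ind.
exists P; split.
- move=> B mB.
  have mC := measurable_pred_preimage (measurable_state 0) mB.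
  rewrite (PC 0%N _ mC); last by move=> w w' ww /=; rewrite (ww 0%N).
  apply: integral_eq_cst => [|w]; first exact: probability_setT.
  rewrite step_transition; last exact: nnm_ind.
  transitivity (\int[(dirac (x0 : borelType X) : {measure set (borelType X) -> \bar R})]_y (\1_B y)%:E); last exact: integral_indicator.
  apply: eq_integral => y _; apply: integral_eq_cst => [|a]; first exact: prob_kernel.
  by rewrite /ind !indicE; congr (_%:R%:E).
- move=> t D B mD mB.
  have mDh := measurable_pred_preimage (@measurable_history t) mD.
  have mBa := measurable_pred_preimage (@measurable_action t) mB.
  have mC : measurable [set w : Omega | D (history t w) /\ B (w t).2] by exact: measurableI.
  have dC : depends_on t.+1 [set w : Omega | D (history t w) /\ B (w t).2].
    move=> w w' ww; rewrite /= /history (ww t)// (@past_agree t w w')//.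
    by apply: agree_le ww.
  have mpi : measurable_fun setT (fun w : Omega => pi t (history t w) B).
    exact: (measurableT_comp (measurable_kernel (pi t) B mB) (@measurable_history t)).
  rewrite integral_mkcond.
  set H := (fun w : Omega => pi t (history t w) B) \_ _.
  have nH : nnm H.
    split; first by move=> w; apply: erestrict_ge0.
    by apply/(measurable_restrictT _ mDh); exact: measurable_funTS.
  have dH : depends_on t.+1 H.
    move=> w w' ww; rewrite /H /patch /history.
    have -> : past t w = past t w' by apply: past_agree; exact: agree_le ww.
    rewrite (ww t)//; congr (if _ then _ else _).
    apply/idP/idP; rewrite !inE /= /history (ww t)//.
      by rewrite (@past_agree t w w')//; exact: agree_le ww.
    by rewrite (@past_agree t w w')//; exact: agree_le ww.
  rewrite (PC t _ mC dC) (HP t H nH dH); apply: eq_integral => w _.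
  rewrite (step_transition _ _ (nnm_ind mC)) (step_transition _ _ nH).
  apply: eq_integral => y _.
  have hE a : history t (upd t w (y, a)) = (past t w, y).
    by rewrite /history past_upd upd_eq.
  have [Dy|nDy] := pselect (D (past t w, y)).
    rewrite [RHS](@integral_eq_cst _ _ _ _ _ (pi t (past t w, y) B)); last 2 first.
    + exact: prob_kernel.
    + by move=> a; rewrite /H /patch mem_set /= hE.
    rewrite -(integral_indicator (pi t (past t w, y)) mB).
    apply: eq_integral => a _; rewrite /ind !indicE; congr ((nat_of_bool _)%:R%:E).
    by apply/idP/idP; rewrite !inE /= hE upd_eq => // -[].
  rewrite !integral0_eq// => a _; first by rewrite /H /patch memNset //= hE.
  by rewrite /ind indicE memNset//= hE => -[].
- move=> t D B mD mB.
  have mDh := measurable_pred_preimage (@measurable_past t.+1) mD.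
  have mBa := measurable_pred_preimage (@measurable_state t.+1) mB.
  have mC : measurable [set w : Omega | D (past t.+1 w) /\ B (w t.+1).1] by exact: measurableI.
  have dC : depends_on t.+2 [set w : Omega | D (past t.+1 w) /\ B (w t.+1).1].
    move=> w w' ww; rewrite /= (ww t.+1)// (@past_agree t.+1 w w')//.
    by apply: agree_le ww.
  rewrite (PC t.+1 _ mC dC) [RHS]integral_mkcond; apply: eq_integral => w _.
  rewrite step_transition; last exact: nnm_ind.
  rewrite /patch; case: ifPn.
    rewrite inE /= => Dw.
    rewrite -(integral_indicator (q (w t)) mB); apply: eq_integral => y _.
    apply: integral_eq_cst => [|a]; first exact: prob_kernel.
    rewrite /ind !indicE; congr ((nat_of_bool _)%:R%:E).
    by apply/idP/idP; rewrite !inE /= past_upd upd_eq => // -[].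
  move=> /negP nD; apply: integral0_eq => y _; apply: integral0_eq => a _.
  rewrite /ind indicE memNset//= past_upd => -[Dw _]; apply: nD; by rewrite inE.
Qed.

Lemma induced_measureP : induced_by q pi x0 (induced_measure q pi x0).
Proof. exact: getPex induced_by_exists. Qed.

End induced.

(** * Expectations along trajectories *)

Section laws.
Context {R : realType} d1 d2 (S : measurableType d1) (T : measurableType d2).

Lemma integral_law (P : {measure set S -> \bar R}) (Y : S -> T)
    (nu : {measure set T -> \bar R}) (g : T -> \bar R) :
  measurable_fun setT Y -> (forall B, measurable B -> P (Y @^-1` B) = nu B) ->
  measurable_fun setT g -> (forall z, 0 <= g z) ->
  \int[P]_w g (Y w) = \int[nu]_z g z.
Proof.
move=> mY PY mg g0.
have g0' : {in setT, forall z, 0 <= g z} by [].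
have /= <- := ge0_integral_pushforward mY P measurableT mg g0'.
by apply: eq_measure_integral => B mB _; exact: PY.
Qed.

Lemma eq_law_integral (P : {measure set S -> \bar R}) (Y Z : S -> T) (g : T -> \bar R) :
  measurable_fun setT Y -> measurable_fun setT Z ->
  (forall B, measurable B -> P (Y @^-1` B) = P (Z @^-1` B)) ->
  measurable_fun setT g -> (forall z, 0 <= g z) ->
  \int[P]_w g (Y w) = \int[P]_w g (Z w).
Proof.
move=> mY mZ PYZ mg g0; have g0' : {in setT, forall z, 0 <= g z} by [].
have /= <- := ge0_integral_pushforward mZ P measurableT mg g0'.
exact: integral_law.
Qed.

End laws.

Lemma integral_sup {R : realType} d (T : measurableType d) (mu : {measure set T -> \bar R})
    (g : nat -> T -> \bar R) :
  (forall n, measurable_fun setT (g n)) -> (forall n x, 0 <= g n x) ->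
  (forall n x, g n x <= g n.+1 x) ->
  \int[mu]_x ereal_sup (range (g ^~ x)) = ereal_sup (range (fun n => \int[mu]_x g n x)).
Proof.
move=> mg g0 gS.
have ndg x : nondecreasing_seq (g ^~ x) by apply/nondecreasing_seqP => n; exact: gS.
rewrite (eq_integral (fun x => limn (g ^~ x))); last first.
  by move=> x _; apply/esym/cvg_lim => //; exact: ereal_nondecreasing_cvgn.
rewrite monotone_convergence//.
apply/cvg_lim => //; apply: ereal_nondecreasing_cvgn.
by apply/nondecreasing_seqP => n; apply: ge0_le_integral.
Qed.

Section expectations.
Context {R : realType} {X A : pmetricType R}.
Local Notation XA := (borelType X * borelType A)%type.
Local Notation Omega := (trajectoryType XA).
Variables (q : R.-pker XA ~> borelType X).
Implicit Types (pi : policy (X := X) (A := A) (R := R)) (x : X).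

Local Notation PP pi x := (induced_measure q pi x).

Lemma expectation_initial pi x (g : borelType X -> \bar R) :
  measurable_fun setT g -> (forall z, 0 <= g z) ->
  \int[PP pi x]_w g (w 0%N).1 = g x.
Proof.
move=> mg g0; have [P0 _ _] := induced_measureP q pi x.
rewrite (integral_law (nu := dirac (x : borelType X)) (measurable_state 0))//.
by rewrite integral_dirac// diracT mul1e.
Qed.

Lemma expectation_next pi x t (g : borelType X -> \bar R) :
  measurable_fun setT g -> (forall z, 0 <= g z) ->
  \int[PP pi x]_w g (w t.+1).1 = \int[PP pi x]_w \int[q (w t)]_y g y.
Proof.
move=> mg g0; have [_ _ Pq] := induced_measureP q pi x.
pose l := kprobability (X := Omega) (@measurable_cst _ _ _ _ setT (PP pi x : pprobability Omega R)).
pose k := kpre q (measurableT_comp (measurable_coord (T := XA) t) (@measurable_snd _ _ Omega Omega)).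
rewrite (integral_law (nu := kbind l k point) (measurable_state t.+1))//.
  by rewrite integral_kbind.
move=> B mB; transitivity (\int[PP pi x]_w q (w t) B); last by [].
have := Pq t setT B measurableT mB.
rewrite (_ : [set w : Omega | [set: t.+1.-tuple XA] (past t.+1 w)] = setT); last by apply/seteqP; split=> w //.
move=> <-; congr (PP pi x _); by apply/seteqP; split => w //= -[].
Qed.

Section deterministic.
Variable phi : X -> A.
Hypothesis mphi : measurable_fun setT (phi : borelType X -> borelType A).

Definition stationary : policy (X := X) (A := A) (R := R) := fun t =>
  kdirac (measurableT_comp mphi (@measurable_snd _ _ (t.-tuple XA) (borelType X))).

(** The laws of the pair at time [t] and of its projection to the graph of [phi]
    agree on measurable rectangles. *)
Lemma expectation_stationary x t (f : XA -> \bar R) :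
  measurable_fun setT f -> (forall z, 0 <= f z) ->
  \int[PP stationary x]_w f (w t) = \int[PP stationary x]_w f ((w t).1, phi (w t).1).
Proof.
move=> mf f0; have [_ Ppi _] := induced_measureP q stationary x.
have mZ : measurable_fun setT (fun w : Omega => ((w t).1, phi (w t).1) : XA).
  apply/measurable_fun_pair; first exact: measurable_state.
  exact: measurableT_comp mphi (measurable_state t).
apply: (eq_law_integral (measurable_coord (T := XA) t) mZ) => // B mB.
pose G := [set C `*` D | C in @measurable _ (borelType X) & D in @measurable _ (borelType A)].
change (giry_map (measurable_coord (T := XA) t) (PP stationary x) B =
        giry_map mZ (PP stationary x) B).
have GB : <<s G >> B by rewrite -measurable_prod_measurableType.
apply: (@g_sigma_algebra_measure_unique _ R XA G _ (fun=> setT)) GB.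
- by move=> _ [C mC [D mD <-]]; exact: measurableX.
- by move=> _; exists setT => //; exists setT => //; rewrite setXTT.
- by rewrite bigcup_const//; exists 0%N.
- move=> _ _ [C mC [D mD <-]] [C' mC' [D' mD' <-]]; rewrite -setXI.
  exists (C `&` C'); first exact: measurableI.
  by exists (D `&` D') => //; exact: measurableI.
- move=> _ [C mC [D mD <-]].
  rewrite /giry_map /= /pushforward.
  have mC' : measurable [set h : t.-tuple XA * borelType X | C h.2].
    by rewrite -[X in measurable X]setTI; exact: measurable_snd.
  transitivity (PP stationary x [set w | [set h : t.-tuple XA * borelType X | C h.2] (history t w) /\ D (w t).2]).
    by congr (PP stationary x _).
  have mD' : measurable [set w : Omega | D (phi (w t).1)].
    exact: (measurable_pred_preimage (measurableT_comp mphi (measurable_state t)) mD).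
  have mCt := measurable_pred_preimage (measurable_state t) mC.
  rewrite Ppi// (eq_integral (fun w : Omega => (\1_[set w : Omega | D (phi (w t).1)] w)%:E)).
    by rewrite integral_indic//; congr (PP stationary x _); apply/seteqP; split => w [].
  by move=> w _; rewrite /stationary /kdirac /dirac !indicE.
- move=> k; change (PP stationary x setT < +oo).
  by apply: (@le_lt_trans _ _ 1); [exact: sprobability_setT|exact: ltry].
Qed.

End deterministic.

Section costs.
Variable c : X * A -> \bar R.
Hypotheses (mc : measurable_fun setT (c : XA -> \bar R)) (c0 : forall z, 0 <= c z).

Definition expected_cost pi x t := \int[PP pi x]_w c (w t).

Let mct t : measurable_fun setT (fun w : Omega => c (w t)).
Proof. exact: measurableT_comp mc (measurable_coord (T := XA) t). Qed.

Lemma expected_cost_ge0 pi x t : 0 <= expected_cost pi x t.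
Proof. by apply: integral_ge0 => w _. Qed.

Lemma v_finiteE N (alpha : R) pi x : (0 <= alpha)%R ->
  v_finite c q N alpha pi x = \sum_(0 <= t < N) (alpha ^+ t)%:E * expected_cost pi x t.
Proof.
move=> a0; rewrite /v_finite ge0_integral_sum//.
- apply: eq_bigr => t _; rewrite ge0_integralZl//.
  by rewrite lee_fin exprn_ge0.
- by move=> t; exact: measurable_funeM.
- by move=> t w _; rewrite mule_ge0// lee_fin exprn_ge0.
Qed.

Lemma v_disc_policyE (alpha : R) pi x : (0 <= alpha)%R ->
  v_disc_policy c q alpha pi x = \sum_(0 <= t <oo) (alpha ^+ t)%:E * expected_cost pi x t.
Proof.
move=> a0; rewrite /v_disc_policy integral_nneseries//.
- apply: eq_eseriesr => t _; rewrite ge0_integralZl//.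
  by rewrite lee_fin exprn_ge0.
- by move=> t; exact: measurable_funeM.
- by move=> t w _; rewrite mule_ge0// lee_fin exprn_ge0.
Qed.

Definition bellman (beta : R) (g : X -> \bar R) (x : X) (a : A) : \bar R :=
  c (x, a) + beta%:E * \int[q (x, a)]_y g y.

Definition nnmX (g : X -> \bar R) :=
  (forall x, 0 <= g x) /\ measurable_fun setT (g : borelType X -> \bar R).

Lemma measurable_kernel_integral g : nnmX g ->
  measurable_fun setT (fun z : XA => \int[q z]_y g y).
Proof.
move=> [g0 mg].
apply: (measurable_fun_integral_sfinite_kernel (fun p : XA * borelType X => g p.2)) => //.
exact: measurableT_comp mg (@measurable_snd _ _ _ _).
Qed.

Lemma kernel_integral_ge0 (g : X -> \bar R) z : (forall x, 0 <= g x) -> 0 <= \int[q z]_y g y.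
Proof. by move=> g0; apply: integral_ge0. Qed.

Lemma measurable_bellman beta g : nnmX g ->
  measurable_fun setT (fun z : XA => bellman beta g z.1 z.2).
Proof.
move=> ng; rewrite (_ : (fun z => _) = (fun z : XA => c z + beta%:E * \int[q z]_y g y)).
  by apply: emeasurable_funD => //; apply: measurable_funeM; exact: measurable_kernel_integral.
by apply/funext => -[].
Qed.

Lemma bellman_ge0 beta g x a : (0 <= beta)%R -> (forall x, 0 <= g x) -> 0 <= bellman beta g x a.
Proof.
by move=> b0 g0; apply: adde_ge0 => //; rewrite mule_ge0//; exact: kernel_integral_ge0.
Qed.

Lemma expected_bellman pi x t beta g : (0 <= beta)%R -> nnmX g ->
  \int[PP pi x]_w bellman beta g (w t).1 (w t).2 =
  expected_cost pi x t + beta%:E * \int[PP pi x]_w g (w t.+1).1.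
Proof.
move=> b0 ng; have [g0 mg] := ng.
rewrite (expectation_next pi x t mg g0).
have mI : measurable_fun setT (fun w : Omega => \int[q (w t)]_y g y).
  exact: measurableT_comp (measurable_kernel_integral ng) (measurable_coord (T := XA) t).
rewrite -ge0_integralZl//; last by move=> w _; exact: kernel_integral_ge0.
have h0 (w : Omega) : setT w -> 0 <= beta%:E * \int[q (w t)]_y g y.
  by move=> _; rewrite mule_ge0//; exact: kernel_integral_ge0.
have hm := measurable_funeM beta%:E mI.
have /= <- := ge0_integralD (PP pi x) measurableT (fun w _ => c0 (w t)) (mct t) h0 hm.
by apply: eq_integral => w _; rewrite /bellman; case: (w t).
Qed.

Let mstate t g : nnmX g -> measurable_fun setT (fun w : Omega => g (w t).1).
Proof. by move=> [_ mg]; exact: measurableT_comp mg (measurable_state t). Qed.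

Let mbell t beta g : nnmX g -> measurable_fun setT (fun w : Omega => bellman beta g (w t).1 (w t).2).
Proof.
by move=> ng; exact: measurableT_comp (measurable_bellman beta ng) (measurable_coord (T := XA) t).
Qed.

(** Iterating the inequality along a trajectory bounds the cost of [k] steps from
    below, whatever the policy is. *)
Lemma value_iteration_lower (V : nat -> X -> \bar R) (alpha : R) pi x k : (0 <= alpha)%R ->
  (forall k, nnmX (V k)) -> (forall x, V 0%N x = 0) ->
  (forall k x a, V k.+1 x <= bellman alpha (V k) x a) ->
  V k x <= \sum_(0 <= t < k) (alpha ^+ t)%:E * expected_cost pi x t.
Proof.
move=> a0 nV V0 VS.
suff H t : \int[PP pi x]_w V k (w t).1 <= \sum_(0 <= j < k) (alpha ^+ j)%:E * expected_cost pi x (t + j)%N.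
  by have := H 0%N; rewrite expectation_initial//; [case: (nV k)|case: (nV k)].
elim: k t => [|k IH] t.
  by rewrite big_geq// integral0_eq// => w _; exact: V0.
have [Vk0 _] := nV k.
apply: (@le_trans _ _ (\int[PP pi x]_w bellman alpha (V k) (w t).1 (w t).2)).
  apply: ge0_le_integral => //.
  - by move=> w _; case: (nV k.+1).
  - exact: mstate.
  - exact: mbell.
rewrite expected_bellman// big_nat_recl//= expr0 mul1e addn0; apply: leeD => //.
apply: (@le_trans _ _ (alpha%:E * \sum_(0 <= j < k) (alpha ^+ j)%:E * expected_cost pi x (t.+1 + j)%N)).
  by apply: lee_wpmul2l.
rewrite ge0_sume_distrr.
  by apply: lee_sum => j _; rewrite muleA -EFinM -exprS addSnnS.
by move=> j _; rewrite mule_ge0// ?lee_fin ?exprn_ge0// expected_cost_ge0.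
Qed.

(** The same iteration along the policy that uses [phi], with the opposite
    inequality; the terminal value [g] is nonnegative and is dropped. *)
Lemma stationary_upper phi (mphi : measurable_fun setT (phi : borelType X -> borelType A))
    (beta : R) (g : X -> \bar R) (r : \bar R) x N : (0 <= beta)%R -> 0 <= r -> nnmX g ->
  (forall x, bellman beta g x (phi x) <= r + g x) ->
  \sum_(0 <= t < N) (beta ^+ t)%:E * expected_cost (stationary mphi) x t <=
    g x + \sum_(0 <= t < N) (beta ^+ t)%:E * r.
Proof.
move=> b0 r0 ng Hphi; have [g0 mg] := ng.
set pi := stationary mphi.
pose G t := \int[PP pi x]_w g (w t).1.
have G0 t : 0 <= G t by apply: integral_ge0 => w _.
have GS t : expected_cost pi x t + beta%:E * G t.+1 <= r + G t.
  rewrite -expected_bellman//.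
  rewrite (expectation_stationary mphi x t (f := fun z => bellman beta g z.1 z.2)); last 2 first.
  - exact: measurable_bellman.
  - by move=> z; exact: bellman_ge0.
  rewrite -[r](integral_eq_cst (mu := PP pi x) (f := cst r))//; last exact: probability_setT.
  rewrite -ge0_integralD//; last exact: mstate.
  apply: ge0_le_integral => //.
  - by move=> w _; exact: bellman_ge0.
  - have mZ : measurable_fun setT (fun w : Omega => ((w t).1, phi (w t).1) : XA).
      apply/measurable_fun_pair; first exact: measurable_state.
      exact: measurableT_comp mphi (measurable_state t).
    exact: measurableT_comp (measurable_bellman beta ng) mZ.
  - by apply: emeasurable_funD => //; exact: mstate.
suff H : \sum_(0 <= t < N) (beta ^+ t)%:E * expected_cost pi x t + (beta ^+ N)%:E * G N
    <= g x + \sum_(0 <= t < N) (beta ^+ t)%:E * r.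
  by apply: le_trans H; rewrite leeDl// mule_ge0// lee_fin exprn_ge0.
elim: N => [|N IH].
  by rewrite !big_geq// add0e adde0 expr0 mul1e /G expectation_initial.
rewrite !big_nat_recr//= exprSr EFinM -!addeA -muleA -ge0_muleDr//; last 2 first.
- exact: expected_cost_ge0.
- by rewrite mule_ge0.
rewrite addeA.
apply: (@le_trans _ _ (\sum_(0 <= t < N) (beta ^+ t)%:E * expected_cost pi x t +
   (beta ^+ N)%:E * (r + G N))).
  by rewrite leeD2l// lee_wpmul2l// lee_fin exprn_ge0.
by rewrite ge0_muleDr// addeCA [leRHS]addeC leeD2l.
Qed.

End costs.
End expectations.

(** * The discounted optimality equation *)

Section dynamic_programming.
Context {R : realType} {X A : pmetricType R}.
Hypotheses (hX : borel_subset_of_polish X) (hA : borel_subset_of_polish A).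
Local Notation XA := (borelType X * borelType A)%type.
Variables (q : R.-pker XA ~> borelType X) (c : X * A -> \bar R).
Hypotheses (mc : measurable_fun setT (c : XA -> \bar R)) (c0 : forall z, 0 <= c z).

Local Notation bell := (bellman q c).

Definition bellman_op (beta : R) (g : X -> \bar R) (x : X) : \bar R :=
  ereal_inf (range (bell beta g x)).

(** What dynamic programming needs from a class of value functions. The two
    continuity assumptions on the model lead to two different classes, the
    measurable functions and the lower semicontinuous ones, and every later
    argument is carried out once, for an arbitrary class with these closure
    properties. *)
Record stable_class (good : (X -> \bar R) -> Prop) : Prop := StableClass {
  stable_nnm : forall g, good g -> nnmX g;
  stable_inf_compact : forall beta g x, (0 <= beta)%R -> good g -> inf_compact (bell beta g x);
  stable_sup : forall g : nat -> X -> \bar R, (forall n, good (g n)) ->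
    (forall n x, g n x <= g n.+1 x) -> good (fun x => ereal_sup (range (g ^~ x)));
  stable_op : forall beta g, (0 <= beta)%R -> good g -> good (bellman_op beta g);
  stable_zero : good (cst 0) }.

Lemma bellman_mono beta beta' g h x a : (0 <= beta)%R -> (beta <= beta')%R ->
  nnmX g -> nnmX h -> (forall y, g y <= h y) -> bell beta g x a <= bell beta' h x a.
Proof.
move=> b0 bb [g0 mg] [h0 mh] gh; rewrite /bellman leeD2l//.
apply: (@le_trans _ _ (beta%:E * \int[q (x, a)]_y h y)).
  by apply: lee_wpmul2l => //; apply: ge0_le_integral.
by apply: lee_wpmul2r; [exact: kernel_integral_ge0|rewrite lee_fin].
Qed.

Lemma bellman_op_le beta g x a : bellman_op beta g x <= bell beta g x a.
Proof. by apply: ereal_inf_lbound; exists a. Qed.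

Lemma adde_mule_sup (r : \bar R) (s : nat -> \bar R) (l : \bar R) (beta : R) :
  0 <= r -> (forall n, 0 <= s n) -> (0 < beta)%R ->
  (forall n, r + beta%:E * s n <= l) -> r + beta%:E * ereal_sup (range s) <= l.
Proof.
move=> r0 s0 b0 H; have s0r n : 0 <= beta%:E * s n by rewrite mule_ge0// lee_fin ltW.
case: l H => [l| |] H; last 2 first.
- by rewrite leey.
- have := H 0%N; rewrite leeNy_eq => /eqP E.
  by have := adde_ge0 r0 (s0r 0%N); rewrite E.
have rfin : r \is a fin_num.
  by rewrite ge0_fin_numE// (@le_lt_trans _ _ l%:E) ?ltry// (le_trans _ (H 0%N))// leeDl.
rewrite -leeBrDl// muleC -lee_pdivlMr//; apply: ge_ereal_sup => _ [n _ <-].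
by rewrite lee_pdivlMr// muleC leeBrDl.
Qed.

Lemma bellman_sup (g : nat -> X -> \bar R) (beta : R) x a l :
  (0 <= beta)%R -> (forall n, nnmX (g n)) -> (forall n y, g n y <= g n.+1 y) ->
  (forall n, bell beta (g n) x a <= l) ->
  bell beta (fun y => ereal_sup (range (g ^~ y))) x a <= l.
Proof.
move=> b0 ng gS H; rewrite /bellman integral_sup//; last 2 first.
- by move=> n; case: (ng n).
- by move=> n; case: (ng n).
have I0 n : 0 <= \int[q (x, a)]_y g n y by apply: kernel_integral_ge0; case: (ng n).
move: b0; rewrite le_eqVlt => /orP[/eqP b0|b0].
  by rewrite -b0 mul0e adde0; have := H 0%N; rewrite /bellman -b0 mul0e adde0.
exact: adde_mule_sup.
Qed.

Variable good : (X -> \bar R) -> Prop.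
Hypothesis sg : stable_class good.

Fixpoint value_iteration (alpha : R) k : X -> \bar R :=
  if k is k'.+1 then bellman_op alpha (value_iteration alpha k') else cst 0.

Section discounted.
Variable alpha : R.
Hypothesis a0 : (0 <= alpha)%R.

Local Notation V := (value_iteration alpha).
Definition value_limit x : \bar R := ereal_sup (range (V ^~ x)).

Lemma value_iteration_good k : good (V k).
Proof.
by elim: k => [|k IH]; [exact: (stable_zero sg)|exact: (stable_op sg)].
Qed.

Lemma value_iteration_nnm k : nnmX (V k).
Proof. exact: stable_nnm sg _ (value_iteration_good k). Qed.

Lemma value_iteration_mono k x : V k x <= V k.+1 x.
Proof.
elim: k x => [|k IH] x.
  by rewrite /=; apply: le_ereal_inf_tmp => _ [a _ <-]; exact: bellman_ge0.
apply: le_ereal_inf_tmp => _ [a _ <-]; apply: le_trans (bellman_op_le _ _ _ a) _.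
by apply: bellman_mono => //; [exact: (value_iteration_nnm k)|exact: (value_iteration_nnm k.+1)].
Qed.

Lemma good_value_limit : good value_limit.
Proof. by apply: (stable_sup sg); [exact: value_iteration_good|exact: value_iteration_mono]. Qed.

Lemma value_iteration_le_limit k x : V k x <= value_limit x.
Proof. by apply: ereal_sup_ubound; exists k. Qed.

Lemma value_limit_le x a : value_limit x <= bell alpha value_limit x a.
Proof.
apply: ge_ereal_sup => _ [k _ <-]; apply: le_trans (value_iteration_mono k x) _.
apply: le_trans (bellman_op_le _ _ _ a) _; apply: bellman_mono => //.
- exact: value_iteration_nnm.
- exact: stable_nnm sg _ good_value_limit.
- by move=> y; exact: value_iteration_le_limit.
Qed.

(** The minimum over the actions commutes with the increasing limit of the value
    iterates, by compactness. *)
Lemma value_limit_attained x : exists a, bell alpha value_limit x a <= value_limit x.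
Proof.
have nV := stable_nnm sg good_value_limit.
have [Voo|] := eqVneq (value_limit x) +oo; first by exists point; rewrite Voo leey.
move=> Vnoo; have Vfin : value_limit x \is a fin_num.
  by rewrite ge0_fin_numE ?ltey//; case: nV.
have [k|n m a nm|n e e0|a Ha] := @inf_compact_interchange R A
    (fun k => bell alpha (V k) x) (fine (value_limit x)).
- exact: (stable_inf_compact sg a0 (value_iteration_good k)).
- elim: m nm => [|m IH]; first by rewrite leqn0 => /eqP ->.
  rewrite leq_eqVlt => /orP[/eqP ->//|]; rewrite ltnS => /IH /le_trans; apply.
  by apply: bellman_mono => //; [exact: value_iteration_nnm|exact: value_iteration_nnm|move=> y; exact: value_iteration_mono].
- have : V n.+1 x < (fine (value_limit x) + e)%:E.
    by rewrite EFinD fineK// (le_lt_trans (value_iteration_le_limit n.+1 x))// lteDl// lte_fin.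
  by move=> /ereal_inf_lt[_ [a _ <-]] /ltW; exists a.
exists a; apply: bellman_sup => //; [exact: value_iteration_nnm|exact: value_iteration_mono|].
by move=> n; have := Ha n; rewrite fineK.
Qed.

Lemma bellman_minimizer beta g : (0 <= beta)%R -> good g ->
  exists phi : X -> A, measurable_fun setT (phi : borelType X -> borelType A) /\
    forall x a, bell beta g x (phi x) <= bell beta g x a.
Proof.
move=> b0 gg; have [g0 mg] := stable_nnm sg gg.
apply: (measurable_minimizer hX hA (f := fun z => bell beta g z.1 z.2)).
- exact: measurable_bellman.
- by move=> z; exact: bellman_ge0.
- by move=> x; exact: (stable_inf_compact sg b0 gg).
Qed.

(** The [k]-th iterate is a lower bound for the cost of [k] steps under any
    policy, and a stationary policy that minimizes the right-hand side for the
    limit does not cost more than the limit. *)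
Lemma v_disc_value_limit : v_disc c q alpha = value_limit.
Proof.
apply/funext => x; apply/eqP; rewrite eq_le; apply/andP; split; last first.
  apply: le_ereal_inf_tmp => _ [pi _ <-]; rewrite v_disc_policyE//.
  apply: ge_ereal_sup => _ [k _ <-].
  apply: (@le_trans _ _ (\sum_(0 <= t < k) (alpha ^+ t)%:E * expected_cost q c pi x t)).
    apply: value_iteration_lower => //; first exact: value_iteration_nnm.
    by move=> k' y a; exact: bellman_op_le.
  apply: nneseries_lim_ge => t *.
  by rewrite mule_ge0// ?lee_fin ?exprn_ge0// expected_cost_ge0.
have [phi [mphi Hphi]] := bellman_minimizer a0 good_value_limit.
apply: (@le_trans _ _ (v_disc_policy c q alpha (stationary mphi) x)).
  by apply: ereal_inf_lbound; exists (stationary mphi).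
rewrite v_disc_policyE//; apply: lime_le.
  apply: is_cvg_nneseries => t *.
  by rewrite mule_ge0// ?lee_fin ?exprn_ge0// expected_cost_ge0.
apply: nearW => N.
have nV := stable_nnm sg good_value_limit.
apply: le_trans (stationary_upper mc c0 mphi (r := 0) x N a0 (lexx 0) nV _) _.
  move=> y; rewrite add0e; have [a Ha] := value_limit_attained y.
  exact: le_trans (Hphi y a) Ha.
by rewrite big1 ?adde0// => t _; rewrite mule0.
Qed.

End discounted.

Theorem discounted_optimality (alpha : R) : (0 <= alpha)%R ->
  [/\ good (v_disc c q alpha),
      forall x a, v_disc c q alpha x <= bell alpha (v_disc c q alpha) x a &
      forall x, exists a, bell alpha (v_disc c q alpha) x a <= v_disc c q alpha x].
Proof.
move=> a0; rewrite v_disc_value_limit//; split.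
- exact: good_value_limit.
- by move=> x a; exact: value_limit_le.
- by move=> x; exact: value_limit_attained.
Qed.

End dynamic_programming.

(** * Lower semicontinuity *)

Section lower_semicontinuity.
Context {R : realType}.

Lemma lte_real_between (r : R) (y : \bar R) : r%:E < y -> exists2 s : R, (r < s)%R & s%:E < y.
Proof.
case: y => [y| |//]; last by move=> _; exists (r + 1)%R; rewrite ?ltry// ltrDl.
by rewrite lte_fin => ry; exists ((r + y) / 2)%R; rewrite ?lte_fin; lra.
Qed.

Context {T : topologicalType}.
Implicit Types f g : T -> \bar R.

Lemma lsc_closed f (r : R) : lower_semicontinuous f -> closed [set x | f x <= r%:E].
Proof.
move=> /lower_semicontinuousP/(_ r) o.
rewrite (_ : [set _ | _] = ~` [set x | f x > r%:E]); first exact: open_closedC.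
by apply/seteqP; split=> x /=; rewrite leNgt => /negP.
Qed.

Lemma closed_lsc f : (forall r : R, closed [set x | f x <= r%:E]) -> lower_semicontinuous f.
Proof.
move=> cf; apply/lower_semicontinuousP => r.
rewrite (_ : [set _ | _] = ~` [set x | f x <= r%:E]); first exact: closed_openC.
by apply/seteqP; split=> x /=; rewrite ltNge => /negP.
Qed.

Lemma lsc_sup (f : nat -> T -> \bar R) : (forall n, lower_semicontinuous (f n)) ->
  lower_semicontinuous (fun x => ereal_sup (range (f ^~ x))).
Proof.
move=> lf x r /ereal_sup_gt[_ [n _ <-]] /(lf n)[V xV HV]; exists V => // y /HV h.
by apply: (lt_le_trans h); apply: ereal_sup_ubound; exists n.
Qed.

Lemma lscD f g : (forall x, 0 <= f x) -> (forall x, 0 <= g x) ->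
  lower_semicontinuous f -> lower_semicontinuous g ->
  lower_semicontinuous (fun x => f x + g x).
Proof.
move=> f0 g0 lf lg x l lt.
have [r [rf rg]] : exists r : R, r%:E < f x /\ (l - r)%:E < g x.
  have := f0 x; have := g0 x; move: lt.
  case: (f x) => [a| |]; case: (g x) => [b| |]//.
  - rewrite -EFinD !lte_fin => lab _ _; exists (a - (a + b - l) / 2)%R.
    by rewrite !lte_fin; split; lra.
  - by move=> _ _ _; exists (a - 1)%R; rewrite lte_fin ltry; split => //; lra.
  - move=> _ b0 _; exists (l + 1)%R; rewrite ltry lte_fin; split => //.
    by move: b0; rewrite lee_fin; lra.
  - by move=> _ _ _; exists 0%R; rewrite !ltry.
have [V xV HV] := lf _ _ rf; have [W xW HW] := lg _ _ rg.
exists (V `&` W); first exact: filterI.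
move=> y [/HV h1 /HW h2]; rewrite (_ : l%:E = r%:E + (l - r)%:E); first exact: lteD.
by rewrite -EFinD; congr (_%:E); lra.
Qed.

Lemma lscZ (k : R) f : (0 <= k)%R -> (forall x, 0 <= f x) -> lower_semicontinuous f ->
  lower_semicontinuous (fun x => k%:E * f x).
Proof.
move=> k0 f0 lf x l; move: k0; rewrite le_eqVlt => /orP[/eqP <-|k0].
  by rewrite mul0e => lt; exists setT; [exact: filterT|move=> y _; rewrite mul0e].
rewrite muleC -lte_pdivrMr// -EFinM => /lf[V xV HV]; exists V => // y /HV.
by rewrite EFinM lte_pdivrMr// muleC.
Qed.

Lemma lsc_sum (I : Type) (s : seq I) (F : I -> T -> \bar R) :
  (forall i x, 0 <= F i x) -> (forall i, lower_semicontinuous (F i)) ->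
  lower_semicontinuous (fun x => \sum_(i <- s) F i x).
Proof.
move=> F0 lF; elim: s => [|i s IH].
  by move=> x l; rewrite big_nil => lt; exists setT; [exact: filterT|move=> y _; rewrite big_nil].
move=> x l; rewrite big_cons => lt.
have [|V xV HV] := lscD (F0 i) _ (lF i) IH lt; first by move=> y; exact: sume_ge0.
by exists V => // y /HV; rewrite big_cons.
Qed.

Lemma continuous_lsc f : continuous f -> lower_semicontinuous f.
Proof.
move=> cf x l lt; exists [set y | l%:E < f y] => //.
exact: (cf x [set u | l%:E < u] (open_nbhs_nbhs (conj (@open_ereal_gt_ereal _ _) lt))).
Qed.

End lower_semicontinuity.

Section metric_lsc.
Context {R : realType}.

Lemma lsc_measurable (X : pmetricType R) (f : X -> \bar R) :
  lower_semicontinuous f -> measurable_fun setT (f : borelType X -> \bar R).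
Proof.
move=> /lower_semicontinuousP lf.
apply: (@measurability _ _ (borelType X) (\bar R) setT _ _ (ErealGenOInfty.measurableE R)).
move=> /= _ [_ [a ->]] <-; apply: measurableI => //.
by rewrite preimage_itvoy; apply: open_measurable_borel; exact: lf.
Qed.

Lemma inf_compact_lsc (A : pmetricType R) (f : A -> \bar R) :
  inf_compact f -> lower_semicontinuous f.
Proof.
move=> cf; apply: closed_lsc => r; apply: compact_closed; first exact: metric_hausdorff.
exact: compact_level.
Qed.

(** The sublevel sets of the sum are closed subsets of those of [f]. *)
Lemma inf_compactD (A : pmetricType R) (f g : A -> \bar R) :
  (forall x, 0 <= f x) -> (forall x, 0 <= g x) ->
  inf_compact f -> lower_semicontinuous g -> inf_compact (fun a => f a + g a).
Proof.
move=> f0 g0 cf lg l; rewrite setTI.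
have lfg := lscD f0 g0 (inf_compact_lsc cf) lg.
rewrite (_ : [set _ | _] = [set a | f a <= l%:E] `&` [set a | f a + g a <= l%:E]).
  by apply: compact_subset_closed; [exact: compact_level|exact: (lsc_closed lfg)].
apply/seteqP; split=> a /=; last by case.
by move=> h; split => //; apply: le_trans h; rewrite leeDl.
Qed.

(** A lower semicontinuous function is the limit of the increasing sequence of
    its truncated Lipschitz regularizations. *)
Section regularization.
Context (X : pmetricType R) (g : X -> \bar R).
Hypotheses (g0 : forall x, 0 <= g x) (lg : lower_semicontinuous g).

Definition regularization (n : nat) (x : X) : R :=
  inf (range (fun y => fine (Order.min (g y) n%:R%:E) + n%:R * mdist x y)%R).

Let t n y : R := fine (Order.min (g y) n%:R%:E).

Let tE n y : (t n y)%:E = Order.min (g y) n%:R%:E.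
Proof.
rewrite /t fineK// ge0_fin_numE; last by rewrite le_min g0 lee_fin ler0n.
by rewrite gt_min ltry orbT.
Qed.

Let t0 n y : (0 <= t n y)%R.
Proof. by rewrite -lee_fin tE le_min g0 lee_fin ler0n. Qed.

Let reg0 n x y : (0 <= t n y + n%:R * mdist x y)%R.
Proof. by rewrite addr_ge0// mulr_ge0// mdist_ge0. Qed.

Let has_lb n x : has_lbound (range (fun y => t n y + n%:R * mdist x y)%R).
Proof. by exists 0%R => _ [y _ <-]. Qed.

Lemma regularization_ge0 n x : (0 <= regularization n x)%R.
Proof.
apply: lb_le_inf; first by exists (t n x + n%:R * mdist x x)%R; exists x.
by move=> _ [y _ <-]; exact: reg0.
Qed.

Lemma regularization_le n x y : (regularization n x <= t n y + n%:R * mdist x y)%R.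
Proof. by apply: ge_inf; [exact: has_lb|exists y]. Qed.

Lemma regularization_lipschitz n x x' :
  (regularization n x <= regularization n x' + n%:R * mdist x x')%R.
Proof.
rewrite -lerBlDr; apply: lb_le_inf; first by exists (t n x + n%:R * mdist x' x)%R; exists x.
move=> _ [y _ <-]; rewrite lerBlDr; apply: le_trans (regularization_le n x y) _.
rewrite -addrA lerD2l -mulrDr ler_wpM2l//.
by rewrite addrC; exact: metric_triangle.
Qed.

Lemma regularization_le_n n x : (regularization n x <= n%:R)%R.
Proof.
apply: le_trans (regularization_le n x x) _; rewrite mdistxx mulr0 addr0.
by rewrite -lee_fin tE ge_min lexx orbT.
Qed.

Lemma regularization_le_fun n x : (regularization n x)%:E <= g x.
Proof.
apply: (@le_trans _ _ (t n x)%:E); last by rewrite tE ge_min lexx.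
by rewrite lee_fin; apply: le_trans (regularization_le n x x) _; rewrite mdistxx mulr0 addr0.
Qed.

Lemma regularization_mono n x : (regularization n x <= regularization n.+1 x)%R.
Proof.
apply: lb_le_inf; first by exists (t n.+1 x + n.+1%:R * mdist x x)%R; exists x.
move=> _ [y _ <-]; apply: le_trans (regularization_le n x y) _; apply: lerD.
  rewrite -lee_fin !tE le_min !ge_min lexx /=.
  by rewrite lee_fin ler_nat leqnSn orbT.
by rewrite ler_wpM2r ?mdist_ge0// ler_nat.
Qed.

Lemma regularization_sup x : ereal_sup (range (fun n => (regularization n x)%:E)) = g x.
Proof.
apply/eqP; rewrite eq_le; apply/andP; split.
  by apply: ge_ereal_sup => _ [n _ <-]; exact: regularization_le_fun.
rewrite leNgt; apply/negP => /[dup] lt.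
have s0 : 0 <= ereal_sup (range (fun n => (regularization n x)%:E)).
  apply: le_trans (ereal_sup_ubound _); last by exists 0%N.
  by rewrite lee_fin regularization_ge0.
have [r rE] : exists r : R, ereal_sup (range (fun n => (regularization n x)%:E)) = r%:E.
  move: s0 lt; case: (ereal_sup _) => [r| |]//; first by exists r.
  by move=> _; rewrite ltNge leey.
have r0 : (0 <= r)%R by rewrite -lee_fin -rE.
rewrite rE => /[dup] rg /lte_real_between[s rs sg].
have [V /nbhs_mdist[d d0 dV] HV] := lg sg.
have [n [ns nd]] : exists n : nat, (s <= n%:R)%R /\ (s <= n%:R * d)%R.
  have s0' : (0 <= s)%R by rewrite (le_trans r0)// ltW.
  exists (maxn (Num.bound s) (Num.bound (s / d))); split.
    by rewrite (le_trans (ltW (archi_boundP s0')))// ler_nat leq_maxl.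
  rewrite -ler_pdivrMr// (le_trans (ltW (archi_boundP _)))//; first by rewrite divr_ge0// ltW.
  by rewrite ler_nat leq_maxr.
have : (s <= regularization n x)%R.
  apply: lb_le_inf; first by exists (t n x + n%:R * mdist x x)%R; exists x.
  move=> _ [y _ <-]; have [xy|xy] := ltP (mdist x y) d.
    apply: (@le_trans _ _ (t n y)); last by rewrite lerDl mulr_ge0// mdist_ge0.
    rewrite -lee_fin tE le_min lee_fin ns andbT ltW//; apply: HV; exact: dV.
  apply: (le_trans nd); apply: (@le_trans _ _ (n%:R * mdist x y)%R).
    by rewrite ler_wpM2l.
  by rewrite lerDr t0.
have : (regularization n x)%:E <= r%:E by rewrite -rE; apply: ereal_sup_ubound; exists n.
by rewrite lee_fin => h1 h2; have := lt_le_trans rs (le_trans h2 h1); rewrite ltxx.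
Qed.

Lemma continuous_regularization n : continuous (regularization n).
Proof.
move=> x; apply/cvgrPdist_lt => e e0; near=> y.
have xy : (n.+1%:R * mdist x y < e)%R.
  rewrite mulrC -ltr_pdivlMr//; near: y; apply/nbhs_mdist.
  by exists (e / n.+1%:R)%R => //; rewrite divr_gt0.
have h1 := regularization_lipschitz n x y; have h2 := regularization_lipschitz n y x.
have h3 : (n%:R * mdist x y <= n.+1%:R * mdist x y)%R by rewrite ler_wpM2r ?mdist_ge0// ler_nat.
by move: h2; rewrite (metric_sym y x) ltr_norml => h2; apply/andP; split; lra.
Unshelve. all: by end_near. Qed.

Lemma bounded_regularization n : bounded_fun (regularization n).
Proof.
exists n%:R; split; first exact: num_real.
move=> M nM x _; rewrite /= ger0_norm ?regularization_ge0//.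
by rewrite (le_trans (regularization_le_n n x))// ltW.
Qed.

End regularization.

End metric_lsc.

Section metric_sequences.
Context {R : realType} {X A : pmetricType R}.

Lemma compact_cvg_range (x : nat -> X) (l : X) :
  (forall e : R, (0 < e)%R -> exists N, forall n, (N <= n)%N -> (mdist l (x n) < e)%R) ->
  compact (range x `|` [set l]).
Proof.
move=> xl F FF FK.
have [clF|/existsNP[B /existsNP[U]]] := pselect (cluster F l).
  by exists l; split => //; right.
move=> /not_implyP[FB /not_implyP[/nbhs_mdist[e e0 eU] BU]].
have [N HN] := xl e e0.
have FN : F (x @` `I_N).
  apply: filterS (filterI FK FB) => y [Ky By].
  have nUy : ~ U y by move=> Uy; apply: BU; exists y.
  case: Ky => [[n _ xn]|/= yl]; last by exfalso; apply: nUy; apply: eU; rewrite yl mdistxx.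
  exists n => //=; rewrite ltnNge; apply/negP => Nn; apply: nUy; rewrite -xn.
  by apply: eU; exact: HN.
have [|p [[n _ pE] clp]] := @finite_compact X (x @` `I_N) _ F FF FN.
  exact: finite_image.
by exists p; split => //; left; exists n.
Qed.

Lemma closed_fst_ball (l : X) (e : R) : closed [set z : X * A | (mdist z.1 l <= e)%R].
Proof.
apply: (@closed_comp _ _ fst [set x | (mdist x l <= e)%R]); first by move=> z _; exact: cvg_fst.
exact: (@closed_mdist_le R X X id).
Qed.

Lemma closed_snd_ball (l : A) (e : R) : closed [set z : X * A | (mdist z.2 l <= e)%R].
Proof.
apply: (@closed_comp _ _ snd [set x | (mdist x l <= e)%R]); first by move=> z _; exact: cvg_snd.
exact: (@closed_mdist_le R A A id).
Qed.

Lemma mdist_eq (Y : metricType R) (x y : Y) :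
  (forall n : nat, (mdist x y <= n.+1%:R^-1)%R) -> x = y.
Proof.
move=> H; apply: mdist_positivity; apply/eqP; rewrite eq_le mdist_ge0 andbT.
apply/ler_addgt0Pr => e e0; rewrite add0r.
have [N _ HN] := near_infty_natSinv_lt (PosNum e0).
by apply: le_trans (H N) _; exact: ltW (HN N (leqnn N)).
Qed.

Lemma natSinv_small (e : R) : (0 < e)%R -> exists N, forall n, (N <= n)%N -> (n.+1%:R^-1 < e)%R.
Proof.
by move=> e0; have [N _ HN] := near_infty_natSinv_lt (PosNum e0); exists N => n; exact: HN.
Qed.

Lemma natSinv_le (N n : nat) : (N <= n)%N -> (n.+1%:R^-1 <= N.+1%:R^-1 :> R)%R.
Proof. by move=> Nn; rewrite lef_pV2 ?posrE// ler_nat. Qed.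

End metric_sequences.

(** * Bellman right-hand sides under the two continuity assumptions *)

Section stable_classes.
Context {R : realType} {X A : pmetricType R}.
Hypotheses (hX : borel_subset_of_polish X) (hA : borel_subset_of_polish A).
Local Notation XA := (borelType X * borelType A)%type.
Variables (q : R.-pker XA ~> borelType X) (c : X * A -> \bar R).
Hypotheses (mc : measurable_fun setT (c : XA -> \bar R)) (c0 : forall z, 0 <= c z).

Local Notation bell := (bellman q c).

Lemma measurable_esup d (T : measurableType d) (g : nat -> T -> \bar R) :
  (forall n, measurable_fun setT (g n)) ->
  measurable_fun setT (fun x => ereal_sup (range (g ^~ x))).
Proof.
move=> mg; rewrite (_ : (fun x => _) = (fun x => esups (g ^~ x) 0%N)).
  exact: measurable_fun_esups.
by apply/funext => x; congr ereal_sup; apply/seteqP; split => _ [n _ <-]; exists n.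
Qed.

Lemma bellman_lsc_inf_compact beta g x : (0 <= beta)%R -> (forall x, 0 <= g x) ->
  inf_compact (fun a => c (x, a)) ->
  lower_semicontinuous (fun a => \int[q (x, a)]_y g y) ->
  inf_compact (bell beta g x).
Proof.
move=> b0 g0 cf lg.
have I0 a : 0 <= \int[q (x, a)]_y g y by exact: kernel_integral_ge0.
apply: inf_compactD => //.
  by move=> a; rewrite mule_ge0.
exact: lscZ.
Qed.

Lemma measurable_bellman_op beta g : (0 <= beta)%R -> nnmX g ->
  (forall x, inf_compact (bell beta g x)) -> nnmX (bellman_op q c beta g).
Proof.
move=> b0 ng cf; have [g0 mg] := ng; split.
  by move=> x; apply: le_ereal_inf_tmp => _ [a _ <-]; exact: bellman_ge0.
have [|||phi [mphi Hphi]] := measurable_minimizer hX hA (f := fun z => bell beta g z.1 z.2).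
- exact: measurable_bellman.
- by move=> z; exact: bellman_ge0.
- exact: cf.
rewrite (_ : bellman_op q c beta g = fun x => bell beta g x (phi x)).
  have mZ : measurable_fun setT (fun x : borelType X => (x, phi x) : XA).
    by apply/measurable_fun_pair.
  exact: measurableT_comp (measurable_bellman q mc beta ng) mZ.
apply/funext => x; apply/eqP; rewrite eq_le bellman_op_le /=.
by apply: le_ereal_inf_tmp => _ [a _ <-]; exact: Hphi.
Qed.

Import HBNNSimple.

Section setwise.
Hypothesis cA : forall x, inf_compact (fun a => c (x, a)).
Hypothesis qA : setwise_continuous_in_action q.

(** The integral is the supremum of integrals of simple functions, which are
    continuous in the action by setwise continuity. *)
Lemma setwise_lsc g x : nnmX g -> lower_semicontinuous (fun a => \int[q (x, a)]_y g y).
Proof.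
move=> [g0 mg]; pose h := nnsfun_approx measurableT mg.
have hmono n m y : (n <= m)%N -> (h n y <= h m y)%R.
  by move=> nm; have /lefP := nd_nnsfun_approx measurableT mg nm; exact.
have hE y : g y = ereal_sup (range (fun n => (h n y)%:E)).
  have nd : nondecreasing_seq (fun n => (h n y)%:E).
    by move=> n m nm; rewrite lee_fin; exact: hmono.
  have := ereal_nondecreasing_cvgn nd => /cvg_lim <- //.
  by apply/esym/cvg_lim => //; apply: cvg_nnsfun_approx.
rewrite (_ : (fun a => _) = (fun a => ereal_sup (range (fun n => \int[q (x, a)]_y (h n y)%:E)))).
  apply: lsc_sup => n.
  rewrite (_ : (fun a => _) = (fun a : A => \sum_(r <- finmap.enum_fset (fset_set (range (h n))))
      (if (0 <= r)%R then r else 0%R)%:E * q (x, a) (h n @^-1` [set r]))).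
    apply: lsc_sum; first by move=> r a; rewrite mule_ge0// lee_fin; case: ifP.
    move=> r; apply: lscZ => //; first by case: ifP.
    by apply: continuous_lsc; apply: qA.
  apply/funext => a; rewrite integral_nnsfun// patch_setT sintegralE fsbig_finite//=.
  rewrite big_seq [RHS]big_seq; apply: eq_bigr => r.
  by rewrite in_fset_set// inE => -[y _ <-]; rewrite fun_ge0.
apply/funext => a; rewrite (eq_integral (fun y : borelType X => ereal_sup (range (fun n => (h n y)%:E)))).
  rewrite integral_sup//.
  - by move=> n; apply/measurable_EFinP.
  - by move=> n y; rewrite lee_fin.
  - by move=> n y; rewrite lee_fin; exact: hmono.
by move=> y _; exact: hE.
Qed.

Lemma setwise_stable : stable_class q c (@nnmX R X).
Proof.
have ic beta g x : (0 <= beta)%R -> nnmX g -> inf_compact (bell beta g x).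
  move=> b0 ng; apply: bellman_lsc_inf_compact => //; last exact: setwise_lsc.
  by case: ng.
split => //.
- move=> g ng gS; split.
    move=> x; apply: le_trans (ereal_sup_ubound _); last by exists 0%N.
    by case: (ng 0%N).
  by apply: measurable_esup => n; case: (ng n).
- by move=> beta g b0 ng; apply: measurable_bellman_op => // x; exact: ic.
Qed.

End setwise.

Section weak.
Hypothesis cK : K_inf_compact c.
Hypothesis qw : weakly_continuous q.

Definition nn_lsc (g : X -> \bar R) := (forall x, 0 <= g x) /\ lower_semicontinuous g.

Lemma nn_lsc_nnm g : nn_lsc g -> nnmX g.
Proof. by move=> [g0 lg]; split => //; exact: lsc_measurable. Qed.

(** The integral is the supremum of integrals of bounded continuous functions. *)
Lemma weak_lsc g : nn_lsc g -> lower_semicontinuous (fun z : X * A => \int[q z]_y g y).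
Proof.
move=> [g0 lg].
rewrite (_ : (fun z => _) = (fun z => ereal_sup (range (fun n => \int[q z]_y (regularization g n y)%:E)))).
  apply: lsc_sup => n; apply: continuous_lsc; apply: qw.
    exact: continuous_regularization.
  exact: bounded_regularization.
apply/funext => z.
rewrite (eq_integral (fun y : borelType X => ereal_sup (range (fun n => (regularization g n y)%:E)))).
  rewrite integral_sup//.
  - move=> n; apply: (@lsc_measurable _ _ (fun y => (regularization g n y)%:E)).
    apply: continuous_lsc => y; apply: cvg_EFin; first exact: nearW.
    exact: continuous_regularization.
  - by move=> n y; rewrite lee_fin regularization_ge0.
  - by move=> n y; rewrite lee_fin regularization_mono.
by move=> y _; rewrite regularization_sup.
Qed.

(** Convergent states and their limit form a compact set, over which the
    sublevel sets of [c] are compact; this is how actions are followed when the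
    state moves. *)
Lemma K_inf_compact_cluster (l : X) (r : R) (z : nat -> X * A) :
  (forall n, (mdist l (z n).1 < n.+1%:R^-1)%R) -> (forall n, c (z n) <= r%:E) ->
  exists2 a, c (l, a) <= r%:E &
    forall C N, closed C -> (forall n, (N <= n)%N -> C (z n)) -> C (l, a).
Proof.
move=> zl cz.
have cKl : compact (range (fun n => (z n).1) `|` [set l]).
  apply: compact_cvg_range => e e0; have [N HN] := natSinv_small e0.
  by exists N => n Nn; exact: lt_trans (zl n) (HN n Nn).
have cD := @cK _ (ex_intro _ l (or_intror erefl)) cKl r.
have [n|[x a] [_ cxa] Hp] := compact_seq_cluster cD (x := z).
  by split; [split => //=; left; exists n|exact: cz].
suff xl : x = l by rewrite xl in cxa Hp; exists a.
apply: mdist_eq => N; apply: (Hp [set z | (mdist z.1 l <= N.+1%:R^-1)%R] N).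
  exact: closed_fst_ball.
move=> n Nn /=; rewrite metric_sym; apply: le_trans (ltW (zl n)) _; exact: natSinv_le.
Qed.

Lemma K_inf_compact_lsc : lower_semicontinuous c.
Proof.
apply: closed_lsc => r -[x a] clz.
have Hn n : exists z : X * A, [/\ c z <= r%:E, (mdist x z.1 < n.+1%:R^-1)%R & (mdist a z.2 < n.+1%:R^-1)%R].
  have n0 : (0 < n.+1%:R^-1 :> R)%R by rewrite invr_gt0.
  have [|z [cz [z1 z2]]] := clz ([set x' | (mdist x x' < n.+1%:R^-1)%R] `*` [set a' | (mdist a a' < n.+1%:R^-1)%R]).
    exists ([set x' | (mdist x x' < n.+1%:R^-1)%R], [set a' | (mdist a a' < n.+1%:R^-1)%R]) => //=.
    by split; apply/nbhs_mdist; exists n.+1%:R^-1%R.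
  by exists z.
have /choice[z Hz] := Hn.
have [||a' ca' Ha'] := @K_inf_compact_cluster x r z.
- by move=> n; case: (Hz n).
- by move=> n; case: (Hz n).
suff <- : a' = a by [].
apply: mdist_eq => N; apply: (Ha' [set z | (mdist z.2 a <= N.+1%:R^-1)%R] N).
  exact: closed_snd_ball.
move=> n Nn /=; rewrite metric_sym; case: (Hz n) => _ _ h.
by apply: le_trans (ltW h) _; exact: natSinv_le.
Qed.

Lemma weak_inf_compact x : inf_compact (fun a => c (x, a)).
Proof.
move=> r; rewrite setTI.
have cx : compact ([set x] : set X) by exact: compact_set1.
have := @cK _ (ex_intro _ x erefl) cx r.
move=> cD; have := @continuous_compact _ _ snd _ _ cD.
move=> H; rewrite (_ : [set _ | _] = snd @` (([set x] `*` setT) `&` [set s | c s <= r%:E])).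
  by apply: H; apply: continuous_subspaceT => z; exact: cvg_snd.
apply/seteqP; split => a /=; first by move=> ca; exists (x, a).
by move=> [[x' a'] [[/= -> _] ca] <-].
Qed.

Lemma lsc_pair (f : X * A -> \bar R) x : lower_semicontinuous f -> lower_semicontinuous (fun a => f (x, a)).
Proof.
move=> lf a r /lf[V [[U W] /= [xU aW] UW] HV]; exists W => // b Wb.
by apply: HV; apply: UW; split => //=; exact: nbhs_singleton xU.
Qed.

Lemma bellman_lsc beta g : (0 <= beta)%R -> nn_lsc g ->
  lower_semicontinuous (fun z : X * A => bell beta g z.1 z.2).
Proof.
move=> b0 [g0 lg].
rewrite (_ : (fun z => _) = (fun z => c z + beta%:E * \int[q z]_y g y)); last by apply/funext => -[].
have I0 z : 0 <= \int[q z]_y g y by exact: kernel_integral_ge0.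
apply: lscD => //.
- by move=> z; rewrite mule_ge0.
- exact: K_inf_compact_lsc.
- by apply: lscZ => //; exact: weak_lsc.
Qed.

(** If the minimum is at most [s] at states converging to [x], then actions that
    achieve this level have a cluster point, which achieves it at [x]. *)
Lemma bellman_op_lsc beta g : (0 <= beta)%R -> nn_lsc g -> lower_semicontinuous (bellman_op q c beta g).
Proof.
move=> b0 ng x r /lte_real_between[s rs sx]; have [g0 lg] := ng.
apply: contrapT => H.
have Hn n : exists z : X * A, (mdist x z.1 < n.+1%:R^-1)%R /\ bell beta g z.1 z.2 <= s%:E.
  apply: contrapT => /forallNP nz; apply: H.
  exists [set x' | (mdist x x' < n.+1%:R^-1)%R].
    by apply/nbhs_mdist; exists n.+1%:R^-1%R => //; rewrite invr_gt0.
  move=> y xy; apply: (@lt_le_trans _ _ s%:E); first by rewrite lte_fin.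
  apply: le_ereal_inf_tmp => _ [a _ <-]; rewrite leNgt; apply/negP => lt.
  by apply: (nz (y, a)); split => //; exact: ltW.
have /choice[z Hz] := Hn.
have [||a _ Ha] := @K_inf_compact_cluster x s z.
- by move=> n; case: (Hz n).
- move=> n; case: (Hz n) => _; apply: le_trans; rewrite /bellman -surjective_pairing leeDl//.
  by rewrite mule_ge0//; exact: kernel_integral_ge0.
have : bell beta g x a <= s%:E.
  apply: (Ha [set z | bell beta g z.1 z.2 <= s%:E] 0%N).
    exact: lsc_closed (bellman_lsc b0 ng).
  by move=> n _; case: (Hz n).
by rewrite leNgt (lt_le_trans sx)// bellman_op_le.
Qed.

Lemma weak_stable : stable_class q c nn_lsc.
Proof.
have ic beta g x : (0 <= beta)%R -> nn_lsc g -> inf_compact (bell beta g x).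
  move=> b0 ng; apply: bellman_lsc_inf_compact => //; first by case: ng.
    exact: weak_inf_compact.
  exact: (@lsc_pair (fun z : X * A => \int[q z]_y g y) x (weak_lsc ng)).
split.
- exact: nn_lsc_nnm.
- exact: ic.
- move=> g ng gS; split; last by apply: lsc_sup => n; case: (ng n).
  move=> x; apply: le_trans (ereal_sup_ubound _); last by exists 0%N.
  by case: (ng 0%N).
- move=> beta g b0 ng; split; last exact: bellman_op_lsc.
  by move=> x; apply: le_ereal_inf_tmp => _ [a _ <-]; apply: bellman_ge0 => //; case: ng.
- split => // x r /= lt; exists setT => //; exact: filterT.
Qed.

End weak.
End stable_classes.

(** * Abel means and Cesaro means of the costs *)

Section abel.
Context {R : realType}.

(** Summation by parts turns the bounds on the partial sums into a bound on the
    weighted sums, because the weights decrease. *)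
Lemma abel_bound (g : nat -> R) (a B : R) n : (0 <= a <= 1)%R ->
  (forall N, \sum_(0 <= t < N) g t <= B)%R -> (\sum_(0 <= t < n) a ^+ t * g t <= B)%R.
Proof.
move=> /andP[a0 a1] HG; pose G n := (\sum_(0 <= t < n) g t)%R.
have an k : (0 <= a ^+ k)%R by rewrite exprn_ge0.
have H : (\sum_(0 <= t < n) a ^+ t * g t <= B * (1 - a ^+ n) + a ^+ n * G n)%R.
  elim: n => [|n IH]; first by rewrite big_geq// expr0 /G big_geq//; lra.
  have GS : (G n.+1 = G n + g n)%R by rewrite /G big_nat_recr.
  rewrite big_nat_recr//= -/(G _); apply: (@le_trans _ _ (B * (1 - a ^+ n) + a ^+ n * G n.+1)%R).
    by rewrite GS; move: IH; rewrite -/(G n); lra.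
  have : (0 <= (a ^+ n - a ^+ n.+1) * (B - G n.+1))%R.
    by rewrite mulr_ge0// subr_ge0; [rewrite exprS ler_piMl|exact: HG].
  lra.
apply: (le_trans H); have : (0 <= a ^+ n * (B - G n))%R.
  by rewrite mulr_ge0// subr_ge0; exact: HG.
lra.
Qed.

Lemma geometric_sum_le (a : R) n : (0 <= a < 1)%R -> (\sum_(0 <= t < n) a ^+ t <= (1 - a)^-1)%R.
Proof.
move=> /andP[a0 a1]; have a10 : (0 < 1 - a)%R by rewrite subr_gt0.
rewrite -[leRHS]mul1r ler_pdivlMr// mulrC big_mkord.
have := subrX1 a n; have : (0 <= a ^+ n)%R by rewrite exprn_ge0.
lra.
Qed.

(** Summation by parts compares the two means; the terms before [N0], where
    nothing bounds the partial sums, contribute the constant [B]. *)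
Lemma cesaro_abel (e : nat -> \bar R) (L : R) N0 : (forall t, 0 <= e t) -> (0 <= L)%R ->
  (forall N, (N0 <= N)%N -> \sum_(0 <= t < N) e t <= (L * N%:R)%:E) ->
  exists B : R, forall a : R, (0 <= a < 1)%R ->
    \sum_(0 <= t <oo) (a ^+ t)%:E * e t <= (B + L / (1 - a))%:E.
Proof.
move=> e0 L0 He.
have efin t : e t \is a fin_num.
  rewrite ge0_fin_numE//; apply: le_lt_trans (ltry (L * (maxn N0 t.+1)%:R)).
  apply: le_trans (He _ (leq_maxl _ _)).
  have tN : (t < maxn N0 t.+1)%N by exact: leq_maxr.
  rewrite (big_cat_nat (n := t))//=; last exact: ltnW.
  rewrite (big_ltn tN) addeCA leeDl// adde_ge0//; exact: sume_ge0.
have [r rE] : exists r : nat -> R, forall t, e t = (r t)%:E.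
  by exists (fun t => fine (e t)) => t; rewrite fineK.
have r0 t : (0 <= r t)%R by rewrite -lee_fin -rE.
have sumE N : \sum_(0 <= t < N) e t = (\sum_(0 <= t < N) r t)%R%:E.
  by rewrite -sumEFin; apply: eq_bigr.
pose B := (\sum_(0 <= t < N0) r t)%R.
exists B => a /[dup] a01 /andP[a0 a1].
have HB N : (\sum_(0 <= t < N) (r t - L) <= B)%R.
  rewrite sumrB [X in (_ - X)%R]big_const_nat subn0 iter_addr_0 -mulr_natr.
  have [NN|/ltnW NN] := leqP N0 N.
    have := He N NN; rewrite sumE lee_fin => h.
    have : (0 <= B)%R by apply: sumr_ge0.
    lra.
  have : (\sum_(0 <= t < N) r t <= B)%R.
    rewrite /B [leRHS](big_cat_nat (n := N))//= lerDl; exact: sumr_ge0.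
  have : (0 <= L * N%:R)%R by rewrite mulr_ge0.
  lra.
apply: lime_le.
  by apply: is_cvg_nneseries => t *; rewrite mule_ge0// lee_fin exprn_ge0.
apply: nearW => n; rewrite (eq_bigr (fun t => (a ^+ t * r t)%:E)); last first.
  by move=> t _; rewrite rE EFinM.
rewrite sumEFin lee_fin.
have h1 : (\sum_(0 <= t < n) a ^+ t * (r t - L) <= B)%R by apply: abel_bound => //; rewrite a0 ltW.
have h2 := geometric_sum_le n a01.
have h3 : (L * (\sum_(0 <= t < n) a ^+ t) <= L / (1 - a))%R by rewrite ler_wpM2l.
move: h1; rewrite (eq_bigr (fun t => a ^+ t * r t - L * a ^+ t)%R); last first.
  by move=> t _; rewrite mulrBr [(_ * L)%R]mulrC.
rewrite sumrB -mulr_sumr; lra.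
Qed.

Lemma limf_einf_le_esup (f : R -> \bar R) (F : set_system R) :
  ProperFilter F -> limf_einf f F <= limf_esup f F.
Proof.
move=> FF; rewrite limf_einfE limf_esupE.
apply: ge_ereal_sup => _ [V FV <-]; apply: le_ereal_inf_tmp => _ [W FW <-].
have [p [Vp Wp]] := filter_ex (filterI FV FW).
apply: (@le_trans _ _ (f p)); first by apply: ereal_inf_lbound; exists p.
by apply: ereal_sup_ubound; exists p.
Qed.

Lemma limn_esup_lt (u : nat -> \bar R) (l : \bar R) : limn_esup u < l ->
  exists N, forall n, (N <= n)%N -> u n < l.
Proof.
rewrite /limn_esup limf_esupE => /ereal_inf_lt[_ [V [N _ NV] <-] lt].
exists N => n Nn; apply: le_lt_trans lt; apply: ereal_sup_ubound; exists n => //.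
exact: NV.
Qed.

Lemma limn_esup_le (u : nat -> \bar R) (l : \bar R) N :
  (forall n, (N <= n)%N -> u n <= l) -> limn_esup u <= l.
Proof.
move=> ul; rewrite /limn_esup limf_esupE.
apply: (@le_trans _ _ (ereal_sup (u @` [set n | (N <= n)%N]))).
  by apply: ereal_inf_lbound; exists [set n | (N <= n)%N] => //; exists N.
by apply: ge_ereal_sup => _ [n Nn <-]; exact: ul.
Qed.

End abel.

Section vanishing_discount.
Context {R : realType} {X A : pmetricType R}.
Local Notation XA := (borelType X * borelType A)%type.
Variables (q : R.-pker XA ~> borelType X) (c : X * A -> \bar R).
Hypotheses (mc : measurable_fun setT (c : XA -> \bar R)) (c0 : forall z, 0 <= c z).
Implicit Types (pi : policy (X := X) (A := A) (R := R)).

Lemma v_finite_ge0 N pi x : 0 <= v_finite c q N 1 pi x.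
Proof.
by apply: integral_ge0 => w _; apply: sume_ge0 => t _; rewrite mule_ge0// lee_fin exprn_ge0.
Qed.

Lemma v_disc_ge0 (alpha : R) x : (0 <= alpha)%R -> 0 <= v_disc c q alpha x.
Proof.
move=> a0; apply: le_ereal_inf_tmp => _ [pi _ <-].
apply: integral_ge0 => w _; apply: nneseries_ge0 => t _ _.
by rewrite mule_ge0// lee_fin exprn_ge0.
Qed.

Lemma m_disc_ge0 (alpha : R) : (0 <= alpha)%R -> 0 <= m_disc c q alpha.
Proof. by move=> a0; apply: le_ereal_inf_tmp => _ [x _ <-]; exact: v_disc_ge0. Qed.

Lemma v_disc_policy_le_cesaro pi x (L : R) : w_policy c q pi x < L%:E ->
  exists B : R, forall a : R, (0 <= a < 1)%R -> v_disc_policy c q a pi x <= (B + L / (1 - a))%:E.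
Proof.
move=> wL; have [N0 HN0] := limn_esup_lt wL.
have L0 : (0 <= L)%R.
  rewrite -lee_fin; apply: le_trans (ltW (HN0 N0 (leqnn _))).
  by rewrite mule_ge0// ?v_finite_ge0// lee_fin invr_ge0.
have [|N|B HB] := @cesaro_abel R (expected_cost q c pi x) L N0.+1 _ L0.
- by move=> t; exact: expected_cost_ge0.
- case: N => [//|N] NN; have /ltW := HN0 N.+1 (ltnW NN).
  rewrite v_finiteE// (eq_bigr (expected_cost q c pi x)); last first.
    by move=> t _; rewrite expr1n mul1e.
  by rewrite muleC lee_pdivrMr// EFinM.
exists B => a /[dup] a01 /andP[a0 a1]; rewrite v_disc_policyE//; exact: HB.
Qed.

Lemma near_left_one (P : set R) (d : R) : (0 < d)%R ->
  (forall a : R, (1 - d < a < 1)%R -> P a) -> (1%R^'-) P.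
Proof.
move=> d0 HP; exists d => //= a /= ad a1; apply: HP; rewrite a1 andbT.
by move: ad; rewrite ltr_norml => /andP[_]; lra.
Qed.

(** The discounted cost of a policy with average cost below [L] is at most
    [B + L / (1 - alpha)], and [B] disappears after multiplication by
    [1 - alpha]. *)
Lemma w_upper_le_w_star : w_upper c q <= w_star c q.
Proof.
apply: le_ereal_inf_tmp => _ [x _ <-]; apply: le_ereal_inf_tmp => _ [pi _ <-].
rewrite leNgt; apply/negP => lt.
have [L [wL Lw]] : exists L : R, w_policy c q pi x < L%:E /\ L%:E < w_upper c q.
  have w0 : 0 <= w_policy c q pi x.
    apply: limf_esup_ge0 => [|N]; first exact: filter_not_empty.
    by rewrite mule_ge0// ?v_finite_ge0// lee_fin invr_ge0.
  have wfin : w_policy c q pi x \is a fin_num by rewrite ge0_fin_numE// (lt_le_trans lt)// leey.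
  move: lt; rewrite -(fineK wfin) => /lte_real_between[L h1 h2]; exists L.
  by rewrite lte_fin.
have /lte_real_between[L' LL' L'w] := Lw.
have [B HB] := v_disc_policy_le_cesaro wL.
have : w_upper c q <= L'%:E.
  rewrite /w_upper limf_esupE.
  pose V := [set a : R | (0 <= a < 1)%R /\ ((1 - a) * B <= L' - L)%R].
  apply: (@le_trans _ _ (ereal_sup ((fun a : R => (1 - a)%:E * m_disc c q a) @` V))).
    apply: ereal_inf_lbound; exists V => //.
    have B1 : (0 < `|B| + 1)%R by rewrite ltr_wpDl.
    pose d := Order.min 1%R ((L' - L) / (`|B| + 1))%R.
    have d0 : (0 < d)%R by rewrite lt_min ltr01 divr_gt0// subr_gt0.
    apply: (near_left_one d0) => a /andP[da a1].
    have d1 : (d <= 1)%R by rewrite ge_min lexx.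
    have dL : (d * (`|B| + 1) <= L' - L)%R by rewrite -ler_pdivlMr// ge_min lexx orbT.
    split; first by lra.
    apply: (@le_trans _ _ ((1 - a) * (`|B| + 1))%R).
      by rewrite ler_wpM2l ?subr_ge0 ?ltW// (le_lt_trans (ler_norm B))// ltrDl.
    by apply: le_trans dL; rewrite ler_wpM2r//; lra.
  apply: ge_ereal_sup => _ [a [a01 aB] <-]; have /andP[a0 a1] := a01.
  have a10 : (0 < 1 - a)%R by rewrite subr_gt0.
  apply: (@le_trans _ _ ((1 - a)%:E * (B + L / (1 - a))%:E)).
    rewrite lee_pmul2l//; apply: le_trans (HB a a01).
    apply: (@le_trans _ _ (v_disc c q a x)); first by apply: ereal_inf_lbound; exists x.
    by apply: ereal_inf_lbound; exists pi.
  rewrite -EFinM lee_fin mulrDr mulrCA divff ?gt_eqF// mulr1; lra.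
by rewrite leNgt L'w.
Qed.

Lemma m_disc_fin (a : R) : w_star c q < +oo -> (0 <= a < 1)%R -> m_disc c q a \is a fin_num.
Proof.
move=> /ereal_inf_lt[_ [x _ <-]] /ereal_inf_lt[_ [pi _ <-]] wlt a01.
have /andP[a0 a1] := a01; rewrite ge0_fin_numE ?m_disc_ge0//.
have w0 : 0 <= w_policy c q pi x.
  apply: limf_esup_ge0 => [|N]; first exact: filter_not_empty.
  by rewrite mule_ge0// ?v_finite_ge0// lee_fin invr_ge0.
have wfin : w_policy c q pi x \is a fin_num by rewrite ge0_fin_numE.
have wL : w_policy c q pi x < (fine (w_policy c q pi x) + 1)%:E.
  by rewrite EFinD fineK// lteDl// lte_fin.
have [B HB] := v_disc_policy_le_cesaro wL.
apply: le_lt_trans (ltry _); apply: le_trans (HB a a01).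
apply: (@le_trans _ _ (v_disc c q a x)); first by apply: ereal_inf_lbound; exists x.
by apply: ereal_inf_lbound; exists pi.
Qed.

Lemma w_lower_ge0 : 0 <= w_lower c q.
Proof.
rewrite /w_lower limf_einfE.
pose V := [set a : R | (0 <= a < 1)%R].
apply: (@le_trans _ _ (ereal_inf ((fun a : R => (1 - a)%:E * m_disc c q a) @` V))).
  apply: le_ereal_inf_tmp => _ [a /andP[a0 a1] <-].
  by rewrite mule_ge0// ?m_disc_ge0// lee_fin subr_ge0 ltW.
apply: ereal_sup_ubound; exists V => //.
apply: (@near_left_one _ 1) => // a; rewrite /V /=; lra.
Qed.

End vanishing_discount.

(** * The average-cost optimality equation *)

Section uniform_integrability.
Context {R : realType} d (T : measurableType d) (mu : {measure set T -> \bar R}).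
Hypothesis mu1 : mu setT = 1.

(** Cut [f n] at a level [K]: the truncated functions converge by dominated
    convergence, and uniform integrability bounds the rest. *)
Lemma integral_limit_le (f : nat -> T -> \bar R) (F : T -> \bar R) :
  (forall n, measurable_fun setT (f n)) -> (forall n x, 0 <= f n x) ->
  (forall x, f n x @[n --> \oo] --> F x) ->
  asymptotically_uniformly_integrable mu f ->
  forall e : R, (0 < e)%R -> exists N, forall n, (N <= n)%N ->
    \int[mu]_x f n x <= \int[mu]_x F x + e%:E.
Proof.
move=> mf f0 fF UI e e0.
have F0 x : 0 <= F x.
  rewrite -(cvg_lim _ (fF x))//; apply: lime_ge; first by apply/cvg_ex; exists (F x).
  by apply: nearW => n; exact: f0.
have mF : measurable_fun setT F by apply: emeasurable_fun_cvg => // x _; exact: fF.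
have [Foo|Foo] := eqVneq (\int[mu]_x F x) +oo.
  by exists 0%N => n _; rewrite Foo addye// leey.
have IFfin : \int[mu]_x F x \is a fin_num.
  by rewrite ge0_fin_numE ?ltey//; apply: integral_ge0.
have e20 : (0 < e / 2)%R by rewrite divr_gt0.
have [K [K0 HK]] : exists K : R, (0 <= K)%R /\
    limn_esup (fun n => \int[mu]_(z in [set z | K%:E <= f n z]) f n z) < (e / 2)%:E.
  have : (0 : \bar R) < (e / 2)%:E by rewrite lte_fin.
  move=> /(open_ereal_lt' (x := 0)) /UI [M [Mreal HM]].
  exists (Order.max M 0 + 1)%R; split.
    by rewrite addr_ge0// le_max lexx orbT.
  by apply: HM; rewrite (@le_lt_trans _ _ (Order.max M 0)%R) ?ltrDl// le_max lexx.
have [N1 HN1] := limn_esup_lt HK.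
pose g n x := Order.min (f n x) K%:E.
pose G x := Order.min (F x) K%:E.
have mg n : measurable_fun setT (g n) by exact: measurable_mine.
have mG : measurable_fun setT G by exact: measurable_mine.
have [||||| _ _ cv] := @dominated_convergence _ _ _ mu setT measurableT g G (cst K%:E).
- exact: mg.
- exact: mG.
- apply: aeW => x _; rewrite /g /G.
  apply: (cvg_comp2 (fF x) (cvg_cst K%:E)); exact: (@min_continuous _ (\bar R) (F x, K%:E)).
- apply/integrableP; split; first exact: measurable_cst.
  rewrite (@integral_eq_cst _ _ _ _ _ K%:E) ?ltry// => x /=.
  by rewrite ger0_norm.
- apply: aeW => x n _; rewrite gee0_abs; first by rewrite ge_min lexx orbT.
  by rewrite le_min f0 lee_fin.
have GF : \int[mu]_x G x <= \int[mu]_x F x.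
  apply: ge0_le_integral => //.
    by move=> x _; rewrite le_min F0 lee_fin.
  by move=> x _; rewrite ge_min lexx.
have [N2 HN2] : exists N2, forall n, (N2 <= n)%N -> \int[mu]_x g n x < \int[mu]_x F x + (e / 2)%:E.
  have lt : \int[mu]_x G x < \int[mu]_x F x + (e / 2)%:E.
    by rewrite (le_lt_trans GF)// lteDl// lte_fin.
  have [N _ HN] := cv _ (open_nbhs_nbhs (conj (@open_ereal_lt_ereal _ _) lt)).
  by exists N => n Nn; exact: HN.
exists (maxn N1 N2) => n; rewrite geq_max => /andP[n1 n2].
have mS : measurable [set z | K%:E <= f n z].
  by rewrite -[X in measurable X]setTI; exact: emeasurable_fun_c_infty.
have mr : measurable_fun setT (f n \_ [set z | K%:E <= f n z]).
  by apply/(@measurable_restrictT _ _ _ _ _ (f n) mS); exact: measurable_funTS.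
apply: (@le_trans _ _ (\int[mu]_x ((f n \_ [set z | K%:E <= f n z]) x + g n x))).
  apply: ge0_le_integral => //.
  - apply: emeasurable_funD => //.
  - move=> x _; rewrite /patch /g; case: ifPn => h.
      by rewrite leeDl// le_min f0 lee_fin.
    rewrite add0e le_min lexx /= ltW// ltNge; apply/negP => Kf.
    by move/negP: h; apply; rewrite inE.
rewrite ge0_integralD//; last first.
- by move=> x _; rewrite le_min f0 lee_fin.
- by move=> x _; apply: erestrict_ge0.
rewrite -integral_mkcond (splitr e) EFinD [leRHS]addeA [leLHS]addeC.
by apply: leeD; [exact: ltW (HN2 n n2)|exact: ltW (HN1 n n1)].
Qed.

End uniform_integrability.

Section optimality_equation.
Context {R : realType} {X A : pmetricType R}.
Hypotheses (hX : borel_subset_of_polish X) (hA : borel_subset_of_polish A).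
Local Notation XA := (borelType X * borelType A)%type.
Variables (q : R.-pker XA ~> borelType X) (c : X * A -> \bar R).
Hypotheses (mc : measurable_fun setT (c : XA -> \bar R)) (c0 : forall z, 0 <= c z).
Variable good : (X -> \bar R) -> Prop.
Hypothesis sg : stable_class q c good.
Variable alpha : nat -> R.
Hypotheses (alpha_range : forall n, (0 <= alpha n < 1)%R)
  (alpha_incr : nondecreasing_seq alpha) (alpha_cvg : alpha @ \oo --> (1%R : R)).
Local Notation u := (fun n => u_disc c q (alpha n)).
Local Notation m n := (m_disc c q (alpha n)).
Local Notation bell := (bellman q c).
Hypotheses (B_w : w_star c q < +oo)
  (B_u : forall x, limn_einf (fun n => u n x) < +oo)
  (LEC_ii : forall x, cvgn (fun n => u n x))
  (LEC_iii : forall x a, asymptotically_uniformly_integrable (q (x, a)) u)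
  (hm : (1 - alpha n)%:E * m n @[n --> \oo] --> w_lower c q).
Hypothesis good_einfs : forall k, good (fun x => einfs (fun n => u n x) k).

Let a0 n : (0 <= alpha n)%R. Proof. by case/andP: (alpha_range n). Qed.
Let a1 n : (alpha n < 1)%R. Proof. by case/andP: (alpha_range n). Qed.

Let U x := limn_einf (fun n => u n x).
Let g k x := einfs (fun n => u n x) k.

Let mfin n : m n \is a fin_num. Proof. exact: m_disc_fin. Qed.
Let m0 n : 0 <= m n. Proof. exact: m_disc_ge0. Qed.

Let u_ge0 n x : 0 <= u n x.
Proof. by rewrite /u_disc sube_ge0 ?mfin//; apply: ereal_inf_lbound; exists x. Qed.

Let vE n x : v_disc c q (alpha n) x = u n x + m n.
Proof. by rewrite /u_disc subeK. Qed.

Lemma relative_value_nnm n : nnmX (u n).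
Proof.
split; first exact: u_ge0.
have [gv _ _] := discounted_optimality hX hA mc c0 sg (a0 n).
have [_ mv] := stable_nnm sg gv.
apply: emeasurable_funB => //; exact: measurable_cst.
Qed.

Let nu n : nnmX (u n) := relative_value_nnm n.

Let UE x : U x = ereal_sup (range (g ^~ x)).
Proof.
rewrite /U limn_einf_lim; apply/cvg_lim => //.
by apply: ereal_nondecreasing_cvgn; exact: nondecreasing_einfs.
Qed.

Let g_mono k x : g k x <= g k.+1 x.
Proof. exact: nondecreasing_einfs. Qed.

Let g_le k n x : (k <= n)%N -> g k x <= u n x.
Proof. by move=> kn; apply: ereal_inf_lbound; exists n. Qed.

Let good_U : good U.
Proof. by rewrite (funext UE); apply: (stable_sup sg) => //; exact: good_einfs. Qed.

Let nU : nnmX U. Proof. exact: (stable_nnm sg good_U). Qed.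
Let ng k : nnmX (g k). Proof. exact: (stable_nnm sg (good_einfs k)). Qed.

Let Ufin x : U x \is a fin_num.
Proof. by rewrite ge0_fin_numE ?B_u//; case: nU. Qed.

Let u_cvg x : u n x @[n --> \oo] --> U x.
Proof.
by rewrite /U; rewrite (is_cvg_limn_einfE (@LEC_ii x)); exact: (@LEC_ii x).
Qed.

Let wl0 : 0 <= w_lower c q. Proof. exact: w_lower_ge0. Qed.

Let w_lower_le_upper : w_lower c q <= w_upper c q.
Proof. exact: limf_einf_le_esup. Qed.

Let wfin : w_lower c q \is a fin_num.
Proof.
rewrite ge0_fin_numE//; apply: le_lt_trans B_w.
exact: (le_trans w_lower_le_upper (w_upper_le_w_star q mc c0)).
Qed.

(** The discounted counterpart of [w_lower c q + U x]: the optimality equation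
    for the discount factor [alpha n], after subtraction of
    [alpha n * m (alpha n)], says that [lambda n x] is the minimum over [a] of
    [bell (alpha n) (u n) x a]. *)
Let lambda n x := (1 - alpha n)%:E * m n + u n x.

Let lambda_cvg x : lambda n x @[n --> \oo] --> w_lower c q + U x.
Proof. by apply: cvgeD => //; rewrite fin_num_adde_defr// Ufin. Qed.

Let bell_v n x a : bell (alpha n) (v_disc c q (alpha n)) x a =
  bell (alpha n) (u n) x a + (alpha n)%:E * m n.
Proof.
rewrite /bellman -addeA; congr (_ + _).
rewrite (eq_integral (fun y : borelType X => u n y + m n)); last by move=> y _; exact: vE.
rewrite ge0_integralD//; last by case: (nu n).
have -> : \int[q (x, a)]__ m n = m n by apply: integral_eq_cst => //; exact: prob_kernel.
by rewrite ge0_muleDr//; apply: integral_ge0 => y _; exact: u_ge0.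
Qed.

Let lambdaE n x : v_disc c q (alpha n) x = lambda n x + (alpha n)%:E * m n.
Proof.
rewrite vE /lambda [RHS]addeAC -ge0_muleDl ?lee_fin ?subr_ge0 ?(ltW (a1 n)) //.
by rewrite -EFinD subrK mul1e addeC.
Qed.

Let amfin n : (alpha n)%:E * m n \is a fin_num.
Proof. by rewrite fin_numM. Qed.

Let lambda_le n x a : lambda n x <= bell (alpha n) (u n) x a.
Proof.
have [_ h _] := discounted_optimality hX hA mc c0 sg (a0 n).
by have := h x a; rewrite bell_v lambdaE leeD2rE.
Qed.

Let lambda_attained n x : exists a, bell (alpha n) (u n) x a <= lambda n x.
Proof.
have [_ _ h] := discounted_optimality hX hA mc c0 sg (a0 n).
by have [a] := h x; rewrite bell_v lambdaE leeD2rE// => ?; exists a.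
Qed.

Let wU_fin x : w_lower c q + U x \is a fin_num.
Proof. by rewrite fin_numD wfin Ufin. Qed.

Let lambda_eventually x (e : R) : (0 < e)%R -> exists N, forall n, (N <= n)%N ->
  lambda n x <= w_lower c q + U x + e%:E /\ w_lower c q + U x <= lambda n x + e%:E.
Proof.
move=> e0.
have lt1 : w_lower c q + U x < w_lower c q + U x + e%:E by rewrite lteDl// lte_fin.
have lt2 : w_lower c q + U x - e%:E < w_lower c q + U x.
  by rewrite lteBlDr// lteDl// lte_fin.
have [N1 _ H1] := @lambda_cvg x _ (open_nbhs_nbhs (conj (@open_ereal_lt_ereal _ _) lt1)).
have [N2 _ H2] := @lambda_cvg x _ (open_nbhs_nbhs (conj (@open_ereal_gt_ereal _ _) lt2)).
exists (maxn N1 N2) => n; rewrite geq_max => /andP[n1 n2]; split.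
  exact: ltW (H1 n n1).
by have := ltW (H2 n n2); rewrite leeBlDr.
Qed.

(** The minimizers for the discount factors [alpha n] vary with [n], and so do
    the measures in the integrals. Replacing [u n] by the infimum [g k] of its
    tail makes the right-hand sides increase with [k]; then compactness gives
    one action that works for all [k], and monotone convergence for the fixed
    measure [q (x, a)] leads from [g k] to [U]. *)
Lemma average_equation_ge x : exists a, bell 1 U x a <= w_lower c q + U x.
Proof.
set l := w_lower c q + U x.
have lfin : l \is a fin_num := wU_fin x.
have [k|n k a nk|k e e0|a Ha] := @inf_compact_interchange R A
   (fun k => bell (alpha k) (g k) x) (fine l).
- exact: (stable_inf_compact sg (a0 k) (good_einfs k)).
- apply: bellman_mono => //; first exact: alpha_incr.
  move=> y; elim: k nk => [|k IH]; first by rewrite leqn0 => /eqP ->.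
  rewrite leq_eqVlt => /orP[/eqP ->//|]; rewrite ltnS => /IH /le_trans; apply.
  exact: g_mono.
- have [N HN] := lambda_eventually x e0.
  have [a Ha] := lambda_attained (maxn k N) x.
  exists a; rewrite EFinD fineK//; apply: le_trans (HN _ (leq_maxr k N)).1.
  apply: le_trans Ha; apply: bellman_mono => //.
  + by apply: alpha_incr; exact: leq_maxl.
  + by move=> y; apply: g_le; exact: leq_maxl.
exists a; rewrite (funext UE); apply: bellman_sup => //.
move=> k; rewrite /bellman mul1e.
have {}Ha n : c (x, a) + (alpha n)%:E * \int[q (x, a)]_y g n y <= l.
  by have := Ha n; rewrite fineK.
have I0 n : 0 <= \int[q (x, a)]_y g n y by apply: kernel_integral_ge0; case: (ng n).
have {}Ha n : (k <= n)%N -> c (x, a) + (alpha n)%:E * \int[q (x, a)]_y g k y <= l.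
  move=> kn; apply: le_trans (Ha n); rewrite leeD2l// lee_wpmul2l ?lee_fin//.
  apply: ge0_le_integral => //.
  - by move=> y _; case: (ng k).
  - by case: (ng k).
  - by case: (ng n).
  - move=> y _; elim: n kn => [|n IH]; first by rewrite leqn0 => /eqP ->.
    rewrite leq_eqVlt => /orP[/eqP ->//|]; rewrite ltnS => /IH /le_trans; apply.
    exact: g_mono.
have [N HN] : exists N, forall n, (N <= n)%N -> (2^-1 < alpha n)%R.
  have lt1 : (2^-1 < 1 :> R)%R by rewrite invf_lt1// ltr1n.
  have [N _ HN] := alpha_cvg (open_nbhs_nbhs (conj (@open_gt _ _) lt1)).
  by exists N.
move: Ha (I0 k); set I := (\int[q (x, a)]_y g k y).
case: I => [i| |//] Ha Ik; last first.
  have := Ha _ (leq_maxl k N); rewrite gt0_muley; last first.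
    by rewrite lte_fin (lt_trans _ (HN _ (leq_maxr k N)))// invr_gt0.
  by rewrite addey ?gt_eqF ?(lt_le_trans _ (c0 _))// leye_eq => /eqP loo; move: lfin; rewrite loo.
have cfin : c (x, a) \is a fin_num.
  rewrite ge0_fin_numE//; apply: (@le_lt_trans _ _ l); last by rewrite ltey_eq lfin.
  by apply: le_trans (Ha k (leqnn k)); rewrite leeDl// mule_ge0// lee_fin.
rewrite -(fineK cfin) -(fineK lfin) -EFinD lee_fin -lerBrDl.
have Hi n : (k <= n)%N -> (alpha n * i <= fine l - fine (c (x, a)))%R.
  by move=> /Ha; rewrite -(fineK cfin) -(fineK lfin) -EFinM -EFinD lee_fin lerBrDl.
have cvi : (alpha n * i)%R @[n --> \oo] --> (1 * i)%R.
  by apply: cvgM => //; exact: cvg_cst.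
rewrite -[i]mul1r -(cvg_lim _ cvi)//; apply: limr_le; first by apply/cvg_ex; exists (1 * i)%R.
by exists k => // n /= kn; exact: Hi.
Qed.

(** For a fixed action the inequality for [alpha n] passes to the limit, because
    uniform integrability bounds the limit of the integrals from above. *)
Lemma average_equation_le x a : w_lower c q + U x <= bell 1 U x a.
Proof.
rewrite /bellman mul1e; apply/lee_addgt0Pr => e e0.
have e20 : (0 < e / 2)%R by rewrite divr_gt0.
have [N1 HN1] := lambda_eventually x e20.
have qq1 : q (x, a) setT = 1 by exact: prob_kernel.
have [N2 HN2] := @integral_limit_le R _ _ (q (x, a)) qq1 u U
  (fun n => (nu n).2) u_ge0 u_cvg (LEC_iii x a) _ e20.
have [_ h1] := HN1 _ (leq_maxl N1 N2); have h2 := HN2 _ (leq_maxr N1 N2).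
have eE : e%:E = (e / 2)%:E + (e / 2)%:E by rewrite -EFinD -splitr.
apply: (le_trans h1); rewrite eE [leRHS]addeA leeD2r// -addeA.
apply: le_trans (lambda_le _ x a) _; rewrite /bellman leeD2l//.
apply: le_trans h2; rewrite -[leRHS]mul1e; apply: lee_wpmul2r.
  by apply: integral_ge0 => y _; exact: u_ge0.
by rewrite lee_fin ltW.
Qed.

(** The stationary policy that uses a minimizer [phi] has a cost of at most
    [U x + N * w_lower c q] over [N] steps. *)
Lemma w_star_le_lower : w_star c q <= w_lower c q.
Proof.
have [phi [mphi Hphi]] := bellman_minimizer hX hA mc c0 sg (@ler01 R) good_U.
pose x : X := point.
apply: (@le_trans _ _ (w_policy c q (stationary mphi) x)).
  apply: (@le_trans _ _ (w_opt c q x)); first by apply: ereal_inf_lbound; exists x.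
  by apply: ereal_inf_lbound; exists (stationary mphi).
apply/lee_addgt0Pr => e e0.
have HU y : bell 1 U y (phi y) <= w_lower c q + U y.
  by have [a Ha] := average_equation_ge y; exact: le_trans (Hphi y a) Ha.
pose N0 := (Num.bound (fine (U x) / e)).+1.
apply: (@limn_esup_le _ _ _ N0) => N NN.
have Npos : (0 < N%:R :> R)%R by rewrite ltr0n (leq_trans _ NN).
rewrite v_finiteE// muleC lee_pdivrMr//.
apply: le_trans (stationary_upper mc c0 mphi x N ler01 wl0 nU HU) _.
rewrite -(fineK (Ufin x)) -(fineK wfin).
rewrite (eq_bigr (fun=> (fine (w_lower c q))%:E)); last by move=> t _; rewrite expr1n mul1e.
rewrite sumEFin big_const_nat subn0 iter_addr_0 -EFinD -EFinD -EFinM lee_fin -mulr_natr.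
have : (fine (U x) <= e * N%:R)%R.
  rewrite mulrC -ler_pdivrMr//; apply: (@le_trans _ _ (Num.bound (fine (U x) / e))%:R)%R.
    by apply/ltW/archi_boundP; rewrite divr_ge0 ?(ltW e0)// fine_ge0//; case: nU.
  by rewrite ler_nat (leq_trans _ NN)// leqnSn.
lra.
Qed.

Theorem average_optimality :
  w_star c q = w_upper c q /\ w_upper c q = w_lower c q /\
  exists phi : X -> A,
    measurable_fun setT (phi : borelType X -> borelType A) /\
    forall x,
      w_lower c q + U x = c (x, phi x) + \int[q (x, phi x)]_y U y /\
      forall a, c (x, phi x) + \int[q (x, phi x)]_y U y <= c (x, a) + \int[q (x, a)]_y U y.
Proof.
have h1 := w_upper_le_w_star q mc c0.
have h2 := w_star_le_lower.
have h3 := w_lower_le_upper.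
have e1 : w_upper c q = w_lower c q.
  by apply/eqP; rewrite eq_le h3 andbT (le_trans h1).
split; first by apply/eqP; rewrite eq_le h1 andbT e1.
split => //.
have [phi [mphi Hphi]] := bellman_minimizer hX hA mc c0 sg (@ler01 R) good_U.
have bell1 x a : c (x, a) + \int[q (x, a)]_y U y = bell 1 U x a by rewrite /bellman mul1e.
exists phi; split => // x; rewrite bell1; split; last by move=> a; rewrite bell1; exact: Hphi.
apply/eqP; rewrite eq_le average_equation_le /=.
by have [a Ha] := average_equation_ge x; exact: le_trans (Hphi x a) Ha.
Qed.

End optimality_equation.

(** * The optimality equation for nonnegative costs *)

Section nonnegative_costs.
Context {R : realType} {X A : pmetricType R}.
Hypotheses (hX : borel_subset_of_polish X) (hA : borel_subset_of_polish A).
Local Notation XA := (borelType X * borelType A)%type.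

(** The infimum over a tail of the sequence is lower semicontinuous because the
    radius in the definition of equicontinuity does not depend on [n]. *)
Lemma equicontinuous_einfs (f : nat -> X -> \bar R) k : (forall n x, 0 <= f n x) ->
  lower_semi_equicontinuous f -> nn_lsc (fun x => einfs (fun n => f n x) k).
Proof.
move=> f0 [_ ef]; split.
  by move=> x; apply: le_ereal_inf_tmp => _ [n _ <-].
move=> x r /lte_real_between[s rs sg].
have [|d d0 Hd] := ef x ((s - r) / 2)%R; first by rewrite divr_gt0// subr_gt0.
exists [set y | (mdist x y < d)%R]; first by apply/nbhs_mdist; exists d.
move=> y xy; apply: (@lt_le_trans _ _ (s - (s - r) / 2)%:E).
  by rewrite lte_fin; lra.
apply: le_ereal_inf_tmp => _ [n kn <-]; apply: le_trans (ltW (Hd _ xy n)).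
rewrite EFinB leeB// ltW// (lt_le_trans sg)//.
by apply: ereal_inf_lbound; exists n.
Qed.

Variables (q : R.-pker XA ~> borelType X) (c : X * A -> \bar R).
Hypotheses (mc : measurable_fun setT (c : XA -> \bar R)) (c0 : forall z, 0 <= c z).
Variable alpha : nat -> R.
Hypotheses (alpha_range : forall n, (0 <= alpha n < 1)%R)
  (alpha_incr : nondecreasing_seq alpha) (alpha_cvg : alpha @ \oo --> (1%R : R)).
Local Notation u := (fun n => u_disc c q (alpha n)).
Hypotheses (B_w : w_star c q < +oo)
  (B_u : forall x, limn_einf (fun n => u n x) < +oo)
  (LEC_ii : forall x, cvgn (fun n => u n x))
  (LEC_iii : forall x a, asymptotically_uniformly_integrable (q (x, a)) u)
  (hab : [/\ K_inf_compact c, weakly_continuous q & lower_semi_equicontinuous u]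
    \/ (forall x, inf_compact (fun a => c (x, a))) /\ setwise_continuous_in_action q)
  (hm : (1 - alpha n)%:E * m_disc c q (alpha n) @[n --> \oo] --> w_lower c q).

Let u_nnm good (sg : stable_class q c good) n : nnmX (u n).
Proof. exact: (relative_value_nnm hX hA mc c0 sg alpha_range B_w). Qed.

Theorem average_optimality_nonnegative :
  w_star c q = w_upper c q /\ w_upper c q = w_lower c q /\
  let U x := limn_einf (fun n => u n x) in
  exists phi : X -> A,
    measurable_fun setT (phi : borelType X -> borelType A) /\
    forall x,
      w_lower c q + U x = c (x, phi x) + \int[q (x, phi x)]_y U y /\
      forall a, c (x, phi x) + \int[q (x, phi x)]_y U y <= c (x, a) + \int[q (x, a)]_y U y.
Proof.
have main good sg := @average_optimality _ _ _ hX hA q c mc c0 good sg _ alpha_range alpha_incr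
  alpha_cvg B_w B_u LEC_ii LEC_iii hm.
case: hab => [[cK qw ue]|[cA qA]].
  have sg := weak_stable c0 cK qw.
  apply: (main _ sg) => k; apply: equicontinuous_einfs => // n x.
  by case: (u_nnm sg n).
have sg := setwise_stable hX hA mc c0 cA qA.
apply: (main _ sg) => k; split.
  by move=> x; apply: le_ereal_inf_tmp => _ [n _ <-]; case: (u_nnm sg n).
by apply: measurable_fun_einfs => n; case: (u_nnm sg n).
Qed.

End nonnegative_costs.

(** * Adding a constant to the cost *)

Section extended_real_shifts.
Context {R : realType}.

Lemma ereal_inf_shift (I : Type) (f g : I -> \bar R) (r : R) :
  (forall i, f i = g i + r%:E) -> ereal_inf (range f) = ereal_inf (range g) + r%:E.
Proof.
move=> fg; apply/eqP; rewrite eq_le; apply/andP; split.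
  rewrite -leeBlDr//; apply: le_ereal_inf_tmp => _ [i _ <-]; rewrite leeBlDr// -fg.
  by apply: ereal_inf_lbound; exists i.
apply: le_ereal_inf_tmp => _ [i _ <-]; rewrite fg leeD2r//.
by apply: ereal_inf_lbound; exists i.
Qed.

Lemma limf_esup_shift_le (S : choiceType) (I : filteredType S) (f g : I -> \bar R) (F : set_system I) (r : R) :
  Filter F -> (\forall x \near F, f x <= g x + r%:E) ->
  limf_esup f F <= limf_esup g F + r%:E.
Proof.
move=> FF fg; rewrite -leeBlDr//; apply: le_ereal_inf_tmp => _ [V FV <-]; rewrite leeBlDr//.
apply: (@le_trans _ _ (ereal_sup (f @` (V `&` [set x | f x <= g x + r%:E])))).
  by apply: ereal_inf_lbound; exists (V `&` [set x | f x <= g x + r%:E]) => //; exact: filterI.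
apply: ge_ereal_sup => _ [x [Vx fgx] <-]; apply: le_trans fgx _; rewrite leeD2r//.
by apply: ereal_sup_ubound; exists x.
Qed.

Lemma limf_esup_shift (S : choiceType) (I : filteredType S) (f g : I -> \bar R) (F : set_system I) (r : R) :
  Filter F -> (\forall x \near F, f x = g x + r%:E) ->
  limf_esup f F = limf_esup g F + r%:E.
Proof.
move=> FF fg; apply/eqP; rewrite eq_le limf_esup_shift_le//=; last first.
  by apply: filterS fg => x ->.
rewrite -leeBrDr// -EFinN; apply: limf_esup_shift_le.
by apply: filterS fg => x ->; rewrite EFinN addeK.
Qed.

Lemma limf_einf_shift (S : choiceType) (I : filteredType S) (f g : I -> \bar R) (F : set_system I) (r : R) :
  Filter F -> (\forall x \near F, f x = g x + r%:E) ->
  limf_einf f F = limf_einf g F + r%:E.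
Proof.
move=> FF fg; rewrite /limf_einf (@limf_esup_shift _ _ (\- f) (\- g) F (- r)).
  by rewrite EFinN fin_num_oppeB// oppeK.
by apply: filterS fg => x /= ->; rewrite EFinN fin_num_oppeD.
Qed.

Lemma sube_shift (x y : \bar R) (r : R) : (x + r%:E) - (y + r%:E) = x - y.
Proof. by rewrite fin_num_oppeD// addeACA subee// adde0. Qed.

End extended_real_shifts.

(** The integral of [G] may be infinite, so additivity is applied to the positive
    and the negative parts; the latter is bounded by [r]. *)
Lemma integral_shift {R : realType} d (T : measurableType d) (P : probability T R)
    (G : T -> \bar R) (r : R) : (0 <= r)%R -> measurable_fun setT G ->
  (forall x, 0 <= G x + r%:E) ->
  \int[P]_x (G x + r%:E) = \int[P]_x G x + r%:E.
Proof.
move=> r0 mG G0.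
have Ir : \int[P]_x (fun=> r%:E) x = r%:E by apply: integral_eq_cst => //; exact: probability_setT.
have mp := measurable_funepos mG; have mn := measurable_funeneg mG.
have e1 : \int[P]_x (G x + r%:E) + \int[P]_x G^\- x = \int[P]_x G^\+ x + r%:E.
  rewrite -[in RHS]Ir -!ge0_integralD//; last exact: emeasurable_funD.
  apply: eq_integral => x _; rewrite funeposE funenegE.
  have := G0 x; case: (G x) => [g gr|_|]; [|by rewrite /= maxye maxNye adde0|by rewrite addNye].
  rewrite -EFinN -!EFin_max -!EFinD; congr EFin.
  have [g0|g0] := leP 0%R g; first by rewrite (@max_r _ _ (- g)%R) ?oppr_le0//; lra.
  by rewrite (@max_l _ _ (- g)%R) ?oppr_ge0 ?(ltW g0)//; lra.
have nfin : \int[P]_x G^\- x \is a fin_num.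
  rewrite ge0_fin_numE; last exact: integral_ge0.
  apply: (@le_lt_trans _ _ r%:E); last exact: ltry.
  rewrite -[leRHS]Ir; apply: ge0_le_integral => // z _; rewrite funenegE ge_max lee_fin r0 andbT.
  by rewrite leeNl -[leLHS]add0e leeBlDr//; exact: G0.
by rewrite [in RHS]integralE addeAC -e1 addeK.
Qed.

Section shifted_cost.
Context {R : realType} {X A : pmetricType R}.
Local Notation XA := (borelType X * borelType A)%type.
Variables (q : R.-pker XA ~> borelType X) (c : X * A -> \bar R) (k : R).
Hypotheses (mc : measurable_fun setT (c : XA -> \bar R)) (k0 : (0 <= k)%R)
  (ck : forall z, 0 <= c z + k%:E).

Definition shifted_cost (z : X * A) : \bar R := c z + k%:E.

Local Notation C := shifted_cost.

Lemma measurable_shifted_cost : measurable_fun setT (C : XA -> \bar R).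
Proof. by apply: emeasurable_funD => //; exact: measurable_cst. Qed.

Lemma shifted_costZ (b : R) z : (0 <= b)%R -> b%:E * C z = b%:E * c z + (b * k)%:E.
Proof. by move=> b0; rewrite muleDr// fin_num_adde_defl. Qed.

Let geo (alpha : R) N : R := (\sum_(0 <= t < N) alpha ^+ t * k)%R.

Lemma sum_shifted_cost (alpha : R) N (w : nat -> XA) : (0 <= alpha)%R ->
  \sum_(0 <= t < N) (alpha ^+ t)%:E * C (w t) =
  \sum_(0 <= t < N) (alpha ^+ t)%:E * c (w t) + (geo alpha N)%:E.
Proof.
move=> a0; rewrite /geo -sumEFin -big_split/=.
by apply: eq_bigr => t _; rewrite shifted_costZ// exprn_ge0.
Qed.

Lemma geo_cvg (alpha : R) : (0 <= alpha < 1)%R ->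
  (geo alpha N)%:E @[N --> \oo] --> (k / (1 - alpha))%:E.
Proof.
move=> /andP[a0 a1]; apply: cvg_EFin; first exact: nearW.
rewrite (_ : _ \o _ = series (geometric k alpha)).
  by apply: cvg_geometric_series; rewrite ger0_norm.
by apply/funext => N; apply: eq_bigr => t _; rewrite mulrC.
Qed.

Let Cge0 (alpha : R) (w : nat -> XA) t : (0 <= alpha)%R -> 0 <= (alpha ^+ t)%:E * C (w t).
Proof. by move=> a0; apply: mule_ge0; [rewrite lee_fin exprn_ge0|exact: ck]. Qed.

Lemma nneseries_shifted_cost (alpha : R) (w : nat -> XA) : (0 <= alpha < 1)%R ->
  \sum_(0 <= t <oo) (alpha ^+ t)%:E * C (w t) =
  \sum_(0 <= t <oo) (alpha ^+ t)%:E * c (w t) + (k / (1 - alpha))%:E.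
Proof.
move=> a01; have /andP[a0 a1] := a01.
have cC : cvgn (fun N => \sum_(0 <= t < N) (alpha ^+ t)%:E * C (w t)).
  by apply: is_cvg_nneseries => t *; exact: Cge0.
rewrite [X in _ = X + _](_ : _ = \sum_(0 <= t <oo) (alpha ^+ t)%:E * C (w t) - (k / (1 - alpha))%:E).
  by rewrite subeK.
apply/cvg_lim => //.
rewrite (_ : (fun N => _) = fun N => \sum_(0 <= t < N) (alpha ^+ t)%:E * C (w t) - (geo alpha N)%:E).
  apply: cvgeB => //; last exact: geo_cvg.
  by rewrite fin_num_adde_defl.
by apply/funext => N; rewrite sum_shifted_cost// addeK.
Qed.

Let mC := measurable_shifted_cost.

Let mcw t : measurable_fun setT (fun w : trajectoryType XA => C (w t)).
Proof. exact: measurableT_comp mC (measurable_coord t). Qed.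

Lemma v_finite_shift N pi x :
  v_finite C q N 1 pi x = v_finite c q N 1 pi x + (N%:R * k)%:E.
Proof.
have gE : geo 1 N = (N%:R * k)%R.
  rewrite /geo (eq_bigr (fun=> k)); last by move=> t _; rewrite expr1n mul1r.
  by rewrite big_const_nat subn0 iter_addr_0 mulr_natl.
have Nk0 : (0 <= N%:R * k)%R by rewrite mulr_ge0.
rewrite /v_finite -integral_shift//.
- by apply: eq_integral => w _; rewrite sum_shifted_cost// gE.
- rewrite (_ : (fun w => _) = fun w : trajectoryType XA =>
    \sum_(0 <= t < N) (1 ^+ t)%:E * C (w t) - (N%:R * k)%:E).
    apply: emeasurable_funB => //; apply: emeasurable_sum => t.
    exact: measurable_funeM.
  by apply/funext => w; rewrite sum_shifted_cost// gE addeK.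
- move=> w; rewrite -gE -sum_shifted_cost//.
  by apply: sume_ge0 => t _; exact: Cge0.
Qed.

Lemma v_disc_policy_shift alpha pi x : (0 <= alpha < 1)%R ->
  v_disc_policy C q alpha pi x = v_disc_policy c q alpha pi x + (k / (1 - alpha))%:E.
Proof.
move=> a01; have /andP[a0 a1] := a01.
have ka0 : (0 <= k / (1 - alpha))%R by rewrite divr_ge0// subr_ge0 ltW.
rewrite /v_disc_policy -integral_shift//.
- by apply: eq_integral => w _; rewrite nneseries_shifted_cost.
- rewrite (_ : (fun w => _) = fun w : trajectoryType XA =>
    \sum_(0 <= t <oo) (alpha ^+ t)%:E * C (w t) - (k / (1 - alpha))%:E).
    apply: emeasurable_funB => //; apply: ge0_emeasurable_sum => t.
      by move=> *; exact: Cge0.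
    by move=> *; exact: measurable_funeM.
  by apply/funext => w; rewrite nneseries_shifted_cost// addeK.
- move=> w; rewrite -nneseries_shifted_cost//.
  by apply: nneseries_ge0 => t *; exact: Cge0.
Qed.

Lemma v_disc_shift alpha x : (0 <= alpha < 1)%R ->
  v_disc C q alpha x = v_disc c q alpha x + (k / (1 - alpha))%:E.
Proof.
by move=> a01; apply: ereal_inf_shift => pi; exact: v_disc_policy_shift.
Qed.

Lemma m_disc_shift alpha : (0 <= alpha < 1)%R ->
  m_disc C q alpha = m_disc c q alpha + (k / (1 - alpha))%:E.
Proof.
by move=> a01; apply: ereal_inf_shift => x; exact: v_disc_shift.
Qed.

(** The relative values do not see a constant added to the cost; this is what
    transfers the hypotheses on them. *)
Lemma u_disc_shift alpha : (0 <= alpha < 1)%R -> u_disc C q alpha = u_disc c q alpha.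
Proof.
move=> a01; apply/funext => x; rewrite /u_disc (v_disc_shift x a01) (m_disc_shift a01).
exact: sube_shift.
Qed.

Lemma w_star_shift : w_star C q = w_star c q + k%:E.
Proof.
apply: ereal_inf_shift => x; apply: ereal_inf_shift => pi.
apply: limf_esup_shift; exists 1%N => // N /= N0.
rewrite v_finite_shift muleDr ?fin_num_adde_defl//; congr (_ + _).
by rewrite -EFinM mulrA mulVf ?mul1r// pnatr_eq0 -lt0n.
Qed.

Lemma normalized_m_disc_shift alpha : (0 <= alpha < 1)%R ->
  (1 - alpha)%:E * m_disc C q alpha = (1 - alpha)%:E * m_disc c q alpha + k%:E.
Proof.
move=> a01; have /andP[a0 a1] := a01.
rewrite (m_disc_shift a01) muleDr ?fin_num_adde_defl//; congr (_ + _).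
by rewrite -EFinM mulrCA mulfV ?mulr1// subr_eq0 gt_eqF.
Qed.

Let near_one : \forall alpha \near (1%R : R)^'-,
  (1 - alpha)%:E * m_disc C q alpha = (1 - alpha)%:E * m_disc c q alpha + k%:E.
Proof.
apply: (@near_left_one R _ 1%R) => // a /andP[a0 a1]; apply: normalized_m_disc_shift.
by rewrite a1 andbT; lra.
Qed.

Lemma w_lower_shift : w_lower C q = w_lower c q + k%:E.
Proof. exact: limf_einf_shift near_one. Qed.

Lemma w_upper_shift : w_upper C q = w_upper c q + k%:E.
Proof. exact: limf_esup_shift near_one. Qed.

Lemma inf_compact_on_shift (U : topologicalType) (D : set U) (f : U -> \bar R) :
  inf_compact_on D f -> inf_compact_on D (fun s => f s + k%:E).
Proof.
move=> Df l; have := Df (l - k)%R; congr (compact _); congr (_ `&` _).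
by apply/seteqP; split => s /=; rewrite EFinB leeBrDr.
Qed.

End shifted_cost.

(** * Costs that are bounded below *)

Unset Implicit Arguments.
Theorem corollary3p12 (R : realType) (X A : pmetricType R)
    (hX : borel_subset_of_polish X) (hA : borel_subset_of_polish A)
    (c : X * A -> \bar R)
    (c_meas : measurable_fun [set: borelType X * borelType A] c)
    (c_bounded_below : exists M : R, forall z, M%:E <= c z)
    (q : R.-pker (borelType X * borelType A) ~> borelType X)
    (alpha : nat -> R)
    (alpha_range : forall n, (0 <= alpha n < 1)%R)
    (alpha_incr : nondecreasing_seq alpha)
    (alpha_cvg : alpha @ \oo --> (1%R : R))
    (B_w : w_star c q < +oo)
    (B_u : forall x, limn_einf (fun n => u_disc c q (alpha n) x) < +oo)
    (LEC_ii : forall x, cvgn (fun n => u_disc c q (alpha n) x))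
    (LEC_iii : forall x a, asymptotically_uniformly_integrable (q (x, a))
                             (fun n => u_disc c q (alpha n)))
    (hab : [/\ K_inf_compact c, weakly_continuous q &
               lower_semi_equicontinuous (fun n => u_disc c q (alpha n))]
           \/
           (forall x, inf_compact (fun a => c (x, a))) /\
           setwise_continuous_in_action q)
    (hm : (1 - alpha n)%:E * m_disc c q (alpha n) @[n --> \oo] --> w_lower c q) :
  w_star c q = w_upper c q /\ w_upper c q = w_lower c q /\
  let u x := limn_einf (fun n => u_disc c q (alpha n) x) in
  exists phi : X -> A,
    measurable_fun [set: borelType X] (phi : borelType X -> borelType A) /\
    forall x,
      w_lower c q + u x = c (x, phi x) + \int[q (x, phi x)]_y u y /\
      forall a, c (x, phi x) + \int[q (x, phi x)]_y u y <=
                c (x, a) + \int[q (x, a)]_y u y.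

Proof.
have [M cM] := c_bounded_below.
pose k := Num.max 0%R (- M)%R.
have k0 : (0 <= k)%R by rewrite le_max lexx.
have ck z : 0 <= c z + k%:E.
  apply: (@le_trans _ _ (M%:E + k%:E)); last by rewrite leeD2r.
  by rewrite -EFinD lee_fin -lerBlDl sub0r le_max lexx orbT.
pose C := shifted_cost c k.
have mC : measurable_fun setT (C : borelType X * borelType A -> \bar R).
  exact: measurable_shifted_cost.
have uE n : u_disc C q (alpha n) = u_disc c q (alpha n).
  exact: (u_disc_shift q c_meas k0 ck (alpha_range n)).
have wE := w_star_shift q c_meas k0 ck.
have lE := w_lower_shift q c_meas k0 ck.
have upE := w_upper_shift q c_meas k0 ck.
have UE : (fun n => u_disc C q (alpha n)) = (fun n => u_disc c q (alpha n)).
  by apply/funext => n; exact: uE.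
have UxE x : (fun n => u_disc C q (alpha n) x) = (fun n => u_disc c q (alpha n) x).
  by apply/funext => n; rewrite uE.
have [||||||e1 [e2 [phi [mphi Hphi]]]] := @average_optimality_nonnegative R X A hX hA q C mC ck
  alpha alpha_range alpha_incr alpha_cvg.
- by rewrite wE; apply: lte_add_pinfty; [exact: B_w|exact: ltry].
- by move=> x; rewrite UxE; exact: B_u.
- by move=> x; rewrite UxE; exact: LEC_ii.
- by move=> x a; rewrite UE; exact: LEC_iii.
- rewrite UE; case: hab => [[cK qw ue]|[cA qA]].
    left; split; [|exact: qw|exact: ue].
    by move=> K K0 cptK; apply: inf_compact_on_shift; exact: cK.
  by right; split; [move=> x; apply: inf_compact_on_shift; exact: cA|exact: qA].
- rewrite lE (_ : (fun n => _) = fun n => (1 - alpha n)%:E * m_disc c q (alpha n) + k%:E).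
    by apply: cvgeD; [rewrite fin_num_adde_defl|exact: hm|exact: cvg_cst].
  by apply/funext => n; exact: (normalized_m_disc_shift q c_meas k0 ck (alpha_range n)).
have cancel x y : x + k%:E = y + k%:E -> x = y.
  by move=> /(congr1 (fun z => z - k%:E)); rewrite !addeK.
have cancel_le x y : x + k%:E <= y + k%:E -> x <= y by rewrite leeD2rE.
split; first by apply: cancel; rewrite -wE -upE.
split; first by apply: cancel; rewrite -lE -upE.
move=> u; exists phi; split; [exact: mphi|move=> x]; have [h1 h2] := Hphi x.
have UU : (fun y => limn_einf (fun n => u_disc C q (alpha n) y)) = u.
  by apply/funext => y; rewrite UxE.
have CE a : C (x, a) + \int[q (x, a)]_y u y = c (x, a) + \int[q (x, a)]_y u y + k%:E.
  by rewrite /C /shifted_cost addeAC.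
split.
  apply: cancel; rewrite (addeAC (w_lower c q)) -lE -(CE (phi x)) -UU.
  exact: h1.
move=> a; apply: cancel_le; rewrite -(CE (phi x)) -(CE a) -UU; exact: h2.
Qed.
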